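(* Let $\rho:(0,\infty)\to[0,\infty)$ be measurable such that $\Pi(dx)=\rho(x)\,dx$ satisfies $\Pi\{(0,\infty)\}=\infty$, $\Pi\{(x,\infty)\}<\infty$ for each $x>0$, and $\int_0^1 x\,\Pi(dx)<\infty$. Let $r>0$ and $\Theta(x):=x\rho(x)$, $x>0$. Let $\mathbb{B}^{(r)}$ be a negative binomial point process with distribution $\mathcal{BN}(r,\rho)$, and let $({}^{(r)}T_n)_{n\ge 0}$ be the sums of points remaining after successive size-biased picks from $\mathbb{B}^{(r)}$, with ${}^{(r)}T={}^{(r)}T_0$. For $s>0$ let $g_s$ be the probability density of ${}^{(s)}T=T(\mathbb{B}^{(s)})$, where $\mathbb{B}^{(s)}\sim\mathcal{BN}(s,\rho)$. (i) For each $n\in\mathbb{N}$, the joint density of $({}^{(r)}T,{}^{(r)}T_1,{}^{(r)}T_2,\ldots,{}^{(r)}T_n)$ with respect to Lebesgue measure is, for $t_0>t_1>\cdots>t_n>0$, $$f(t_0,t_1,\ldots,t_n)=r^{[n]}\,g_{r+n}(t_n)\prod_{i=0}^{n-1}\frac{\Theta(t_i-t_{i+1})}{t_i}.$$ (ii) $\{{}^{(r)}T,{}^{(r)}T_1,{}^{(r)}T_2,\ldots\}$ is a non-homogeneous Markov chain with transition density $$\mathbb{P}\big({}^{(r)}T_{n+1}\in dt_1\,\big|\,{}^{(r)}T_n=t\big)=(r+n)\,\frac{\Theta(t-t_1)}{t}\,\frac{g_{r+n+1}(t_1)}{g_{r+n}(t)}\,dt_1,$$ for each $n=0,1,2,\ldots$,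 $t>0$ and $0<t_1<t$.
   Context: Negative binomial point process: for $r>0$, $\mathbb{B}^{(r)}\sim\mathcal{BN}(r,\rho)$ (also written $\mathcal{BN}(r,\Pi)$, with $\Pi(dx)=\rho(x)dx$) means that $\mathbb{B}^{(r)}$ is a point process on $(0,\infty)$ with Laplace functional $\mathbb{E}(e^{-\mathbb{B}^{(r)}(f)})=\big(1+\int_0^\infty(1-e^{-f(x)})\Pi(dx)\big)^{-r}$ for all nonnegative measurable $f$. Equivalently, it is a Poisson point process with randomised intensity measure $\Gamma_r\Pi$, where $\Gamma_r$ is an independent Gamma$(r,1)$ random variable. Its points in decreasing order are $J_{(1)}\ge J_{(2)}\ge\cdots$, and $T(\mathbb{B}^{(r)})=\sum_i J_{(i)}$, which lies in $(0,\infty)$ almost surely. Size-biased picks: conditional on $\mathcal{J}=(J_{(i)})$, $\tilde J_1$ takes the value $J_{(i)}$ with probability $J_{(i)}/T(\mathbb{B}^{(r)})$; for $n\ge1$, conditional on $\mathcal{J}$ and $\tilde J_1,\ldots,\tilde J_n$, $\tilde J_{n+1}$ takes the value $J_{(j)}\in\mathcal{J}\setminus\{\tilde J_1,\ldots,\tilde J_n\}$ with probability $J_{(j)}/(T(\mathbb{B}^{(r)})-\sum_{i=1}^n\tilde J_i)$. The remaining sums are ${}^{(r)}T={}^{(r)}T_0=T(\mathbb{B}^{(r)})$ and ${}^{(r)}T_n={}^{(r)}T_{n-1}-\tilde J_n$, $n\ge1$. Notation: $r^{[n]}=r(r+1)\cdots(r+n-1)$, $r^{[0]}=1$. As usual,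 densities and conditional laws given $\{{}^{(r)}T_n=t\}$ are determined up to null sets. *)

(* Defs.v *)
From HB Require Import structures.
From mathcomp Require Import all_boot all_order all_algebra.
From mathcomp Require Import all_classical all_reals all_analysis measurable_realfun.

Set Implicit Arguments.
Unset Strict Implicit.
Unset Printing Implicit Defensive.

Import Order.TTheory GRing.Theory Num.Theory.
Import numFieldNormedType.Exports.

Local Open Scope classical_set_scope.
Local Open Scope ring_scope.

Section lebesgue_tuple.
Context {R : realType}.
Implicit Types n : nat.

Definition tuple_cons n (p : R * n.-tuple R) : n.+1.-tuple R :=
  [tuple of p.1 :: p.2].

Lemma measurable_tuple_cons n : measurable_fun [set: R * n.-tuple R]
  (@tuple_cons n).
Proof. exact: measurable_cons. Qed.

Section step.
Context n (m : {sigma_finite_measure set (n.-tuple R) -> \bar R}).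

Definition lebesgue_cons : set (n.+1.-tuple R) -> \bar R :=
  pushforward (@lebesgue_measure R \x m)%E (@tuple_cons n).

Let lebesgue_cons0 : lebesgue_cons set0 = 0%E.
Proof. by rewrite /lebesgue_cons /pushforward preimage_set0 measure0. Qed.

Let lebesgue_cons_ge0 A : (0 <= lebesgue_cons A)%E.
Proof. by rewrite /lebesgue_cons /pushforward measure_ge0. Qed.

Let lebesgue_cons_sigma_additive : semi_sigma_additive lebesgue_cons.
Proof.
move=> F mF tF mUF; rewrite /lebesgue_cons /pushforward preimage_bigcup.
apply: measure_semi_sigma_additive.
- by move=> k; rewrite -[X in measurable X]setTI; exact: measurable_tuple_cons.
- apply/trivIsetP => /= i j _ _ ij; rewrite -preimage_setI.
  by move/trivIsetP : tF => /(_ _ _ _ _ ij) ->//; rewrite preimage_set0.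
- rewrite -preimage_bigcup -[X in measurable X]setTI.
  exact: measurable_tuple_cons.
Qed.

HB.instance Definition _ := isMeasure.Build _ _ _ lebesgue_cons
  lebesgue_cons0 lebesgue_cons_ge0 lebesgue_cons_sigma_additive.

Let lebesgue_cons_sigma_finite : sigma_finite setT lebesgue_cons.
Proof.
have [F TF FE] : sigma_finite setT (@lebesgue_measure R \x m)%E.
  have /sigma_finiteP[F [TF ndF Foo]] := sigma_finiteT (@lebesgue_measure R).
  have /sigma_finiteP[G [TG ndG Goo]] := sigma_finiteT m.
  exists (fun k => F k `*` G k).
    rewrite -setXTT TF TG predeqE => -[x y]; split.
      move=> [/= [i _ Fix] [j _ Gjy]]; exists (maxn i j) => //; split.
      - by move: x Fix; exact/subsetPset/ndF/leq_maxl.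
      - by move: y Gjy; exact/subsetPset/ndG/leq_maxr.
    by move=> [i _ []/= ? ?]; split; exists i.
  move=> k; have [? ?] := Foo k; have [? ?] := Goo k.
  split; first exact: measurableX.
  by rewrite product_measure1E// lte_mul_pinfty// ge0_fin_numE.
pose un (t : n.+1.-tuple R) : R * n.-tuple R := (thead t, [tuple of behead t]).
have unK : cancel (@tuple_cons n) un.
  by case=> x t; rewrite /un /tuple_cons/=; congr pair; apply: val_inj.
have mun : measurable_fun setT un.
  apply/measurable_fun_pairP; split.
    exact: measurable_tnth.
  exact: measurable_behead.
exists (fun k => un @^-1` F k).
  by rewrite -preimage_bigcup -TF preimage_setT.
move=> k; have [mFk Fk] := FE k; split.
  by rewrite -[X in measurable X]setTI; exact: mun.
rewrite /lebesgue_cons /pushforward.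
suff -> : @tuple_cons n @^-1` (un @^-1` F k) = F k by [].
by apply/seteqP; split => p /=; rewrite unK.
Qed.

HB.instance Definition _ := Measure_isSigmaFinite.Build _ _ _ lebesgue_cons
  lebesgue_cons_sigma_finite.

End step.

(* n-dimensional Lebesgue measure, as the n-fold product of the Lebesgue
   measure on R *)
Fixpoint lebesgue_tuple n : {sigma_finite_measure set (n.-tuple R) -> \bar R} :=
  match n with
  | 0 => dirac ([tuple] : 0.-tuple R)
  | k.+1 => lebesgue_cons (lebesgue_tuple k)
  end.

End lebesgue_tuple.

Section levy_density.
Context {R : realType}.
Notation mu := (@lebesgue_measure R).
Implicit Type rho : R -> R.

(* \int_(x in D) h(x) Pi(dx), where Pi(dx) = rho(x) dx *)
Definition levy_integral rho (D : set R) (h : R -> \bar R) : \bar R :=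
  (\int[mu]_(x in D) (h x * (rho x)%:E))%E.

Definition levy_measure rho (D : set R) : \bar R := levy_integral rho D (cst 1%E).

(* only the values of rho on (0,+oo) matter *)
Definition infinite_levy_density rho : Prop :=
  [/\ measurable_fun (`]0, +oo[ : set R) rho,
      forall x, 0 < x -> 0 <= rho x,
      levy_measure rho `]0, +oo[ = +oo%E,
      forall x, 0 < x -> (levy_measure rho `]x, +oo[ < +oo)%E &
      (levy_integral rho `]0%R, 1%R] (fun x => x%:E) < +oo)%E ].

End levy_density.

Section point_process.
Context d (T : measurableType d) (R : realType) (P : probability T R).
Implicit Types (B : R.-ker T ~> R) (J Jt : nat -> {RV P >-> R}) (X : nat -> T -> R).

(* J i is the (i+1)-st largest point of the random measure B *)
Definition ranked_points B J : Prop :=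
  (forall i w, 0 < J i w) /\
  {ae P, forall w, (forall i, J i.+1 w <= J i w) /\
    forall A, measurable A -> B w A = (\sum_(i <oo) \d_(J i w) A)%E}.

(* E e^{-B(f)} = (1 + \int (1 - e^{-f}) dPi)^{-r}; the quantities B(f) and
   \int (1 - e^{-f}) dPi may be infinite, with e^{-oo} = (+oo)^{-r} = 0 *)
Definition BN_laplace (r : R) (rho : R -> R) B : Prop :=
  forall f : R -> R,
    measurable_fun (`]0, +oo[ : set R) f -> (forall x, 0 < x -> 0 <= f x) ->
    (\int[P]_w expeR (- \int[B w]_(x in `]0%R, +oo[) (f x)%:E) =
     ((1 + levy_integral rho `]0%R, +oo[ (fun x => (1 - expR (- f x))%:E))
       `^ r)^-1)%E.

Definition BN_process (r : R) (rho : R -> R) B J : Prop :=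
  BN_laplace r rho B /\ ranked_points B J.

(* fine maps the (null) event of divergence to 0 *)
Definition sum_points J (w : T) : R := fine (\sum_(i <oo) (J i w)%:E)%E.

Definition preimages (I : set nat) X : set_system T :=
  \bigcup_(i in I) preimage_set_system setT (X i) measurable.

(* phi is a version of the conditional probability P(E | G) *)
Definition is_cond_prob (G : set_system T) (E : set T) (phi : T -> \bar R) :=
  (forall A : set (\bar R), measurable A -> G (phi @^-1` A)) /\
  forall F, G F -> P (E `&` F) = (\int[P]_(w in F) phi w)%E.

(* Jt n is the (n+1)-st size-biased pick *)
Definition size_biased_picks J Jt : Prop :=
  forall n j, is_cond_prob
    <<s preimages setT J `|` preimages `I_n Jt >>
    [set w | Jt n w = J j w]
    (fun w => (if [forall i : 'I_n, Jt i w != J j w]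
               then J j w / (sum_points J w - \sum_(i < n) Jt i w)
               else 0)%:E).

Fixpoint remaining_sum J Jt (n : nat) (w : T) : R :=
  match n with
  | 0 => sum_points J w
  | k.+1 => remaining_sum J Jt k w - Jt k w
  end.

Definition has_density d' (S : measurableType d') (m : set S -> \bar R)
    (X : T -> S) (f : S -> R) : Prop :=
  [/\ measurable_fun setT X, measurable_fun setT f, forall x, 0 <= f x &
      forall A, measurable A -> P (X @^-1` A) = (\int[m]_(x in A) (f x)%:E)%E].

(* P(X_{n+1} in C | X_0, ..., X_n) = P(X_{n+1} in C | X_n) almost surely *)
Definition markov_chain X : Prop :=
  (forall n, measurable_fun setT (X n)) /\
  forall n (C : set R), measurable C -> exists phi : T -> \bar R,
    is_cond_prob <<s preimages `I_n.+1 X >> (X n.+1 @^-1` C) phi /\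
    is_cond_prob <<s preimages [set n] X >> (X n.+1 @^-1` C) phi.

(* P(X_{n+1} in dy | X_n = x) = p n x y dy *)
Definition transition_density X (p : nat -> R -> R -> R) : Prop :=
  forall n (C : set R), measurable C ->
    is_cond_prob <<s preimages [set n] X >> (X n.+1 @^-1` C)
      (fun w => \int[@lebesgue_measure R]_(y in C) (p n (X n w) y)%:E)%E.

End point_process.

Section formulas.
Context {R : realType}.
Variables (r : R) (rho : R -> R) (g : R -> R -> R).

Definition rising (n : nat) : R := \prod_(i < n) (r + i%:R).

Definition Theta (x : R) : R := x * rho x.

Definition joint_density (n : nat) (t : n.+1.-tuple R) : R :=
  if [forall i : 'I_n, t`_i.+1 < t`_i] && (0 < t`_n) then
    rising n * g (r + n%:R) t`_n *
    \prod_(i < n) (Theta (t`_i - t`_i.+1) / t`_i)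
  else 0.

Definition trans_density (n : nat) (t t1 : R) : R :=
  if 0 < t1 < t then
    (r + n%:R) * (Theta (t - t1) / t) *
    (g (r + n%:R + 1) t1 / g (r + n%:R) t)
  else 0.

End formulas.

(* Main.v *)
(* Let B_r be BN(r, rho), and write T_n for the sums after n picks. Differentiating
   l |-> E e^{-B_r(f + l h)} at l = 0 yields a Mecke formula
     E[e^{-B_r(f)} B_r(h)] = r \int h e^{-f} dPi E[e^{-B_{r+1}(f)}]:
   removing a point x of B_r, weighted by r Pi(dx), leaves BN(r + 1, rho).
   Taking f + l|x| for f and using that Laplace transforms of measures on [0, +oo)
   determine them, the formula extends to include functions of the total sum.
   A size-biased pick is an integral against the remaining points with weight
   x / T_n, so n picks turn B_r into BN(r + n, rho) and contribute the factors
   (r + i) Theta(T_i - T_{i+1}) / T_i: this is proved by induction on n for the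
   joint law of (T_0, ..., T_n) and of the remaining points. Part (i) follows, and
   part (ii) because the joint density factorises along the path. The picks are
   well defined as the points of B_r are almost surely distinct, which is obtained
   from the Mecke formula by counting the points in short intervals. *)

(* The total sum may have infinite mean, since nothing makes [x] integrable against [Pi] near
   infinity. Laplace uniqueness, however, compares measures of finite mass. The weight [exp(-T)] is
   therefore built in by adding [|x|] to the test function, which makes the masses finite, and it is
   removed afterwards by a factor [exp(t)]. Test functions are bounded by a multiple of [|x|]: then
   [B_r(f)] is almost surely finite, and the total sum is among the [B_r(f)].

   The processes [BN(s)], [s = r + n], live on unrelated probability spaces and are never coupled:
   every comparison is an equality of integrals of nonnegative functions. To keep these free of sign
   conditions, quantities that are positive only almost surely enter through absolute values, and
   differences of integrals are rearranged into sums. The densities [g_s] come in only at the end,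
   as the laws of the total sums of the [BN(s)]. *)
Require Import Defs.
From HB Require Import structures.
From mathcomp Require Import all_boot all_order all_algebra.
From mathcomp Require Import all_classical all_reals all_analysis measurable_realfun.
From mathcomp Require Import ring lra.

Set Implicit Arguments.
Unset Strict Implicit.
Unset Printing Implicit Defensive.

Import Order.TTheory GRing.Theory Num.Theory.
Import numFieldNormedType.Exports.

Local Open Scope classical_set_scope.
Local Open Scope ring_scope.

(** * Integrals and weighted laws *)

Section ae_integral.
Local Open Scope ereal_scope.
Context d (T : measurableType d) (R : realType) (mu : {measure set T -> \bar R}).

Import HBNNSimple.

(** No measurability of [f] or [g] is required: a simple function below [f], set to 0 on the null
    set, lies below [g] and keeps its integral. *)
Lemma ge0_ae_le_integralT (f g : T -> \bar R) :
  (forall x, 0 <= f x) -> (forall x, 0 <= g x) ->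
  {ae mu, forall x, f x <= g x} -> \int[mu]_x f x <= \int[mu]_x g x.
Proof.
move=> f0 g0 [N [mN N0 sN]].
rewrite ge0_integralTE//; apply: ge_ereal_sup => _ [/= h hf <-].
pose k : {nnsfun T >-> R} := proj_nnsfun h (measurableC mN).
have kE x : k x = if x \in ~` N then h x else 0%R.
  by rewrite /k/= mindicE; case: (x \in ~` N); rewrite ?mulr1 ?mulr0.
have kg x : (k x)%:E <= g x.
  rewrite kE; case: ifPn => [|_]; last exact: g0.
  rewrite inE => xN; apply: le_trans (hf x) _.
  by apply: contrapT => fg; apply: xN; apply: sN.
rewrite (_ : sintegral mu h = sintegral mu k); last first.
  rewrite -!integralT_nnsfun; apply: ge0_ae_eq_integral => //.
  - exact/measurable_EFinP.
  - exact/measurable_EFinP.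
  - by move=> x _; rewrite lee_fin.
  - by move=> x _; rewrite lee_fin.
  - exists N; split => // x /= /not_implyP[_ ne]; apply: contrapT => xN; apply: ne.
    by move: (kE x); rewrite mem_set// => kx; congr EFin; exact: esym.
by rewrite [leRHS]ge0_integralTE//; apply: ereal_sup_ubound; exists k.
Qed.

Lemma ge0_ae_eq_integralT (f g : T -> \bar R) :
  (forall x, 0 <= f x) -> (forall x, 0 <= g x) ->
  {ae mu, forall x, f x = g x} -> \int[mu]_x f x = \int[mu]_x g x.
Proof.
move=> f0 g0 fg; apply/eqP; rewrite eq_le.
by rewrite !ge0_ae_le_integralT//; apply: filterS fg => x ->.
Qed.

End ae_integral.

Section ereal_limit.
Local Open Scope ereal_scope.

(** Multiplication is discontinuous at [0 * +oo], but monotonicity saves the limit: if [l = 0] the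
    sequence vanishes identically, and if [w = 0] both sides do. *)
Lemma nondecreasing_ge0_cvgeZl (R : realType) (w l : \bar R) (u : (\bar R)^nat) :
  0 <= w -> (forall n, 0 <= u n) -> nondecreasing_seq u ->
  u @ \oo --> l -> (w * u n) @[n --> \oo] --> w * l.
Proof.
move=> w0 u0 ndu ul.
have lE : l = ereal_sup (range u).
  by rewrite -(cvg_lim _ ul)//; apply/cvg_lim => //; exact: ereal_nondecreasing_cvgn.
have [l0|l0] := eqVneq l 0.
  have uE n : u n = 0.
    apply/eqP; rewrite eq_le u0 andbT -l0 lE.
    by apply: ereal_sup_ubound; exists n.
  by under eq_fun do rewrite uE mule0; rewrite l0 mule0; exact: cvg_cst.
have [->|w1] := eqVneq w 0.
  by under eq_fun do rewrite mul0e; rewrite mul0e; exact: cvg_cst.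
apply: cvgeM => //; last exact: cvg_cst.
by move: w w1 l l0 {w0 lE ul} => [?||] + [?||]; rewrite /mule_def// ?eqe.
Qed.

End ereal_limit.

Section weighted_law.
Local Open Scope ereal_scope.
Context d (T : measurableType d) d' (S : measurableType d') (R : realType).
Variables (mu : {measure set T -> \bar R}) (w : T -> \bar R) (Y : T -> S).

(** The side conditions are arguments of the definition, so that the measure structure can be
    attached to the term itself. *)
Definition wlaw of (forall x, 0 <= w x) & measurable_fun setT w &
    measurable_fun setT Y : set S -> \bar R :=
  fun A => \int[mu]_(x in Y @^-1` A) w x.

Hypotheses (w0 : forall x, 0 <= w x) (mw : measurable_fun setT w)
  (mY : measurable_fun setT Y).

Let wl := wlaw w0 mw mY.

Let wl0 : wl set0 = 0.
Proof. by rewrite /wl /wlaw preimage_set0 integral_set0. Qed.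

Let wl_ge0 A : 0 <= wl A.
Proof. exact: integral_ge0. Qed.

Let mpre A : measurable A -> measurable (Y @^-1` A).
Proof. by move=> mA; rewrite -[X in measurable X]setTI; exact: mY. Qed.

Let wl_sigma_additive : semi_sigma_additive wl.
Proof.
move=> F mF tF mUF; rewrite /wl /wlaw preimage_bigcup.
rewrite ge0_integral_bigcup//.
- by apply: is_cvg_nneseries => *; exact: integral_ge0.
- by move=> k; exact: mpre.
- exact: measurable_funTS.
- apply/trivIsetP => /= i j _ _ ij; rewrite -preimage_setI.
  by move/trivIsetP : tF => /(_ _ _ _ _ ij) ->//; rewrite preimage_set0.
Qed.

HB.instance Definition _ := isMeasure.Build _ _ _ (wlaw w0 mw mY)
  wl0 wl_ge0 wl_sigma_additive.

Import HBNNSimple.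

Lemma wlawE A : measurable A ->
  wlaw w0 mw mY A = \int[mu]_x (w x * (\1_A (Y x))%:E).
Proof.
move=> mA; rewrite /wlaw integral_mkcond; apply: eq_integral => x _.
rewrite patchE indicE.
have -> : (x \in Y @^-1` A) = (Y x \in A) by apply/idP/idP; rewrite !inE.
case: ifPn => _; first by rewrite mule1.
by rewrite mule0.
Qed.

Let integral_wlaw_nnsfun (h : {nnsfun S >-> R}) :
  \int[wlaw w0 mw mY]_y (h y)%:E = \int[mu]_x (w x * (h (Y x))%:E).
Proof.
rewrite integralT_nnsfun sintegralE.
transitivity (\sum_(k \in range h)
    \int[mu]_x (w x * (k * \1_(h @^-1` [set k]) (Y x))%:E)).
  apply: eq_fsbigr => k /[!inE] -[y _ hk].
  have k0 : (0 <= k)%R by rewrite -hk.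
  rewrite [X in _ * X](wlawE (measurable_sfunP h (measurable_set1 k)))/=.
  rewrite -ge0_integralZl//; last 2 first.
  - apply: emeasurable_funM => //; apply/measurable_EFinP.
    by apply: measurableT_comp.
  - by move=> x _; rewrite mule_ge0// lee_fin.
  by apply: eq_integral => x _; rewrite muleCA EFinM.
rewrite -ge0_integral_fsum//; last first.
- move=> k x _; have := nnfun_muleindic_ge0 h k (Y x).
  by move=> ?; rewrite mule_ge0.
- move=> k; apply: emeasurable_funM => //; apply/measurable_EFinP.
  by apply: measurable_funM => //; apply: measurableT_comp.
apply: eq_integral => x _.
rewrite fimfunE -fsumEFin// ge0_mule_fsumr//.
by move=> k; exact: nnfun_muleindic_ge0.
Qed.

Lemma integral_wlaw (psi : S -> \bar R) : (forall y, 0 <= psi y) ->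
  measurable_fun setT psi ->
  \int[wlaw w0 mw mY]_y psi y = \int[mu]_x (w x * psi (Y x)).
Proof.
move=> psi0 mpsi.
pose f_ := nnsfun_approx measurableT mpsi.
transitivity (limn (fun n => \int[wlaw w0 mw mY]_x (f_ n x)%:E)).
  rewrite -monotone_convergence//.
  - apply: eq_integral => y /[!inE] yD; apply/esym/cvg_lim => //.
    by apply: cvg_nnsfun_approx.
  - by move=> n; exact/measurable_EFinP/measurable_funP.
  - by move=> n y _; rewrite lee_fin.
  - by move=> y _ m n mn; rewrite lee_fin; exact/lefP/nd_nnsfun_approx.
rewrite [X in limn X](_ : _ = (fun n => \int[mu]_x (w x * (f_ n (Y x))%:E))); last first.
  by apply/funext => n; rewrite integral_wlaw_nnsfun.
rewrite -monotone_convergence//; last 3 first.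
- move=> n; apply: emeasurable_funM => //; apply/measurable_EFinP.
  exact: measurableT_comp.
- by move=> n x _; rewrite mule_ge0// lee_fin.
- move=> x _ m n mn; apply: lee_pmul => //; rewrite ?lee_fin//.
  exact/lefP/nd_nnsfun_approx.
apply: eq_integral => x _; apply/cvg_lim => //.
apply: nondecreasing_ge0_cvgeZl => //.
- by move=> n; rewrite lee_fin.
- by move=> m n mn; rewrite lee_fin; exact/lefP/nd_nnsfun_approx.
- exact: cvg_nnsfun_approx.
Qed.

End weighted_law.

Section weighted_law_unique.
Local Open Scope ereal_scope.
Context d1 (T1 : measurableType d1) d2 (T2 : measurableType d2)
  d' (S : measurableType d') (R : realType).
Variables (mu1 : {measure set T1 -> \bar R}) (mu2 : {measure set T2 -> \bar R}).
Variables (w1 : T1 -> \bar R) (w2 : T2 -> \bar R) (Y1 : T1 -> S) (Y2 : T2 -> S).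
Hypotheses (w10 : forall x, 0 <= w1 x) (w20 : forall x, 0 <= w2 x)
  (mw1 : measurable_fun setT w1) (mw2 : measurable_fun setT w2)
  (mY1 : measurable_fun setT Y1) (mY2 : measurable_fun setT Y2).

(** The tool for comparing laws across different spaces: an identity checked on indicators extends
    to all nonnegative measurable functions. *)
Lemma eq_integral_law :
  (forall A, measurable A -> \int[mu1]_x (w1 x * (\1_A (Y1 x))%:E) =
                             \int[mu2]_x (w2 x * (\1_A (Y2 x))%:E)) ->
  forall psi : S -> \bar R, (forall y, 0 <= psi y) -> measurable_fun setT psi ->
  \int[mu1]_x (w1 x * psi (Y1 x)) = \int[mu2]_x (w2 x * psi (Y2 x)).
Proof.
move=> h psi psi0 mpsi.
rewrite -(integral_wlaw mu1 w10 mw1 mY1)// -(integral_wlaw mu2 w20 mw2 mY2)//.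
apply: eq_measure_integral => A mA _.
by rewrite /= !wlawE// h.
Qed.

(** Uniqueness of measures on a pi-system. Since [setT] is in [G], the finite total mass supplies
    the exhausting sequence. *)
Lemma eq_integral_law_pi (G : set (set S)) :
  measurable = <<s G >> -> setI_closed G -> G setT ->
  (forall A, G A -> \int[mu1]_x (w1 x * (\1_A (Y1 x))%:E) =
                    \int[mu2]_x (w2 x * (\1_A (Y2 x))%:E)) ->
  \int[mu1]_x w1 x < +oo ->
  forall psi : S -> \bar R, (forall y, 0 <= psi y) -> measurable_fun setT psi ->
  \int[mu1]_x (w1 x * psi (Y1 x)) = \int[mu2]_x (w2 x * psi (Y2 x)).
Proof.
move=> mG GI GT h fin1; apply: eq_integral_law => A mA.
have sG B : G B -> measurable B by rewrite mG => ?; exact: sub_sigma_algebra.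
have -> : \int[mu1]_x (w1 x * (\1_A (Y1 x))%:E) = wlaw mu1 w10 mw1 mY1 A.
  by rewrite wlawE.
have -> : \int[mu2]_x (w2 x * (\1_A (Y2 x))%:E) = wlaw mu2 w20 mw2 mY2 A.
  by rewrite wlawE.
apply: (measure_unique G (fun=> setT)) => //.
- by rewrite -subTset => x _; exists 0%N.
- by move=> B GB /=; rewrite !wlawE; [exact: h|exact: sG|exact: sG].
Qed.

End weighted_law_unique.

(** * Uniqueness of Laplace transforms *)

Section limits.
Context (R : realType).

Lemma bernoulli_ineq (x : R) n : 0 <= x <= 1 -> 1 - n%:R * x <= (1 - x) ^+ n.
Proof.
move=> /andP[x0 x1]; elim: n => [|n ih]; first by rewrite mul0r subr0 expr0.
rewrite exprS; apply: (@le_trans _ _ ((1 - x) * (1 - n%:R * x))).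
  rewrite -natr1; have : 0 <= n%:R * x * x by rewrite !mulr_ge0.
  by nra.
by rewrite ler_wpM2l// subr_ge0.
Qed.

Lemma cvg_nmul_expRN (e : R) : 0 < e ->
  (n%:R * expR (- (n%:R * e))) @[n --> \oo] --> 0.
Proof.
(* From [expR x >= 1 + x^2 / 2] at [x = n e]: the term [4 / e^2] turns [(n e)^2 / 2] into [2 n^2],
   so that [C * (1 + (n e)^2 / 2)] exceeds [n (n + 1)]. *)
move=> e0; pose C := 2 + 4 / e ^+ 2.
apply: (@squeeze_cvgr _ _ _ _ (cst 0) (fun n => C * harmonic n)).
- apply: nearW => n; rewrite /= mulr_ge0 ?expR_ge0//=.
  have n0 : 0 <= n%:R :> R by [].
  have n1 : 0 < n.+1%:R :> R by [].
  rewrite expRN ler_pdivrMr ?expR_gt0// /harmonic mulrAC ler_pdivlMr//.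
  have := @expR_ge1Dxn _ (n%:R * e) 1 (mulr_ge0 n0 (ltW e0)).
  have C0 : 0 <= C by rewrite addr_ge0// divr_ge0// sqr_ge0.
  move=> /(ler_wpM2l C0); apply: le_trans.
  have -> : C * (1 + (n%:R * e) ^+ 2 / 2`!%:R) =
     2 + 4 / e ^+ 2 + n%:R ^+ 2 * (e ^+ 2 + 2).
    by rewrite /C (_ : 2`!%:R = 2)//; field; rewrite gt_eqF.
  rewrite -natr1; have : 0 <= 4 / e ^+ 2 by rewrite divr_ge0// sqr_ge0.
  have : 0 <= n%:R ^+ 2 * e ^+ 2 by rewrite mulr_ge0 ?sqr_ge0.
  by nra.
- exact: cvg_cst.
- by rewrite -[X in _ --> X](mulr0 C); apply: cvgMr; exact: cvg_harmonic.
Qed.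

Lemma le_expr_inv (x : R) n : 0 <= x <= 1 -> (1 - x) ^+ n <= (1 + n%:R * x)^-1.
Proof.
move=> /andP[x0 x1]; have n0 : 0 <= n%:R * x by rewrite mulr_ge0.
apply: (@le_trans _ _ (expR (- x) ^+ n)).
  by apply: lerXn2r; rewrite ?nnegrE ?subr_ge0 ?expR_ge0 ?expR_ge1Dx.
rewrite -expRM_natl mulrN expRN lef_pV2 ?posrE ?expR_gt0 ?expR_ge1Dx//.
by rewrite ltr_pwDl.
Qed.

Lemma cvg_le_harmonic (u : R^nat) : (forall n, 0 <= u n <= (1 + n%:R)^-1) ->
  u @ \oo --> 0.
Proof.
move=> h; apply: (@squeeze_cvgr _ _ _ _ (cst 0) harmonic).
- by apply: nearW => n; rewrite /harmonic/= -natr1 addrC.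
- exact: cvg_cst.
- exact: cvg_harmonic.
Qed.

(* With 2^n = exp(n ln 2), the exponent n 2^n compares exp(-l n y) with 2^-n. *)
Lemma cvg_laplace_ray (l y : R) : 0 < l -> 0 <= y ->
  ((1 - expR (- (n%:R * l * y))) ^+ (n * 2 ^ n)) @[n --> \oo] -->
  ((ln 2 / l < y)%R%:R : R).
Proof.
move=> l0 y0.
have x01 n : 0 <= expR (- (n%:R * l * y)) <= 1.
  by rewrite expR_ge0 -expR0 ler_expR oppr_le0 !mulr_ge0// ltW.
(* If [l y > ln 2] this product tends to 0, and Bernoulli's inequality gives the limit 1. Otherwise
   it is at least [n], and the power is at most [1 / (1 + n)]. *)
have E n : (n * 2 ^ n)%:R * expR (- (n%:R * l * y)) =
           n%:R * expR (- (n%:R * (l * y - ln 2))).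
  rewrite natrM natrX -mulrA; congr (_ * _).
  rewrite -[in LHS](@lnK _ 2) ?posrE// -expRM_natl -expRD; congr expR; ring.
have [ly|ly] := ltP.
- apply: (@squeeze_cvgr _ _ _ _
    (fun n => 1 - n%:R * expR (- (n%:R * (l * y - ln 2)))) (cst 1)).
  + apply: nearW => n; rewrite -E bernoulli_ineq//= exprn_ile1//.
      by rewrite subr_ge0; case/andP: (x01 n).
  + rewrite -[X in _ --> X]subr0; apply: cvgB; first exact: cvg_cst.
    by apply: cvg_nmul_expRN; rewrite subr_gt0 mulrC -ltr_pdivrMr.
  + exact: cvg_cst.
- apply: cvg_le_harmonic => n.
  rewrite exprn_ge0/=; last by rewrite subr_ge0; case/andP: (x01 n).
  apply: (le_trans (le_expr_inv _ (x01 n))).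
  rewrite E lef_pV2 ?posrE; last 2 first.
  + by rewrite ltr_pwDl// mulr_ge0// expR_ge0.
  + by rewrite ltr_pwDl.
  rewrite lerD2l ler_peMr// -[leLHS]expR0 ler_expR oppr_ge0.
  by rewrite mulr_ge0_le0// subr_le0 mulrC -ler_pdivlMr.
Qed.

(** Handles the threshold 0, out of reach of [cvg_laplace_ray], where [ln 2 / l] is positive. *)
Lemma cvg_laplace_pos (y : R) : 0 <= y ->
  (1 - expR (- (n%:R * y))) @[n --> \oo] --> ((0 < y)%R%:R : R).
Proof.
rewrite le_eqVlt => /predU1P[<-|y0].
  by rewrite ltxx; under eq_fun do rewrite mulr0 oppr0 expR0 subrr; exact: cvg_cst.
rewrite y0 -[X in _ --> X]subr0; apply: cvgB; first exact: cvg_cst.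
apply: (@squeeze_cvgr _ _ _ _ (cst 0) (fun n => (1 + y^-1) * harmonic n)).
- apply: nearW => n; rewrite expR_ge0/= expRN /harmonic.
  rewrite -[leLHS]mul1r ler_pdivrMr ?expR_gt0// mulrAC ler_pdivlMr// mul1r.
  have C0 : 0 <= 1 + y^-1 by rewrite addr_ge0// invr_ge0 ltW.
  have /(ler_wpM2l C0) := expR_ge1Dx (n%:R * y); apply: le_trans.
  rewrite mulrDl mul1r mulrDr mulr1 mulrCA mulVf ?gt_eqF// mulr1 -natr1.
  have : 0 <= n%:R * y by rewrite mulr_ge0// ltW.
  have : 0 <= y^-1 by rewrite invr_ge0 ltW.
  lra.
- exact: cvg_cst.
- by rewrite -[X in _ --> X](mulr0 (1 + y^-1)); apply: cvgMr; exact: cvg_harmonic.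
Qed.

End limits.

Section laplace_unique.
Local Open Scope ereal_scope.
Context d1 (T1 : measurableType d1) d2 (T2 : measurableType d2) (R : realType).
Variables (mu1 : {measure set T1 -> \bar R}) (mu2 : {measure set T2 -> \bar R}).
Variables (w1 : T1 -> \bar R) (w2 : T2 -> \bar R) (Y1 : T1 -> R) (Y2 : T2 -> R).
Hypotheses (w10 : forall x, 0 <= w1 x) (w20 : forall x, 0 <= w2 x)
  (mw1 : measurable_fun setT w1) (mw2 : measurable_fun setT w2)
  (mY1 : measurable_fun setT Y1) (mY2 : measurable_fun setT Y2)
  (Y10 : forall x, (0 <= Y1 x)%R) (Y20 : forall x, (0 <= Y2 x)%R).
Hypothesis fin1 : \int[mu1]_x w1 x < +oo.
Hypothesis lap : forall l, (0 <= l)%R ->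
  \int[mu1]_x (w1 x * (expR (- (l * Y1 x)))%:E) =
  \int[mu2]_x (w2 x * (expR (- (l * Y2 x)))%:E).

Let I1 (f : R -> R) := \int[mu1]_x (w1 x * (f (Y1 x))%:E).
Let I2 (f : R -> R) := \int[mu2]_x (w2 x * (f (Y2 x))%:E).

Let fin12 : \int[mu1]_x w1 x = \int[mu2]_x w2 x.
Proof.
have := lap (lexx 0%R).
under eq_integral do rewrite mul0r oppr0 expR0 mule1.
by under [in RHS]eq_integral do rewrite mul0r oppr0 expR0 mule1.
Qed.

Let fin2 : \int[mu2]_x w2 x < +oo.
Proof. by rewrite -fin12. Qed.

(** Expanding the power gives a signed combination of the exponentials with rates [l + j m],
    [j <= n], on which both sides agree. Limits of such functions include indicators of
    half-lines. *)
Let q l m n (y : R) := (expR (- (l * y)) * (1 - expR (- (m * y))) ^+ n)%R.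

Let mq l m n : measurable_fun setT (q l m n).
Proof.
apply: measurable_funM.
  by apply: measurableT_comp => //; apply: measurable_funN; exact: mulrl_measurable.
apply: measurable_funX; apply: measurable_funB => //.
by apply: measurableT_comp => //; apply: measurable_funN; exact: mulrl_measurable.
Qed.

Let q01 l m n y : (0 <= l -> 0 <= m -> 0 <= y -> 0 <= q l m n y <= 1)%R.
Proof.
move=> l0 m0 y0; have e1 k : (0 <= k -> expR (- (k * y)) <= 1)%R.
  by move=> k0; rewrite -[leRHS]expR0 ler_expR oppr_le0 mulr_ge0.
rewrite /q mulr_ge0 ?expR_ge0 ?exprn_ge0 ?subr_ge0 ?e1//=.
rewrite mulr_ile1 ?expR_ge0 ?e1 ?exprn_ge0 ?exprn_ile1 ?subr_ge0 ?e1//.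
Qed.

Let fin_le d (T : measurableType d) (mu : {measure set T -> \bar R})
    (w : T -> \bar R) (f : T -> R) :
  (forall x, 0 <= w x) -> measurable_fun setT w -> measurable_fun setT f ->
  \int[mu]_x w x < +oo -> (forall x, (0 <= f x <= 1)%R) ->
  \int[mu]_x (w x * (f x)%:E) \is a fin_num.
Proof.
move=> w0 mw mf fin f01.
rewrite ge0_fin_numE; last first.
  by apply: integral_ge0 => x _; rewrite mule_ge0// lee_fin; case/andP: (f01 x).
apply: le_lt_trans fin; apply: ge0_le_integral => //.
- by move=> x _; rewrite mule_ge0// lee_fin; case/andP: (f01 x).
- by apply: emeasurable_funM => //; exact/measurable_EFinP.
- by move=> x _; rewrite -[leRHS]mule1 lee_wpmul2l// lee_fin; case/andP: (f01 x).
Qed.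

(** The recursion on the exponent, written as a sum of nonnegative integrals. The subtraction is
    left to [eq_q], where the term to be removed is finite. *)
Let q_split d (T : measurableType d) (mu : {measure set T -> \bar R})
    (w : T -> \bar R) (Y : T -> R) l m n :
  (forall x, 0 <= w x) -> measurable_fun setT w -> measurable_fun setT Y ->
  (forall x, (0 <= Y x)%R) -> (0 <= l)%R -> (0 <= m)%R ->
  \int[mu]_x (w x * (q l m n.+1 (Y x))%:E) +
  \int[mu]_x (w x * (q (l + m) m n (Y x))%:E) =
  \int[mu]_x (w x * (q l m n (Y x))%:E).
Proof.
move=> w0 mw mY Y0 l0 m0.
have lm0 : (0 <= l + m)%R by rewrite addr_ge0.
rewrite -ge0_integralD//.
- apply: eq_integral => x _; have [/andP[? _] /andP[? _]] :=
    (q01 n.+1 l0 m0 (Y0 x), q01 n lm0 m0 (Y0 x)).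
  rewrite -ge0_muleDr ?lee_fin// -EFinD; congr (_ * _%:E).
  by rewrite /q mulrDl opprD expRD exprS; ring.
- by move=> x _; rewrite mule_ge0// lee_fin; case/andP: (q01 n.+1 l0 m0 (Y0 x)).
- by apply: emeasurable_funM => //; apply/measurable_EFinP; exact: measurableT_comp.
- by move=> x _; rewrite mule_ge0// lee_fin; case/andP: (q01 n lm0 m0 (Y0 x)).
- by apply: emeasurable_funM => //; apply/measurable_EFinP; exact: measurableT_comp.
Qed.

Let eq_q n l m : (0 <= l)%R -> (0 <= m)%R -> I1 (q l m n) = I2 (q l m n).
Proof.
elim: n l => [|n ih] l l0 m0.
  rewrite /I1 /I2 /q; under eq_integral do rewrite expr0 mulr1.
  by under [in RHS]eq_integral do rewrite expr0 mulr1; exact: lap.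
have := ih l l0 m0.
have fq : I2 (q (l + m) m n) \is a fin_num.
  apply: fin_le => //; first exact: measurableT_comp.
  by move=> x; rewrite q01// addr_ge0.
rewrite /I1 /I2 -(q_split mu1 n w10 mw1 mY1 Y10 l0 m0).
rewrite -(q_split mu2 n w20 mw2 mY2 Y20 l0 m0).
rewrite -/(I1 _) -/(I2 _) -/(I1 _) -/(I2 _) ih ?addr_ge0// => /(congr1 (fun x => x - I2 (q (l + m) m n))).
by rewrite !addeK.
Qed.

Let cvg_dom d (T : measurableType d) (mu : {measure set T -> \bar R})
    (w : T -> \bar R) (f : nat -> T -> R) (g : T -> R) :
  (forall x, 0 <= w x) -> measurable_fun setT w ->
  (forall n, measurable_fun setT (f n)) -> measurable_fun setT g ->
  \int[mu]_x w x < +oo -> (forall n x, (0 <= f n x <= 1)%R) ->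
  (forall x, f ^~ x @ \oo --> g x) ->
  \int[mu]_x (w x * (f n x)%:E) @[n --> \oo] --> \int[mu]_x (w x * (g x)%:E).
Proof.
move=> w0 mw mf mg fin f01 fg.
have iw : mu.-integrable setT w.
  apply/integrableP; split => //.
  by under eq_integral do rewrite gee0_abs//.
have [//|||||_ _] := @dominated_convergence _ _ _ mu setT measurableT
  (fun n x => w x * (f n x)%:E) (fun x => w x * (g x)%:E) w; last exact.
- by move=> n; apply: emeasurable_funM => //; exact/measurable_EFinP.
- by apply: emeasurable_funM => //; exact/measurable_EFinP.
- have := integrable_ae measurableT iw; apply: filterS => x /(_ Logic.I) wx _.
  by apply: cvgeZl => //; apply: cvg_EFin; [exact: nearW|exact: fg].
- exact: iw.
- apply/aeW => x n _; have /andP[f0 f1] := f01 n x.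
  by rewrite gee0_abs ?mule_ge0 ?lee_fin// -[leRHS]mule1 lee_wpmul2l ?lee_fin.
Qed.

Let eq_lim (l m : nat -> R) (k : nat -> nat) (g : R -> R) :
  (forall n, 0 <= l n)%R -> (forall n, 0 <= m n)%R -> measurable_fun setT g ->
  (forall y, (0 <= y)%R -> (fun n => q (l n) (m n) (k n) y) @ \oo --> g y) ->
  I1 g = I2 g.
Proof.
move=> l0 m0 mg h.
have c1 : I1 (q (l n) (m n) (k n)) @[n --> \oo] --> I1 g.
  apply: cvg_dom => //.
  - by move=> n; exact: measurableT_comp.
  - exact: measurableT_comp.
  - by move=> n x; exact: q01.
  - by move=> x; exact: h.
have c2 : I2 (q (l n) (m n) (k n)) @[n --> \oo] --> I2 g.
  apply: cvg_dom => //.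
  - by move=> n; exact: measurableT_comp.
  - exact: measurableT_comp.
  - by move=> n x; exact: q01.
  - by move=> x; exact: h.
rewrite -(cvg_lim _ c1)// -(cvg_lim _ c2)//; congr (limn _).
by apply/funext => n; exact: eq_q.
Qed.

Lemma laplace_unique (psi : R -> \bar R) : (forall y, 0 <= psi y) ->
  measurable_fun setT psi ->
  \int[mu1]_x (w1 x * psi (Y1 x)) = \int[mu2]_x (w2 x * psi (Y2 x)).
Proof.
move=> psi0 mpsi.
(* The rays []a, +oo[] form the pi-system; [setT] is added as [eq_integral_law_pi] requires. Rays
   with [a < 0] contain all values, [a > 0] is reached with [l = ln 2 / a], and [a = 0] is the
   separate limit. *)
pose G : set (set R) := [set setT] `|` @RGenOInfty.G R.
have H := (@eq_integral_law_pi _ _ _ _ _ _ _ mu1 mu2 w1 w2 Y1 Y2 w10 w20 mw1 mw2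
  mY1 mY2 G).
apply: H => //.
- transitivity (<<s @RGenOInfty.G R >>); first exact: RGenOInfty.measurableE.
  apply/seteqP; split.
    by apply: sub_sigma_algebra2; right.
  apply: smallest_sub; first exact: smallest_sigma_algebra.
  move=> A [->|GA]; last exact: sub_sigma_algebra.
  exact: (@measurableT _ (g_sigma_algebraType (@RGenOInfty.G R))).
- move=> A B [->|[a ->]]; first by rewrite setTI.
  move=> [->|[b ->]]; first by rewrite setIT; right; exists a.
  right; exists (Num.max a b); rewrite predeqE => x.
  by split; rewrite /= !in_itv/= !andbT gt_max => /andP.
- by left.
- move=> A [->|[a ->]].
    under eq_integral do rewrite indicT mule1.
    by under [in RHS]eq_integral do rewrite indicT mule1.
  have [a0|a0|a0] := ltgtP a 0%R.
  + rewrite (eq_integral w1); last first.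
      by move=> x _; rewrite indicE mem_set ?mule1//= in_itv/= andbT (lt_le_trans a0).
    rewrite [RHS](eq_integral w2)//.
    by move=> x _; rewrite indicE mem_set ?mule1//= in_itv/= andbT (lt_le_trans a0).
  + pose l := (ln 2 / a)%R.
    have ln2 : (0 < ln 2 :> R)%R by rewrite ln_gt0// ltr1n.
    have l0 : (0 < l)%R by rewrite divr_gt0.
    have lE : (ln 2 / l)%R = a by rewrite /l invf_div mulrCA mulfV ?gt_eqF// mulr1.
    rewrite -/(I1 \1_(`]a, +oo[)) -/(I2 \1_(`]a, +oo[)).
    apply: (@eq_lim (fun=> 0%R) (fun n => n%:R * l)%R (fun n => n * 2 ^ n)%N) => //.
      by move=> n; rewrite mulr_ge0// ltW.
    move=> y y0; rewrite /q indicE mem_setE in_itv/= andbT -lE.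
    under eq_fun do rewrite mul0r oppr0 expR0 mul1r.
    exact: cvg_laplace_ray.
  + rewrite a0 -/(I1 \1_(`]0%R, +oo[)) -/(I2 \1_(`]0%R, +oo[)).
    apply: (@eq_lim (fun=> 0%R) (fun n => n%:R)%R (fun n => 1)%N) => //.
    move=> y y0; rewrite /q indicE mem_setE in_itv/= andbT.
    under eq_fun do rewrite mul0r oppr0 expR0 mul1r expr1.
    exact: cvg_laplace_pos.
Qed.

End laplace_unique.

(** * The negative binomial process *)

Section levy.
Context (R : realType).
Notation mu := (@lebesgue_measure R).
Implicit Type rho : R -> R.

(* Extending rho by 0 makes all integrals against Pi integrals over R; the
   values of rho outside of (0, +oo) are unconstrained. *)
Definition rho0 rho (x : R) : R := if 0 < x then rho x else 0.

Definition levy_int rho (h : R -> R) : \bar R :=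
  (\int[mu]_x (h x * rho0 rho x)%:E)%E.

Variable rho : R -> R.
Hypothesis hrho : infinite_levy_density rho.

Lemma rho0_ge0 x : 0 <= rho0 rho x.
Proof. by rewrite /rho0; case: ifPn => // x0; case: hrho => _ h _ _ _; exact: h. Qed.

Lemma measurable_rho0 : measurable_fun setT (rho0 rho).
Proof.
case: hrho => mrho _ _ _ _.
have -> : rho0 rho = (rho \_ (`]0, +oo[ : set R)).
  by apply/funext => x; rewrite /rho0 patchE mem_setE in_itv/= andbT.
by apply/(measurable_restrictT rho).
Qed.

Lemma levy_integral_levy_int (h : R -> R) :
  levy_integral rho `]0, +oo[ (fun x => (h x)%:E) = levy_int rho h.
Proof.
rewrite /levy_integral integral_mkcond; apply: eq_integral => x _.
rewrite patchE mem_setE in_itv/= andbT /rho0; case: ifPn => // _.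
by rewrite mulr0.
Qed.

Lemma measurable_levy (h : R -> R) : measurable_fun setT h ->
  measurable_fun setT (fun x => (h x * rho0 rho x)%:E).
Proof.
by move=> mh; apply/measurable_EFinP; apply: measurable_funM => //; exact: measurable_rho0.
Qed.

Lemma levy_int_ge0 (h : R -> R) : (forall x, 0 <= h x) -> (0 <= levy_int rho h)%E.
Proof.
by move=> h0; apply: integral_ge0 => x _; rewrite lee_fin mulr_ge0 ?rho0_ge0.
Qed.

(** [min(x, 1)] is [Pi]-integrable: [x] on []0, 1]] and 1 on []1, +oo[] are the two finiteness
    conditions of [infinite_levy_density]. *)
Lemma levy_int_fin (C : R) (h : R -> R) : 0 <= C -> (forall x, 0 <= h x) ->
  (forall x, 0 < x -> h x <= C * Num.min x 1) -> (levy_int rho h < +oo)%E.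
Proof.
move=> C0 h0 hC; case: hrho => mrho rho_ge0 _ /(_ 1 ltr01) i1 i2.
pose k1 : R -> \bar R := ((fun y => y%:E * (rho y)%:E)%E \_ `]0%R, 1%R]).
pose k2 : R -> \bar R := ((fun y => 1%E * (rho y)%:E)%E \_ `]1%R, +oo[).
pose k x : \bar R := (C%:E * k1 x +
     C%:E * k2 x)%E.
have k10 x : (0 <= k1 x)%E.
  rewrite /k1 patchE mem_setE in_itv/=; case: ifPn => // /andP[x0 x1].
  by rewrite mule_ge0// lee_fin ?rho_ge0// ltW.
have k20 x : (0 <= k2 x)%E.
  rewrite /k2 patchE mem_setE in_itv/= andbT; case: ifPn => // x1.
  by rewrite mule_ge0// lee_fin ?rho_ge0// (lt_trans _ x1).
have mrho1 D : measurable D -> D `<=` (`]0, +oo[ : set R) -> measurable_fun D rho.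
  by move=> mD sD; apply: measurable_funS mrho.
apply: (@le_lt_trans _ _ (\int[mu]_x k x)%E).
  apply: ge0_ae_le_integralT.
  - by move=> x; rewrite lee_fin mulr_ge0 ?rho0_ge0.
  - by move=> x; rewrite adde_ge0// mule_ge0// lee_fin.
  - apply/aeW => x; rewrite /k /k1 /k2 /rho0 !patchE !mem_setE !in_itv/= andbT.
    case: ifPn => x0; last first.
      by rewrite mulr0 (_ : (1 < x) = false) ?mule0 ?adde0//; apply/negbTE; lra.
    have rx := rho_ge0 _ x0; have := hC _ x0.
    have [x1|x1] := leP x 1.
      by rewrite mule0 adde0 -!EFinM !lee_fin => ?; rewrite mulrA ler_wpM2r.
    by rewrite mule0 add0e mul1e lee_fin mulr1 => ?; rewrite ler_wpM2r.
have mk1 : measurable_fun setT k1.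
  apply: (measurable_restrictT _ (measurable_itv _)).1.
  apply: (emeasurable_funM (f := EFin) (g := EFin \o rho)) => //.
  apply/measurable_EFinP; apply: mrho1 => //.
  by move=> x; rewrite /= !in_itv/= !andbT => /andP[].
have mk2 : measurable_fun setT k2.
  apply: (measurable_restrictT _ (measurable_itv _)).1.
  apply: (emeasurable_funM (f := cst 1%E) (g := EFin \o rho)) => //.
  apply/measurable_EFinP; apply: mrho1 => //.
  by move=> x; rewrite /= !in_itv/= !andbT => x1; rewrite (lt_trans _ x1).
rewrite ge0_integralD//; last first.
- exact: measurable_funeM.
- by move=> x _; rewrite mule_ge0// lee_fin.
- exact: measurable_funeM.
- by move=> x _; rewrite mule_ge0// lee_fin.
rewrite !ge0_integralZl_EFin//.
by rewrite /k1 /k2 lte_add_pinfty// -integral_mkcond lte_mul_pinfty.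
Qed.

End levy.

Section psum.
Context (T : Type) (R : realType).
Implicit Types (J : nat -> T -> R) (f h : R -> R).

Definition psum J f w : \bar R := (\sum_(i <oo) (f (J i w))%:E)%E.

Lemma psum_ge0 J f w : (forall x, 0 <= f x) -> (0 <= psum J f w)%E.
Proof. by move=> f0; apply: nneseries_ge0 => i _ _; rewrite lee_fin. Qed.

Lemma psumD J f h w : (forall x, 0 <= f x) -> (forall x, 0 <= h x) ->
  psum J (fun x => f x + h x) w = (psum J f w + psum J h w)%E.
Proof.
by move=> f0 h0; rewrite -nneseriesD// => i _ _; rewrite lee_fin.
Qed.

Lemma psumZ J f (c : R) w : (forall x, 0 <= f x) ->
  psum J (fun x => c * f x) w = (c%:E * psum J f w)%E.
Proof. by move=> f0; rewrite -nneseriesZl// => i _; rewrite lee_fin. Qed.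

Lemma le_psum J f h w : (forall x, 0 <= f x) -> (forall i, f (J i w) <= h (J i w)) ->
  (psum J f w <= psum J h w)%E.
Proof. by move=> f0 fh; apply: lee_nneseries => [i _ _|i _]; rewrite lee_fin. Qed.

End psum.

Lemma measurable_psum d (T : measurableType d) (R : realType)
    (J : nat -> T -> R) (f : R -> R) : (forall i, measurable_fun setT (J i)) ->
  measurable_fun setT f -> (forall x, 0 <= f x) -> measurable_fun setT (psum J f).
Proof.
move=> mJ mf f0; apply: ge0_emeasurable_sum => i.
- by move=> x _ _; rewrite lee_fin.
- by move=> _; apply/measurable_EFinP; exact: measurableT_comp.
Qed.

Section bn_laplace.
Context d (T : measurableType d) (R : realType) (P : probability T R).
Variables (B : R.-ker T ~> R) (J : nat -> {RV P >-> R}) (rho : R -> R) (r : R).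
Hypothesis hB : BN_process r rho B J.
Hypothesis hrho : infinite_levy_density rho.
Implicit Type f : R -> R.

Lemma BN_gt0 i w : 0 < J i w.
Proof. by case: hB => _ []. Qed.

(** [ranked_points] describes [B w] on sets only; identifying it with a series of Dirac masses
    extends this to integrals. All points are positive, so restricting to []0, +oo[] loses none. *)
Lemma BN_integral f : measurable_fun setT f -> (forall x, 0 <= f x) ->
  {ae P, forall w, (\int[B w]_(x in `]0%R, +oo[) (f x)%:E)%E = psum J f w}.
Proof.
move=> mf f0; case: hB => _ [_ ]; apply: filterS => w [_ BE].
pose dJ i : {measure set R -> \bar R} := \d_(J i w).
transitivity (\int[mseries dJ 0]_(x in `]0%R, +oo[) (f x)%:E)%E.
  by apply: eq_measure_integral => A mA _; rewrite BE.
rewrite ge0_integral_measure_series//; last 2 first.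
- by move=> x _; rewrite lee_fin.
- by apply: measurable_funTS; exact/measurable_EFinP.
apply: eq_eseriesr => i _.
rewrite integral_dirac//; last by apply: measurable_funTS; exact/measurable_EFinP.
by rewrite diracE mem_set ?mul1e//= in_itv/= BN_gt0.
Qed.

Lemma BN_psum_laplace f : measurable_fun setT f -> (forall x, 0 <= f x) ->
  (\int[P]_w expeR (- psum J f w) =
   ((1 + levy_int rho (fun x => 1 - expR (- f x))%R) `^ r)^-1)%E.
Proof.
move=> mf f0; case: (hB) => hL _.
rewrite -levy_integral_levy_int -hL//; last exact: measurable_funTS.
apply: ge0_ae_eq_integralT => [x|x|]; [exact: expeR_ge0|exact: expeR_ge0|].
by apply: filterS (BN_integral mf f0) => w ->.
Qed.

End bn_laplace.

Section difference_quotient.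
Context (R : realType).

(* The dyadic steps make the difference quotients of e^{-x} at 0 monotone in k,
   so that monotone convergence applies. *)
Definition dquot k (b : R) : R := 2 ^+ k * (1 - expR (- (b / 2 ^+ k))).

Lemma measurable_dquot k : measurable_fun setT (dquot k).
Proof.
apply: measurable_funM => //; apply: measurable_funB => //.
by apply: measurableT_comp => //; apply: measurable_funN; exact: mulrr_measurable.
Qed.

Lemma dquot_ge0 k b : 0 <= b -> 0 <= dquot k b.
Proof.
move=> b0; rewrite mulr_ge0 ?exprn_ge0// subr_ge0 -[leRHS]expR0 ler_expR oppr_le0.
by rewrite divr_ge0// exprn_ge0.
Qed.

Lemma dquot_le k b : dquot k b <= b.
Proof.
have e0 : (0 < 2 ^+ k :> R) by rewrite exprn_gt0.
rewrite /dquot mulrC -ler_pdivlMr//.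
by have := expR_ge1Dx (- (b / 2 ^+ k)); lra.
Qed.

Lemma dquot_nd b : {homo dquot ^~ b : m n / (m <= n)%N >-> m <= n}.
Proof.
apply/nondecreasing_seqP => k; rewrite /dquot.
have e0 : (0 < 2 ^+ k :> R) by rewrite exprn_gt0.
have -> : b / 2 ^+ k = 2%:R * (b / 2 ^+ k.+1).
  by rewrite exprS; field; rewrite gt_eqF.
rewrite -mulrN expRM_natl; set z := expR _.
rewrite [in leRHS]exprS -mulrA mulrCA ler_wpM2l ?(ltW e0)//.
have : 0 <= (1 - z) ^+ 2 by exact: sqr_ge0.
by rewrite !expr2; lra.
Qed.

Lemma cvg_dquot b : 0 <= b -> dquot ^~ b @ \oo --> b.
Proof.
(* With [x = b / 2^k], the bound [1 - expR (- x) >= x - x^2] gives [dquot k b >= b - b^2 / 2^k], and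
   [2^k >= k + 1]. *)
move=> b0; apply: (@squeeze_cvgr _ _ _ _ (fun k => b - b ^+ 2 * harmonic k) (cst b)).
- apply: nearW => k; rewrite dquot_le andbT.
  have e0 : (0 < 2 ^+ k :> R) by rewrite exprn_gt0.
  have k1 : k.+1%:R <= 2 ^+ k :> R by rewrite -natrX ler_nat ltn_expl.
  have n1 : 0 < k.+1%:R :> R by [].
  pose x := b / 2 ^+ k; have x0 : 0 <= x by rewrite divr_ge0// ltW.
  have bE : b = 2 ^+ k * x by rewrite /x mulrCA mulfV ?gt_eqF// mulr1.
  rewrite /dquot -/x.
  apply: (@le_trans _ _ (2 ^+ k * (x - x ^+ 2))).
    rewrite mulrBr -bE lerD2l lerN2 /harmonic ler_pdivlMr//.
    have -> : b ^+ 2 = 2 ^+ k * x ^+ 2 * 2 ^+ k by rewrite bE; ring.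
    by rewrite ler_wpM2l// mulr_ge0 ?sqr_ge0// ltW.
  rewrite ler_wpM2l ?(ltW e0)//.
  have ex := expR_ge1Dx x; have ex0 : 0 < expR x by exact: expR_gt0.
  rewrite expRN lerBrDr -lerBrDl.
  rewrite -[leLHS]mul1r ler_pdivrMr//.
  have : 0 <= (1 - (x - x ^+ 2)) by have := sqr_ge0 (x - 1); rewrite !expr2; nra.
  move=> H; apply: le_trans (ler_wpM2l H ex).
  have x3 : 0 <= x ^+ 3 by exact: exprn_ge0.
  by rewrite (_ : (1 - (x - x ^+ 2)) * (1 + x) = 1 + x ^+ 3) ?lerDl//; ring.
- rewrite -[X in _ --> X]subr0; apply: cvgB; first exact: cvg_cst.
  by rewrite -[X in _ --> X](mulr0 (b ^+ 2)); apply: cvgMr; exact: cvg_harmonic.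
- exact: cvg_cst.
Qed.

End difference_quotient.

Section powR_convex.
Context (R : realType).
Implicit Types a b s : R.

Lemma ln_ge_sub a b : 0 < a -> 0 < b -> 1 - a / b <= ln (b / a).
Proof.
move=> a0 b0; have ab0 : 0 < a / b by rewrite divr_gt0.
rewrite -(invf_div a b) lnV ?posrE// lerNr opprB.
have := @le_ln1Dx _ (a / b - 1); rewrite [X in ln X]addrC subrK; apply.
by rewrite ltrBrDr addrC subrr.
Qed.

(** The convex function [t |-> t^(-s)] lies above its tangent at [b]. No derivative is taken:
    [a^(-s) = b^(-s) expR (s ln (b / a))], and [expR x >= 1 + x]. *)
Lemma powRN_convex_le a b s : 0 <= s -> 0 < a -> 0 < b ->
  s * b `^ (- (s + 1)) * (b - a) <= a `^ (- s) - b `^ (- s).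
Proof.
move=> s0 a0 b0.
have -> : a `^ (- s) = b `^ (- s) * expR (s * ln (b / a)).
  rewrite /powR !gt_eqF// -expRD; congr expR.
  by rewrite ln_div ?posrE//; ring.
have -> : b `^ (- (s + 1)) = b `^ (- s) / b.
  by rewrite opprD powRB ?(gt_eqF b0) ?implybT// powRr1 // ltW.
have p0 : 0 <= b `^ (- s) by exact: powR_ge0.
apply: (@le_trans _ _ (b `^ (- s) * (s * (1 - a / b)))).
  by rewrite le_eqVlt; apply/orP; left; apply/eqP; field; rewrite gt_eqF.
rewrite -[X in _ <= _ - X]mulr1 -mulrBr ler_wpM2l//.
rewrite lerBrDl; apply: le_trans (expR_ge1Dx _).
by rewrite lerD2l ler_wpM2l// ln_ge_sub.
Qed.

(** Put [y = x k / 2^k]. The tangents at [p] and at [p + y] bound the increment from above and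
    below; the slope at [p + y] is compared with that at [p] by convexity for the exponent
    [s + 1]. *)
Lemma cvg_powRN_quot (s p I : R) (x : R^nat) : 0 < s -> 1 <= p ->
  (forall k, 0 <= x k) -> x @ \oo --> I ->
  (2 ^+ k * (p `^ (- s) - (p + x k / 2 ^+ k) `^ (- s))) @[k --> \oo] -->
  s * p `^ (- (s + 1)) * I.
Proof.
move=> s0 p1 x0 xI; have p0 : 0 < p by exact: lt_le_trans p1.
have e0 k : (0 < 2 ^+ k :> R) by rewrite exprn_gt0.
have px k : 0 < p + x k / 2 ^+ k by rewrite ltr_pwDl// divr_ge0// ltW.
have s10 : 0 < s + 1 by rewrite addr_gt0.
have c0 : (x k / 2 ^+ k) @[k --> \oo] --> 0.
  rewrite -[X in _ --> X](mulr0 I); apply: cvgM => //.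
  have := @cvg_geometric _ 1 (2^-1 : R); rewrite ger0_norm//.
  rewrite invf_lt1// ltr1n => /(_ erefl); apply: cvg_trans.
  by apply: near_eq_cvg; apply: nearW => k /=; rewrite mul1r exprVn.
have c1 : (s * (p `^ (- (s + 1)) - (s + 1) * p `^ (- (s + 1 + 1)) * (x k / 2 ^+ k))
      * x k) @[k --> \oo] --> s * p `^ (- (s + 1)) * I.
  apply: cvgM => //; apply: cvgMr; rewrite -[X in _ --> X]subr0.
  apply: cvgB; first exact: cvg_cst.
  rewrite -[X in _ --> X](mulr0 ((s + 1) * p `^ (- (s + 1 + 1)))).
  exact: cvgMr.
apply: squeeze_cvgr c1 (_ : (s * p `^ (- (s + 1)) * x k) @[k --> \oo] --> _); last first.
  exact: cvgMr.
apply: nearW => k.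
have xE : x k = 2 ^+ k * (x k / 2 ^+ k) by rewrite mulrCA mulfV ?gt_eqF// mulr1.
have y0 : 0 <= x k / 2 ^+ k by rewrite divr_ge0// ltW.
set y := x k / 2 ^+ k in xE y0 *.
apply/andP; split.
  rewrite xE [leLHS]mulrCA ler_wpM2l ?(ltW (e0 k))//.
  apply: le_trans (powRN_convex_le (ltW s0) p0 (px k)).
  rewrite [X in _ <= _ * X]addrC addKr ler_wpM2r// ler_wpM2l ?(ltW s0)//.
  have := powRN_convex_le (ltW s10) (px k) p0.
  by rewrite -/y (_ : p - (p + y) = - y); [lra|ring].
rewrite xE [leRHS]mulrCA ler_wpM2l ?(ltW (e0 k))//.
have := powRN_convex_le (ltW s0) (px k) p0.
by rewrite -/y (_ : p - (p + y) = - y); [lra|ring].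
Qed.

End powR_convex.

Section linbd.
Context (R : realType).
Implicit Types f h : R -> R.

(** The test functions: their sums over the points are almost surely finite. They contain [|x|],
    which gives the total sum, and indicators of sets bounded away from 0 on the positive side,
    which count points. *)
Definition linbd f := [/\ measurable_fun setT f, forall x, 0 <= f x &
  exists2 C, 0 <= C & forall x, f x <= C * `|x| ].

Lemma linbd_norm : linbd Num.norm.
Proof.
split; [exact: normr_measurable|by []|exists 1 => // x; by rewrite mul1r].
Qed.

Lemma linbdD f h : linbd f -> linbd h -> linbd (fun x => f x + h x).
Proof.
move=> [mf f0 [C C0 fC]] [mh h0 [D D0 hD]]; split.
- exact: measurable_funD.
- by move=> x; rewrite addr_ge0.
- by exists (C + D); [rewrite addr_ge0|move=> x; rewrite mulrDl lerD].
Qed.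

Lemma linbdM (b : R) f (k : R -> R) : linbd f -> measurable_fun setT k ->
  (forall x, 0 <= k x <= b) -> linbd (fun x => f x * k x).
Proof.
move=> [mf f0 [C C0 fC]] mk k0; split.
- exact: measurable_funM.
- by move=> x; rewrite mulr_ge0//; case/andP: (k0 x).
- have b0 : 0 <= b by case/andP : (k0 0) => /le_trans; apply.
  exists (C * b); first by rewrite mulr_ge0.
  by move=> x; rewrite mulrAC; case/andP: (k0 x) => ? ?; rewrite ler_pM.
Qed.

Lemma linbdZ (c : R) f : 0 <= c -> linbd f -> linbd (fun x => c * f x).
Proof.
move=> c0 [mf f0 [C C0 fC]]; split.
- exact: measurable_funM.
- by move=> x; rewrite mulr_ge0.
- by exists (c * C); [rewrite mulr_ge0|move=> x; rewrite -mulrA ler_wpM2l].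
Qed.

Lemma linbd0 : linbd (fun=> 0).
Proof. by split => //; exists 0 => // x; rewrite mul0r. Qed.

Lemma linbd_measurable f : linbd f -> measurable_fun setT f. Proof. by case. Qed.

Lemma linbd_ge0 f : linbd f -> forall x, 0 <= f x. Proof. by case. Qed.

End linbd.

Section levy_exponent.
Context (R : realType).
Variable rho : R -> R.
Hypothesis hrho : infinite_levy_density rho.
Implicit Types f h : R -> R.

Definition levy_exp f : R -> R := fun x => 1 - expR (- f x).

(** The base common to all parameters: the Laplace functional of [BN(s)] at [f] is [phi f] to the
    power [-s], so that differentiating replaces [s] by [s + 1]. *)
Definition phi f : R := 1 + fine (levy_int rho (levy_exp f)).

Lemma levy_exp_ge0 f : (forall x, 0 <= f x) -> forall x, 0 <= levy_exp f x.
Proof. by move=> f0 x; rewrite subr_ge0 -[leRHS]expR0 ler_expR oppr_le0. Qed.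

Lemma measurable_levy_exp f : measurable_fun setT f -> measurable_fun setT (levy_exp f).
Proof.
move=> mf; apply: measurable_funB => //; apply: measurableT_comp => //.
exact: measurable_funN.
Qed.

Lemma levy_exp_fin f : linbd f -> levy_int rho (levy_exp f) \is a fin_num.
Proof.
move=> [mf f0 [C C0 fC]].
rewrite ge0_fin_numE; last by apply/levy_int_ge0 => //; exact: levy_exp_ge0.
apply: (@levy_int_fin _ _ hrho (C + 1)); [by rewrite addr_ge0|exact: levy_exp_ge0|].
move=> x x0; have := fC x; rewrite gtr0_norm// => fx.
have := expR_ge1Dx (- f x); have := expR_gt0 (- f x); rewrite /levy_exp.
by rewrite /Num.min; case: ifPn => //; nra.
Qed.

Lemma phi_ge1 f : linbd f -> 1 <= phi f.
Proof.
move=> lf; rewrite lerDl fine_ge0// levy_int_ge0//; apply: levy_exp_ge0.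
exact: linbd_ge0.
Qed.

End levy_exponent.

Section bn_points.
Context d (T : measurableType d) (R : realType) (P : probability T R).
Variables (rho : R -> R) (r : R) (J : nat -> T -> R).

(** All that is kept of the process from here on: positive measurable points and their Laplace
    functional on [linbd]. The kernel and the ranking are forgotten. *)
Definition bn_points := [/\ forall i, measurable_fun setT (J i),
  forall i w, 0 < J i w &
  forall f, linbd f ->
    (\int[P]_w expeR (- psum J f w) = (phi rho f `^ (- r))%:E)%E].

End bn_points.

Lemma BN_process_points d (T : measurableType d) (R : realType)
    (P : probability T R) (B : R.-ker T ~> R) (J : nat -> {RV P >-> R}) rho r :
  infinite_levy_density rho -> BN_process r rho B J ->
  bn_points P rho r (fun i => J i : T -> R).
Proof.
move=> hrho hB; split; first by move=> i; exact: measurable_funPT.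
  by move=> i w; apply: (BN_gt0 hB).
move=> f lf; case: (lf) => mf f0 _.
rewrite (BN_psum_laplace hB mf f0) -(fineK (levy_exp_fin hrho lf)).
rewrite -EFinD -/(phi rho f) poweR_EFin inver gt_eqF//; last first.
  by rewrite powR_gt0// (lt_le_trans _ (phi_ge1 hrho lf)).
by rewrite powRN.
Qed.

Lemma measurable_expeR (R : realType) : measurable_fun setT (@expeR R).
Proof.
(* [er_map] fixes [-oo], where [expeR] is 0; the maximum with 0 corrects this value. *)
have -> : @expeR R = fun x => maxe 0%E (er_map (@expR R) x).
  apply/funext => -[x| |]; apply/esym.
  - by apply/max_idPr; rewrite lee_fin expR_ge0.
  - by apply/max_idPr; rewrite leey.
  - by apply/max_idPl; rewrite leNye.
apply: measurable_maxe => //.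
exact: (@measurable_er_map _ R R _ (@measurable_expR R)).
Qed.

Section bn_finite.
Context d (T : measurableType d) (R : realType) (P : probability T R).
Variables (rho : R -> R) (r : R) (J : nat -> T -> R).
Hypothesis hrho : infinite_levy_density rho.
Hypothesis r0 : 0 < r.
Hypothesis hJ : bn_points P rho r J.

Let mJ i : measurable_fun setT (J i). Proof. by case: hJ. Qed.

Lemma measurable_psum_lin f : linbd f -> measurable_fun setT (psum J f).
Proof. by move=> [mf f0 _]; exact: measurable_psum. Qed.

Lemma measurable_expeR_psum f : linbd f ->
  measurable_fun setT (fun w => expeR (- psum J f w)%E).
Proof.
move=> lf; apply: measurableT_comp; first exact: measurable_expeR.
by apply: measurableT_comp => //; exact: measurable_psum_lin.
Qed.

(** [expR (- c T)] vanishes where [T = +oo], so [P(T < +oo)] is at least its mean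
    [phi^(-r) >= 1 - r I], where [I] is the integral of [1 - expR (- c |x|)] against [Pi]. By
    dominated convergence [I] tends to 0 with [c = 1 / (n + 1)]. *)
Lemma psum_norm_fin : {ae P, forall w, (psum J Num.norm w < +oo)%E}.
Proof.
pose E := [set w | (psum J Num.norm w < +oo)%E].
have mE : measurable E.
  rewrite /E -[X in measurable X]setTI; apply: emeasurable_fun_infty_o => //.
  exact: measurable_psum_lin (linbd_norm R).
pose c (n : nat) : R := harmonic n.
have c0 n : 0 < c n by rewrite /c /harmonic/= invr_gt0.
have lc n : linbd (fun x : R => c n * `|x|) by apply: linbdZ (linbd_norm R); exact: ltW.
pose I n := fine (levy_int rho (levy_exp (fun x => c n * `|x|))).
have I0 n : 0 <= I n.
  by rewrite fine_ge0// levy_int_ge0//; apply: levy_exp_ge0; exact: linbd_ge0.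
have PE n : ((1 - r * I n)%:E <= P E)%E.
  apply: (@le_trans _ _ (\int[P]_w expeR (- psum J (fun x => c n * `|x|)%R w))%E).
    case: hJ => _ _ /(_ _ (lc n)) ->; rewrite lee_fin /phi -/(I n).
    rewrite /powR gt_eqF ?ltr_pwDl//; apply: le_trans (expR_ge1Dx _).
    rewrite lerD2l mulNr lerN2 ler_wpM2l ?(ltW r0)// le_ln1Dx//.
    by rewrite (lt_le_trans _ (I0 n)).
  rewrite -(setIT E) -integral_indic//; apply: ge0_ae_le_integralT.
  - by move=> w; exact: expeR_ge0.
  - by move=> w; rewrite lee_fin.
  - apply/aeW => w; rewrite psumZ// indicE.
    have S0 : (0 <= psum J Num.norm w)%E by exact: psum_ge0.
    have [wE|wE] := boolP (w \in E).
      rewrite -[leRHS]expeR0 lee_expeR oppe_le0 mule_ge0// lee_fin ltW//.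
    have -> : psum J Num.norm w = +oo%E.
      apply/eqP; rewrite -leye_eq leNgt; apply/negP => H.
      by move: wE; rewrite notin_setE; apply.
    by rewrite gt0_muley ?lte_fin.
have Ic : I @ \oo --> 0.
  apply: fine_cvg.
  have [//|||||_ _] := @dominated_convergence _ _ _ (@lebesgue_measure R) setT measurableT
    (fun n x => (levy_exp (fun x => c n * `|x|) x * rho0 rho x)%:E) (cst 0%E)
    (fun x => (levy_exp Num.norm x * rho0 rho x)%:E).
  - move=> n; apply: measurable_levy => //; apply: measurable_levy_exp.
    exact: linbd_measurable.
  - exact: measurable_cst.
  - apply/aeW => x _; apply: cvg_EFin; first exact: nearW.
    rewrite -(mul0r (rho0 rho x)); apply: cvgMl.
    rewrite -(subrr 1) -[X in _ --> _ - X](expR0) -oppr0 -(mul0r `|x|).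
    apply: cvgB; first exact: cvg_cst.
    apply: continuous_cvg; first exact: continuous_expR.
    by apply: cvgN; apply: cvgMl; exact: cvg_harmonic.
  - apply/integrableP; split.
      exact: (measurable_levy hrho (measurable_levy_exp (@normr_measurable R setT))).
    have := levy_exp_fin hrho (linbd_norm R); rewrite ge0_fin_numE; last first.
      by apply: levy_int_ge0 => //; exact: levy_exp_ge0.
    apply: le_lt_trans; rewrite le_eqVlt; apply/orP; left; apply/eqP.
    apply: eq_integral => x _; rewrite gee0_abs// lee_fin mulr_ge0 ?rho0_ge0//.
    exact: levy_exp_ge0.
  - apply/aeW => x n _; rewrite gee0_abs ?lee_fin; last first.
      rewrite mulr_ge0 ?rho0_ge0//; apply: levy_exp_ge0; exact: linbd_ge0.
    rewrite ler_wpM2r ?rho0_ge0// /levy_exp lerD2l lerN2 ler_expR lerN2.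
    by rewrite ler_piMl// /c /harmonic/= invf_le1// ler1n.
  by rewrite integral0.
have P1 : P E = 1%E.
  apply/eqP; rewrite eq_le probability_le1//=.
  have H : (1 - r * I n)%:E @[n --> \oo] --> 1%E; last first.
  - by apply: (cvge_to_le H); apply: nearW => n; exact: PE.
  - apply: cvg_EFin; first exact: nearW.
    rewrite -[X in _ --> X]subr0 -[X in _ --> _ - X](mulr0 r).
    by apply: cvgB; [exact: cvg_cst|exact: cvgMr].
exists (~` E); split => //; first exact: measurableC.
by rewrite probability_setC// P1 subee.
Qed.

Lemma psum_fin : {ae P, forall w, forall f, linbd f -> psum J f w \is a fin_num}.
Proof.
apply: filterS psum_norm_fin => w Tw f [mf f0 [C C0 fC]].
rewrite ge0_fin_numE; last exact: psum_ge0.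
apply: (@le_lt_trans _ _ (C%:E * psum J Num.norm w)%E).
  by rewrite -psumZ//; apply: le_psum.
by apply: lte_mul_pinfty => //; rewrite ge0_fin_numE// psum_ge0.
Qed.

End bn_finite.

(** * The Mecke formula *)

Section levy_quotient.
Context (R : realType) (rho : R -> R).
Hypothesis hrho : infinite_levy_density rho.
Variables f h : R -> R.
Hypotheses (lf : linbd f) (lh : linbd h).

(** The derivative of [levy_exp (f + l h)] at [l = 0]. *)
Definition tilt (f h : R -> R) : R -> R := fun x => expR (- f x) * h x.

Lemma measurable_tilt (u v : R -> R) : measurable_fun setT u ->
  measurable_fun setT v -> measurable_fun setT (tilt u v).
Proof.
move=> mu mv; apply: measurable_funM => //; apply: measurableT_comp => //.
exact: measurable_funN.
Qed.

Let mdq k : measurable_fun setT (tilt f (dquot k \o h)).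
Proof.
apply: measurable_tilt; first exact: linbd_measurable.
by apply: measurableT_comp; [exact: measurable_dquot|exact: linbd_measurable].
Qed.

Let dq0 k x : 0 <= tilt f (dquot k \o h) x.
Proof. by rewrite mulr_ge0 ?expR_ge0// dquot_ge0//; exact: linbd_ge0. Qed.

Lemma tilt_le (u v : R -> R) x : (forall x, 0 <= u x) -> (forall x, 0 <= v x) ->
  tilt u v x <= v x.
Proof.
by move=> u0 v0; rewrite ler_piMl// -[leRHS]expR0 ler_expR oppr_le0.
Qed.

(** Finite even if [h] is not [Pi]-integrable near infinity, because [dquot k] is bounded by
    [2^k]. *)
Lemma levy_dquot_fin k : levy_int rho (tilt f (dquot k \o h)) \is a fin_num.
Proof.
rewrite ge0_fin_numE; last exact: levy_int_ge0.
case: (lh) => mh h0 [C C0 hC].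
have e0 : (0 < 2 ^+ k :> R) by rewrite exprn_gt0.
apply: (@levy_int_fin _ _ hrho (C + 2 ^+ k)); [by rewrite addr_ge0// ltW|by []|].
move=> x x0; apply: (@le_trans _ _ (dquot k (h x))).
  apply: (@tilt_le f (dquot k \o h)); first exact: linbd_ge0.
  by move=> y; exact: dquot_ge0.
have h1 : dquot k (h x) <= C * x.
  by apply: le_trans (dquot_le _ _) _; have := hC x; rewrite gtr0_norm.
have h2 : dquot k (h x) <= 2 ^+ k.
  by rewrite ler_piMr ?(ltW e0)// gerBl expR_ge0.
rewrite /Num.min; case: ifPn => _.
  by rewrite mulrDl (le_trans h1)// lerDl mulr_ge0// ltW.
by rewrite mulr1 (le_trans h2)// lerDr.
Qed.

Let I k := fine (levy_int rho (tilt f (dquot k \o h))).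

Lemma levy_dquot_ge0 k : 0 <= I k.
Proof. by rewrite fine_ge0// levy_int_ge0. Qed.

(** An exact identity, not an expansion; it puts the increments of [phi] in the form required by
    [cvg_powRN_quot], with [x k = I k]. *)
Lemma phi_dquot k :
  phi rho (fun x => f x + 2 ^- k * h x) = phi rho f + I k / 2 ^+ k.
Proof.
have e0 : (0 < 2 ^+ k :> R) by rewrite exprn_gt0.
have ie0 : (0 <= 2 ^- k :> R) by rewrite invr_ge0 ltW.
rewrite /phi -addrA; congr (1 + _).
rewrite [X in _ + X]mulrC.
have -> : 2 ^- k * I k = fine ((2 ^- k)%:E * levy_int rho (tilt f (dquot k \o h)))%E.
  by rewrite fineM// levy_dquot_fin.
rewrite -fineD ?levy_exp_fin ?fin_numM ?levy_dquot_fin//.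
congr fine; rewrite /levy_int -ge0_integralZl//; last 2 first.
- exact: measurable_levy.
- by move=> x _; rewrite lee_fin mulr_ge0 ?rho0_ge0.
rewrite -ge0_integralD//; last first.
- by apply: measurable_funeM; exact: measurable_levy.
- by move=> x _; rewrite mule_ge0// lee_fin mulr_ge0 ?rho0_ge0.
- by apply: measurable_levy => //; apply: measurable_levy_exp; exact: linbd_measurable.
- move=> x _; rewrite lee_fin mulr_ge0 ?rho0_ge0//; apply: levy_exp_ge0.
  exact: linbd_ge0.
apply: eq_integral => x _; rewrite -EFinM -EFinD; congr EFin.
rewrite mulrA -mulrDl; congr (_ * _); rewrite /levy_exp /tilt /dquot /=.
rewrite opprD expRD (mulrC (2 ^- k) (h x)).
by field; rewrite gt_eqF.
Qed.

Lemma cvg_levy_dquot : (levy_int rho (tilt f h) < +oo)%E ->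
  I @ \oo --> fine (levy_int rho (tilt f h)).
Proof.
move=> fin; apply: fine_cvg; rewrite fineK; last first.
  rewrite ge0_fin_numE//; apply: (levy_int_ge0 hrho) => x.
  by rewrite mulr_ge0 ?expR_ge0//; exact: linbd_ge0.
have E x : (tilt f (dquot k \o h) x * rho0 rho x)%:E @[k --> \oo] -->
    (tilt f h x * rho0 rho x)%:E.
  apply: cvg_EFin; first exact: nearW.
  by apply: cvgMl; apply: cvgMr; apply: cvg_dquot; exact: linbd_ge0.
rewrite /levy_int.
rewrite (_ : (fun x => (tilt f h x * rho0 rho x)%:E) =
   (fun x => limn (fun k => (tilt f (dquot k \o h) x * rho0 rho x)%:E))); last first.
  by apply/funext => x; apply/esym/cvg_lim => //; exact: E.
apply: cvg_monotone_convergence => //.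
- by move=> k; exact: measurable_levy.
- by move=> k x _; rewrite lee_fin mulr_ge0 ?rho0_ge0.
- move=> x _ m n mn; rewrite lee_fin ler_wpM2r ?rho0_ge0// ler_wpM2l ?expR_ge0//.
  exact: dquot_nd.
Qed.

End levy_quotient.

Section mecke.
Context d (T : measurableType d) (R : realType) (P : probability T R).
Context d' (T' : measurableType d') (P' : probability T' R).
Variables (rho : R -> R) (r : R) (J : nat -> T -> R) (J' : nat -> T' -> R).
Hypothesis hrho : infinite_levy_density rho.
Hypothesis r0 : 0 < r.
Hypothesis hJ : bn_points P rho r J.
Hypothesis hJ' : bn_points P' rho (r + 1) J'.
Variables f h : R -> R.
Hypotheses (lf : linbd f) (lh : linbd h).

Let lfh k : linbd (fun x => f x + 2 ^- k * h x).
Proof. by apply: linbdD => //; apply: linbdZ => //; rewrite invr_ge0 ltW. Qed.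

Let mpsum g : linbd g -> measurable_fun setT (psum J g).
Proof. by move=> lg; apply: (measurable_psum_lin hJ). Qed.

Let S0 w : (0 <= psum J h w)%E.
Proof. by apply: psum_ge0; exact: linbd_ge0. Qed.

Let mdq k : measurable_fun setT (fun w => (dquot k (fine (psum J h w)))%:E).
Proof.
apply/measurable_EFinP; apply: measurableT_comp; first exact: measurable_dquot.
by apply: measurableT_comp => //; exact: mpsum.
Qed.

Let dq0 k w : (0 <= (dquot k (fine (psum J h w)))%:E)%E.
Proof. by rewrite lee_fin dquot_ge0// fine_ge0. Qed.

Let mexp g : linbd g -> measurable_fun setT (fun w => expeR (- psum J g w)%E).
Proof. by move=> lg; apply: (measurable_expeR_psum hJ). Qed.

(* The difference quotient of l |-> E e^{-B(f + l h)} at step 2^-k. *)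
Let bn_dquot_aux k (a b : R) :
  (\int[P]_w expeR (- psum J f w) = a%:E)%E ->
  (\int[P]_w expeR (- psum J (fun x => f x + 2 ^- k * h x)%R w) = b%:E)%E ->
  (\int[P]_w (expeR (- psum J f w) * (dquot k (fine (psum J h w)))%:E) =
   (2 ^+ k * (a - b))%:E)%E.
Proof.
move=> ha hb.
(* Moving the subtracted integral to the left leaves only nonnegative integrands. *)
have H : (\int[P]_w (expeR (- psum J f w) * (dquot k (fine (psum J h w)))%:E) +
   (2 ^+ k)%:E * b%:E = (2 ^+ k)%:E * a%:E)%E.
  rewrite -ha -hb.
  have ek0 : (0 <= (2 ^+ k)%:E :> \bar R)%E by rewrite lee_fin ltW.
  have mg := mexp lf; have mg' := mexp (lfh k).
  have g0 g w : (0 <= expeR (- psum J g w))%E by exact: expeR_ge0.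
  rewrite -(ge0_integralZl _ measurableT mg')//.
  rewrite -(ge0_integralZl _ measurableT mg)//.
  rewrite -ge0_integralD//; last first.
  - by apply: measurable_funeM; exact: mexp.
  - by move=> w _; rewrite mule_ge0 ?expeR_ge0// lee_fin ltW.
  - by apply: emeasurable_funM => //; exact: mexp.
  - by move=> w _; rewrite mule_ge0 ?expeR_ge0.
  apply: ge0_ae_eq_integralT.
  - by move=> w; rewrite adde_ge0// mule_ge0 ?expeR_ge0// lee_fin ltW.
  - by move=> w; rewrite mule_ge0 ?expeR_ge0// lee_fin ltW.
  apply: filterS (psum_fin hrho r0 hJ) => w fw.
  rewrite psumD; [|exact: linbd_ge0|by move=> x; rewrite mulr_ge0 ?(linbd_ge0 lh)// invr_ge0 ltW].
  rewrite psumZ; last exact: linbd_ge0.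
  rewrite -(fineK (fw _ lf)) -(fineK (fw _ lh)) /= -!EFinM -EFinD.
  congr EFin; rewrite /dquot opprD expRD (mulrC (2 ^- k) (fine _)).
  by field.
by rewrite mulrBr EFinB 2!EFinM -H addeK.
Qed.

Lemma bn_dquot k :
  (\int[P]_w (expeR (- psum J f w) * (dquot k (fine (psum J h w)))%:E) =
  (2 ^+ k * (phi rho f `^ (- r) -
     phi rho (fun x => f x + 2 ^- k * h x)%R `^ (- r)))%:E)%E.
Proof. by case: hJ => _ _ hL; apply: bn_dquot_aux; exact: hL. Qed.

(** The limit of [bn_dquot]: monotone convergence on the left, [cvg_powRN_quot] on the right. *)
Lemma mecke_phi : (levy_int rho (tilt f h) < +oo)%E ->
  (\int[P]_w (expeR (- psum J f w) * psum J h w) =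
   (r * phi rho f `^ (- (r + 1)) * fine (levy_int rho (tilt f h)))%:E)%E.
Proof.
move=> fin.
have c1 := cvg_powRN_quot r0 (phi_ge1 hrho lf) (levy_dquot_ge0 hrho f lh)
  (cvg_levy_dquot hrho lf lh fin).
have c2 : (\int[P]_w (expeR (- psum J f w) * (dquot k (fine (psum J h w)))%:E))%E @[k --> \oo] -->
    (\int[P]_w (expeR (- psum J f w) * (fine (psum J h w))%:E))%E.
  have E w : ((expeR (- psum J f w) * (dquot k (fine (psum J h w)))%:E) @[k --> \oo] -->
    (expeR (- psum J f w) * (fine (psum J h w))%:E))%E.
    apply: nondecreasing_ge0_cvgeZl => //.
    - exact: expeR_ge0.
    - by move=> m n mn; rewrite lee_fin dquot_nd.
    - apply: cvg_EFin; first exact: nearW.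
      by apply: cvg_dquot; rewrite fine_ge0.
  rewrite (_ : (fun w => (expeR (- psum J f w) * (fine (psum J h w))%:E)%E) =
    (fun w => limn (fun k => (expeR (- psum J f w) * (dquot k (fine (psum J h w)))%:E))%E)); last first.
    by apply/funext => w; apply/esym/cvg_lim => //; exact: E.
  apply: cvg_monotone_convergence => //.
  - by move=> k; apply: emeasurable_funM => //; exact: mexp.
  - by move=> k w _; rewrite mule_ge0// expeR_ge0.
  - move=> w _ m n mn; rewrite lee_wpmul2l ?expeR_ge0// lee_fin; exact: dquot_nd.
rewrite (@ge0_ae_eq_integralT _ _ _ _ _
  (fun w => (expeR (- psum J f w) * (fine (psum J h w))%:E)%E)).
- rewrite -(cvg_lim _ c2)//; apply/cvg_lim => //.
  under eq_fun do rewrite bn_dquot (phi_dquot hrho lf lh).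
  by apply: cvg_EFin; [exact: nearW|exact: c1].
- by move=> w; rewrite mule_ge0 ?expeR_ge0.
- by move=> w; rewrite mule_ge0 ?expeR_ge0// lee_fin fine_ge0.
- by apply: filterS (psum_fin hrho r0 hJ) => w fw; rewrite fineK// fw.
Qed.

(* By mecke_phi, since phi^{-(r+1)} is the Laplace functional of BN(r+1). *)
Lemma mecke : (levy_int rho (tilt f h) < +oo)%E ->
  (\int[P]_w (expeR (- psum J f w) * psum J h w) =
   r%:E * levy_int rho (tilt f h) * \int[P']_w expeR (- psum J' f w))%E.
Proof.
move=> fin; rewrite mecke_phi//; case: hJ' => _ _ ->//.
rewrite -[in RHS](fineK (_ : levy_int rho (tilt f h) \is a fin_num)).
  by rewrite -!EFinM mulrAC.
rewrite ge0_fin_numE//; apply: (levy_int_ge0 hrho) => x.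
by rewrite mulr_ge0 ?expR_ge0//; exact: linbd_ge0.
Qed.

End mecke.

Section product_integral.
Local Open Scope ereal_scope.
Context d1 (T1 : measurableType d1) d2 (T2 : measurableType d2) (R : realType).
Variables (m1 : {sigma_finite_measure set T1 -> \bar R})
  (m2 : {sigma_finite_measure set T2 -> \bar R}).

Lemma ge0_integral_prodM (a : T1 -> \bar R) (b : T2 -> \bar R) :
  (forall x, 0 <= a x) -> (forall y, 0 <= b y) ->
  measurable_fun setT a -> measurable_fun setT b ->
  \int[m1 \x m2]_z (a z.1 * b z.2) = \int[m1]_x a x * \int[m2]_y b y.
Proof.
move=> a0 b0 ma mb; rewrite fubini_tonelli1//; last 2 first.
- by apply: emeasurable_funM; exact: measurableT_comp.
- by move=> z; rewrite mule_ge0.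
rewrite -ge0_integralZr//; last exact: integral_ge0.
by apply: eq_integral => x _; rewrite /fubini_F/= ge0_integralZl.
Qed.

End product_integral.

(** The absolute value makes the total sum the [psum] of a function of [linbd]; it agrees with
    [sum_points] since the points are positive. *)
Definition tsum (T : Type) (R : realType) (J : nat -> T -> R) w : R :=
  fine (psum J Num.norm w).

Lemma tsum_ge0 (T : Type) (R : realType) (J : nat -> T -> R) w : 0 <= tsum J w.
Proof. by rewrite fine_ge0// psum_ge0. Qed.

Section total_sum.
Context d (T : measurableType d) (R : realType) (P : probability T R).
Variables (rho : R -> R) (r : R) (J : nat -> T -> R).
Hypothesis hrho : infinite_levy_density rho.
Hypothesis r0 : 0 < r.
Hypothesis hJ : bn_points P rho r J.

Lemma measurable_tsum : measurable_fun setT (tsum J).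
Proof.
apply: measurableT_comp => //; apply: (measurable_psum_lin hJ).
exact: linbd_norm.
Qed.

(** Adding [l |x|] to the test function tilts by [expR (- l T)], so the Laplace functional contains
    the Laplace transform of the total sum. One null set serves all [f] and [l]. *)
Lemma expeR_psum_tsum : {ae P, forall w, forall f l, linbd f -> 0 <= l ->
  (expeR (- psum J (fun x => f x + l * `|x|)%R w) =
   expeR (- psum J f w) * (expR (- (l * tsum J w)))%:E)%E}.
Proof.
apply: filterS (psum_fin hrho r0 hJ) => w fw f l lf l0.
rewrite psumD; [|exact: linbd_ge0|by move=> x; rewrite mulr_ge0].
rewrite psumZ// /tsum -(fineK (fw _ lf)) -(fineK (fw _ (linbd_norm R))) /=.
by rewrite opprD expRD EFinM.
Qed.

End total_sum.

(** For [x > 0] the integrand is at most [C x expR (- x)], hence at most [C min(x, 1)]. *)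
Lemma tilt_norm_fin (R : realType) (rho f h : R -> R) :
  infinite_levy_density rho -> linbd f -> linbd h -> (forall x, `|x| <= f x) ->
  (levy_int rho (tilt f h) < +oo)%E.
Proof.
move=> hrho lf [mh h0 [C C0 hC]] fx.
apply: (@levy_int_fin _ _ hrho C) => // x.
  by rewrite mulr_ge0 ?expR_ge0.
move=> x0; apply: (@le_trans _ _ (expR (- x) * (C * x))).
  rewrite ler_pM ?expR_ge0//; last by have := hC x; rewrite gtr0_norm.
  by rewrite ler_expR lerN2; have := fx x; rewrite gtr0_norm.
rewrite mulrCA ler_wpM2l// expRN mulrC ler_pdivrMr ?expR_gt0//.
have := expR_ge1Dx x; rewrite /Num.min; case: ifPn => _; nra.
Qed.

Section mecke_sum.
Local Open Scope ereal_scope.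
Context d (T : measurableType d) (R : realType) (P : probability T R).
Context d' (T' : measurableType d') (P' : probability T' R).
Variables (rho : R -> R) (r : R) (J : nat -> T -> R) (J' : nat -> T' -> R).
Hypothesis hrho : infinite_levy_density rho.
Hypothesis r0 : (0 < r)%R.
Hypothesis hJ : bn_points P rho r J.
Hypothesis hJ' : bn_points P' rho (r + 1)%R J'.
Variables f h : R -> R.
Hypotheses (lf : linbd f) (lh : linbd h).
Notation mu := (@lebesgue_measure R).

Let r10 : (0 < r + 1)%R. Proof. by rewrite addr_gt0. Qed.

(** The extra [|x|] weights by [expR (- T)], which makes the mass of [w1] finite; for [f] alone the
    mean of [expR (- B(f)) B(h)] can be infinite. *)
Let f1 x := (f x + 1 * `|x|)%R.

Let lf1 : linbd f1.
Proof. by apply: linbdD => //; apply: linbdZ => //; exact: linbd_norm. Qed.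

Let f1x x : (`|x| <= f1 x)%R.
Proof. by rewrite /f1 mul1r lerDr; exact: linbd_ge0. Qed.

Let w1 w := expeR (- psum J f1 w) * psum J h w.
Let w2 (z : T' * R) := expeR (- psum J' f1 z.1) * (r * (tilt f1 h z.2 * rho0 rho z.2))%:E.

Let w10 w : 0 <= w1 w.
Proof. by rewrite mule_ge0 ?expeR_ge0// psum_ge0//; exact: linbd_ge0. Qed.

Let t0 u x : (0 <= tilt u h x * rho0 rho x)%R.
Proof. by rewrite mulr_ge0 ?rho0_ge0// mulr_ge0 ?expR_ge0//; exact: linbd_ge0. Qed.

Let w20 z : 0 <= w2 z.
Proof. by rewrite mule_ge0 ?expeR_ge0// lee_fin mulr_ge0// ltW. Qed.

Let mw1 : measurable_fun setT w1.
Proof.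
apply: emeasurable_funM; first exact: (measurable_expeR_psum hJ).
exact: (measurable_psum_lin hJ).
Qed.

Let mt u : linbd u -> measurable_fun setT (fun x => (tilt u h x * rho0 rho x)%R).
Proof.
move=> lu; apply: measurable_funM; last exact: measurable_rho0.
by apply: measurable_tilt; exact: linbd_measurable.
Qed.

Let mw2 : measurable_fun setT w2.
Proof.
apply: emeasurable_funM.
  by apply: (measurableT_comp (measurable_expeR_psum hJ' lf1)).
apply/measurable_EFinP; apply: measurable_funM => //.
by apply: (measurableT_comp (mt lf1)).
Qed.

(** The total sum before the point [z.2] is removed. *)
Let Y2 (z : T' * R) := (tsum J' z.1 + `|z.2|)%R.

Let mY2 : measurable_fun setT Y2.
Proof.
apply: measurable_funD; first exact: (measurableT_comp (measurable_tsum hJ')).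
by apply: measurableT_comp => //; exact: normr_measurable.
Qed.

Let fin1 : \int[P]_w w1 w < +oo.
Proof. by rewrite (mecke_phi hrho r0 hJ lf1 lh) ?ltry// tilt_norm_fin. Qed.

Let f2 l x := (f1 x + l * `|x|)%R.

Let lf2 l : (0 <= l)%R -> linbd (f2 l).
Proof. by move=> l0; apply: linbdD => //; apply: linbdZ => //; exact: linbd_norm. Qed.

Let lap l : (0 <= l)%R -> \int[P]_w (w1 w * (expR (- (l * tsum J w)))%:E) =
  \int[P' \x mu]_z (w2 z * (expR (- (l * Y2 z)))%:E).
Proof.
move=> l0; have l2 := lf2 l0.
transitivity (\int[P]_w (expeR (- psum J (f2 l) w) * psum J h w)).
  apply: ge0_ae_eq_integralT => [w|w|].
  - by rewrite mule_ge0 ?lee_fin ?expR_ge0.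
  - by rewrite mule_ge0 ?expeR_ge0// psum_ge0//; exact: linbd_ge0.
  - apply: filterS (expeR_psum_tsum hrho r0 hJ) => w /(_ f1 l lf1 l0) ->.
    by rewrite muleAC.
rewrite (mecke hrho r0 hJ hJ' l2 lh); last first.
  apply: tilt_norm_fin => // x; apply: (le_trans (f1x x)).
  by rewrite lerDl mulr_ge0.
transitivity (\int[P' \x mu]_z ((expeR (- psum J' f1 z.1) *
    (expR (- (l * tsum J' z.1)))%:E) * (r * (tilt (f2 l) h z.2 * rho0 rho z.2))%:E)).
  rewrite (@ge0_integral_prodM _ _ _ _ _ P' mu
    (fun w => expeR (- psum J' f1 w) * (expR (- (l * tsum J' w)))%:E)
    (fun x => (r * (tilt (f2 l) h x * rho0 rho x))%:E)).
  - rewrite muleC; congr (_ * _).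
      apply: ge0_ae_eq_integralT => [w|w|].
      + exact: expeR_ge0.
      + by rewrite mule_ge0 ?expeR_ge0// lee_fin expR_ge0.
      + by apply: filterS (expeR_psum_tsum hrho r10 hJ') => w /(_ f1 l lf1 l0) ->.
    rewrite /levy_int -ge0_integralZl//.
    - by apply/measurable_EFinP; exact: mt.
    - by move=> x _; rewrite lee_fin.
    - by rewrite lee_fin ltW.
  - by move=> w; rewrite mule_ge0 ?expeR_ge0// lee_fin expR_ge0.
  - by move=> x; rewrite lee_fin mulr_ge0// ltW.
  - apply: emeasurable_funM; first exact: (measurable_expeR_psum hJ').
    apply/measurable_EFinP; apply: measurableT_comp => //; apply: measurable_funN.
    by apply: measurable_funM => //; exact: (measurable_tsum hJ').
  - by apply/measurable_EFinP; apply: measurable_funM => //; exact: mt.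
apply: eq_integral => z _; rewrite /w2 -!muleA; congr (_ * _).
rewrite -!EFinM; congr EFin; rewrite /Y2 /tilt /f2 mulrDr !opprD !expRD; ring.
Qed.

(* V is reached from exponentials of the total sum by uniqueness of Laplace
   transforms: |x| is the test function whose integral is the total sum. *)
Lemma mecke_tsum (V : R -> \bar R) : (forall t, 0 <= V t) -> measurable_fun setT V ->
  \int[P]_w (expeR (- psum J f w) * psum J h w * V (tsum J w)) =
  r%:E * \int[P']_w (expeR (- psum J' f w) *
    \int[mu]_x ((tilt f h x * rho0 rho x)%:E * V (tsum J' w + `|x|)%R)).
Proof.
move=> V0 mV.
(* The factor [expR t] undoes the weight introduced by [f1]. *)
pose psi t := (expR t)%:E * V t.
have psi0 t : 0 <= psi t by rewrite mule_ge0// lee_fin expR_ge0.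
have mpsi : measurable_fun setT psi.
  by apply: emeasurable_funM => //; apply/measurable_EFinP.
have := laplace_unique (mu2 := (P' \x mu : {measure set _ -> \bar R})) w10 w20 mw1 mw2 (measurable_tsum hJ) mY2 (@tsum_ge0 _ _ J)
  (fun z => addr_ge0 (tsum_ge0 J' z.1) (normr_ge0 z.2)) fin1 lap psi0 mpsi.
move=> H; transitivity (\int[P]_w (w1 w * psi (tsum J w))).
  apply: ge0_ae_eq_integralT => [w|w|].
  - by rewrite !mule_ge0 ?expeR_ge0// psum_ge0//; exact: linbd_ge0.
  - by rewrite mule_ge0.
  - apply: filterS (expeR_psum_tsum hrho r0 hJ) => w /(_ f 1%R lf ler01) E.
    rewrite /w1 /psi E mul1r (muleAC _ _ (psum _ _ _)) -!muleA.
    by rewrite (muleA (expR _)%:E (expR _)%:E) -EFinM -expRD addNr expR0 mul1e.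
rewrite H fubini_tonelli1//; last 2 first.
- by apply: emeasurable_funM => //; exact: measurableT_comp.
- by move=> z; rewrite mule_ge0.
rewrite -ge0_integralZl//; last 3 first.
- apply: emeasurable_funM; first exact: (measurable_expeR_psum hJ').
  apply: (@measurable_fun_fubini_tonelli_F _ _ _ _ _ mu
    (fun z => (tilt f h z.2 * rho0 rho z.2)%:E * V (tsum J' z.1 + `|z.2|)%R)).
    apply: emeasurable_funM; last exact: measurableT_comp.
    by apply/measurable_EFinP; exact: (measurableT_comp (mt lf)).
  by move=> z; rewrite mule_ge0// lee_fin.
- move=> w _; rewrite mule_ge0 ?expeR_ge0//; apply: integral_ge0 => x _.
  by rewrite mule_ge0// lee_fin.
- by rewrite lee_fin ltW.
apply: ge0_ae_eq_integralT => [w|w|].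
- by apply: integral_ge0 => x _; rewrite mule_ge0.
- rewrite mule_ge0 ?lee_fin ?(ltW r0)// mule_ge0 ?expeR_ge0//.
  by apply: integral_ge0 => x _; rewrite mule_ge0// lee_fin.
- apply: filterS (expeR_psum_tsum hrho r10 hJ') => w /(_ f 1%R lf ler01) E.
  have mVx : measurable_fun setT (fun x => (tilt f h x * rho0 rho x)%:E *
      V (tsum J' w + `|x|)%R).
    apply: emeasurable_funM; first by apply/measurable_EFinP; exact: mt.
    have mg : measurable_fun setT (fun x : R => (tsum J' w + `|x|)%R).
      by apply: measurable_funD => //; exact: normr_measurable.
    exact: measurableT_comp mV mg.
  rewrite muleCA -ge0_integralZl//; last 2 first.
  - by move=> x _; rewrite mule_ge0// lee_fin.
  - by rewrite lee_fin ltW.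
  rewrite -ge0_integralZl//; last 3 first.
  - exact: measurable_funeM.
  - by move=> x _; rewrite !mule_ge0 ?lee_fin// ltW.
  - exact: expeR_ge0.
  apply: eq_integral => x _; rewrite /w2 /fubini_F /psi /Y2 /= E.
  rewrite -!muleA; congr (_ * _); rewrite !muleA; congr (_ * _).
  rewrite -!EFinM; congr EFin; rewrite /tilt /f1 !mul1r opprD !expRD !expRN.
  by field; rewrite !gt_eqF ?expR_gt0.
Qed.

End mecke_sum.

(** * Distinctness of the points *)

Section distinct_points.
Context d (T : measurableType d) (R : realType) (P : probability T R).
Variables (rho : R -> R) (r : R) (J : nat -> T -> R).
Hypothesis hrho : infinite_levy_density rho.
Hypothesis r0 : 0 < r.
Hypothesis hJ : bn_points P rho r J.
Notation mu := (@lebesgue_measure R).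

Let mJ i : measurable_fun setT (J i). Proof. by case: hJ. Qed.

Section one_interval.
Variables (e : R) (A : set R).
Hypotheses (e0 : 0 < e) (mA : measurable A) (Ae : A `<=` [set x | e < x]).

Let iA : R -> R := \1_A.

Let miA : measurable_fun setT iA. Proof. exact: measurable_indic. Qed.

Lemma linbd_indic : linbd iA.
Proof.
split => //; exists e^-1; first by rewrite invr_ge0 ltW.
move=> x; rewrite /iA indicE; have [/set_mem xA|_] := boolP (x \in A).
  have /= xe := Ae xA.
  by rewrite mulrC ler_pdivlMr// mul1r (le_trans (ltW xe)) ?ler_norm.
by rewrite mulr_ge0// invr_ge0 ltW.
Qed.

Lemma levy_indic_fin : (levy_int rho iA < +oo)%E.
Proof.
apply: (@levy_int_fin _ _ hrho (e^-1 + 1)) => //.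
  by rewrite addr_ge0// invr_ge0 ltW.
move=> x x0; have ie0 : 0 < e^-1 by rewrite invr_gt0.
rewrite /iA indicE; have [/set_mem xA|_] := boolP (x \in A).
  have /= xe := Ae xA; have : 1 <= e^-1 * x by rewrite mulrC ler_pdivlMr// mul1r ltW.
  by rewrite /Num.min; case: ifPn => _; nra.
by rewrite mulr_ge0 ?addr_ge0 ?(ltW ie0)// le_min ltW//=.
Qed.

Let p := fine (levy_int rho iA).

Let pE : levy_int rho iA = p%:E.
Proof. by rewrite fineK// ge0_fin_numE ?levy_indic_fin// levy_int_ge0. Qed.

Let p0 : 0 <= p. Proof. by rewrite fine_ge0// levy_int_ge0. Qed.

Let levy_intZ c (h : R -> R) : 0 <= c -> measurable_fun setT h -> (forall x, 0 <= h x) ->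
  levy_int rho (fun x => c * h x) = (c%:E * levy_int rho h)%E.
Proof.
move=> c0 mh h0; rewrite /levy_int -ge0_integralZl//.
- by apply: eq_integral => x _; rewrite -EFinM mulrA.
- exact: measurable_levy.
- by move=> x _; rewrite lee_fin mulr_ge0 ?rho0_ge0.
Qed.

Let phiA : phi rho iA = 1 + (1 - expR (-1)) * p.
Proof.
rewrite /phi; congr (1 + _).
have -> : levy_exp iA = (fun x => (1 - expR (-1)) * iA x).
  apply/funext => x; rewrite /levy_exp /iA indicE.
  by case: (x \in A); rewrite ?mulr1// mulr0 oppr0 expR0 subrr.
by rewrite levy_intZ ?subr_ge0// pE.
Qed.

Let phi0 : phi rho (fun=> 0) = 1.
Proof.
rewrite /phi; have -> : levy_int rho (levy_exp (fun=> 0)) = 0%E.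
  apply: integral0_eq => x _; by rewrite /levy_exp oppr0 expR0 subrr mul0r.
by rewrite addr0.
Qed.

Let tilt0 : tilt (fun=> 0) iA = iA.
Proof. by apply/funext => x; rewrite /tilt oppr0 expR0 mul1r. Qed.

Let tiltA : tilt iA iA = (fun x => expR (-1) * iA x).
Proof.
apply/funext => x; rewrite /tilt /iA indicE.
by case: (x \in A); rewrite ?mulr1// !mulr0.
Qed.

Let EN : (\int[P]_w psum J iA w = (r * p)%:E)%E.
Proof.
have := mecke_phi hrho r0 hJ (linbd0 R) linbd_indic.
rewrite tilt0 levy_indic_fin phi0 powR1 mulr1 => /(_ isT) <-.
apply: eq_integral => w _.
suff -> : psum J (fun=> 0) w = 0%E by rewrite oppe0 expeR0 mul1e.
by rewrite /psum eseries0.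
Qed.

Let ENe : (\int[P]_w (expeR (- psum J iA w) * psum J iA w) =
  (r * phi rho iA `^ (- (r + 1)) * (expR (-1) * p))%:E)%E.
Proof.
rewrite (mecke_phi hrho r0 hJ linbd_indic linbd_indic) tiltA levy_intZ ?expR_ge0//.
  by rewrite pE -EFinM.
by rewrite pE ltry.
Qed.

(* With N the number of points in A, N - e N e^{-N} vanishes for N = 0, 1, and
   its mean is of second order in Pi(A) by the Mecke formula. *)
Let count_ineq (N : \bar R) : (N \is a fin_num)%E -> (N = 0 \/ 1 <= N)%E ->
  (((2%:E <= N)%E%:R : R)%:E + (expR 1)%:E * (expeR (- N) * N) <= N)%E.
Proof.
case: N => // n _ hN; rewrite /= -!EFinM -EFinD lee_fin.
have [n2|n2] := boolP (2%:E <= n%:E)%E.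
  move: n2; rewrite lee_fin => n2.
  have e2 : 2 <= expR 1 :> R by have := expR_ge1Dx (1 : R); lra.
  have E : expR 1 * (expR (- n) * n) <= n / 2.
    rewrite mulrA -expRD mulrC ler_pM2l; last lra.
    rewrite -[1 - n]opprB expRN lef_pV2 ?posrE ?expR_gt0//.
    by apply: (le_trans e2); rewrite ler_expR; lra.
  by rewrite mulr1n; lra.
rewrite add0r; case: hN => [[->]|]; first by rewrite !mulr0.
rewrite lee_fin => n1; rewrite mulrA -expRD ler_piMl ?(le_trans _ n1)//.
by rewrite -[leRHS]expR0 ler_expR; lra.
Qed.

(** Two points in [A] force [N >= 2]. Taking means in [count_ineq] gives
    [P D + r phi^(-(r+1)) p <= r p], and [phi^(-(r+1)) >= 1 - (r + 1) p]. *)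
Lemma two_points_le i j : i != j ->
  (P [set w | A (J i w) /\ A (J j w)] <= (r * (r + 1) * p * p)%:E)%E.
Proof.
move=> ij; set D := [set w | _].
have mD : measurable D.
  have -> : D = (J i @^-1` A) `&` (J j @^-1` A) by [].
  by apply: measurableI; rewrite -[X in measurable X]setTI; exact: mJ.
have mN := measurable_psum_lin hJ linbd_indic.
have me := measurable_expeR_psum hJ linbd_indic.
have N0 w : (0 <= psum J iA w)%E by apply: psum_ge0.
have key : (P D + (r * phi rho iA `^ (- (r + 1)) * p)%:E <= (r * p)%:E)%E.
  rewrite -EN.
  have -> : (r * phi rho iA `^ (- (r + 1)) * p)%:E =
      ((expR 1)%:E * \int[P]_w (expeR (- psum J iA w) * psum J iA w))%E.
    rewrite ENe -EFinM; congr EFin.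
    by rewrite (mulrCA (expR 1)) (mulrA (expR 1)) -expRD subrr expR0 mul1r.
  rewrite -[X in P X](setIT D) -(integral_indic P measurableT mD).
  have mEN : measurable_fun setT (fun w => expeR (- psum J iA w) * psum J iA w)%E.
    exact: emeasurable_funM.
  have EN0 w : (0 <= expeR (- psum J iA w) * psum J iA w)%E.
    by rewrite mule_ge0 ?expeR_ge0.
  have ee0 : (0 <= (expR 1)%:E :> \bar R)%E by rewrite lee_fin expR_ge0.
  rewrite -(ge0_integralZl _ measurableT mEN)//.
  rewrite -ge0_integralD//; last 3 first.
  - exact/measurable_EFinP/measurable_indic.
  - by move=> w _; rewrite mule_ge0.
  - exact: measurable_funeM.
  apply: ge0_ae_le_integralT => //.
  - by move=> w; rewrite adde_ge0 ?lee_fin// !mule_ge0 ?expeR_ge0 ?lee_fin ?expR_ge0.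
  - apply: filterS (psum_fin hrho r0 hJ) => w fw.
    have Nk k : A (J k w) -> (1 <= psum J iA w)%E.
      move=> Ak; rewrite /psum (@nneseriesD1 _ _ k xpredT)//; last first.
        by move=> l _; rewrite lee_fin.
      rewrite {1}/iA indicE mem_set// leeDl//.
      by apply: nneseries_ge0 => l _ _; rewrite lee_fin.
    apply: le_trans (count_ineq (fw _ linbd_indic) _); last first.
      have [[k Ak]|nA] := pselect (exists k, A (J k w)); [right; exact: Nk Ak|left].
      rewrite /psum eseries0// => k _ _; rewrite /iA indicE memNset// => Ak.
      by apply: nA; exists k.
    rewrite leeD2r// lee_fin indicE; case: (boolP (w \in D)) => [|_]; last exact: ler0n.
    rewrite inE => -[Ai Aj]; rewrite (_ : (2%:E <= _)%E = true)//.
    rewrite /psum (@nneseriesD1 _ _ i xpredT)//; last first.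
      by move=> l _; rewrite lee_fin.
    rewrite (@nneseriesD1 _ _ j (fun k => true && (k != i)))//=; last 2 first.
    - by move=> l _; rewrite lee_fin.
    - by rewrite eq_sym.
    rewrite {1 2}/iA !indicE !mem_set//= addeA -EFinD -[leLHS]adde0 leeD//.
    by apply: nneseries_ge0 => l _ _; rewrite lee_fin.
have phA1 : 1 <= phi rho iA by apply: phi_ge1 => //; exact: linbd_indic.
have : 1 - (r + 1) * p <= phi rho iA `^ (- (r + 1)).
  rewrite /powR gt_eqF ?(lt_le_trans _ phA1)//; apply: le_trans (expR_ge1Dx _).
  rewrite lerD2l mulNr lerN2 ler_wpM2l ?addr_ge0 ?(ltW r0)//.
  rewrite phiA; apply: (@le_trans _ _ ((1 - expR (-1)) * p)).
    by rewrite le_ln1Dx// (@lt_le_trans _ _ 0)// mulr_ge0// subr_ge0.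
  by rewrite ler_piMl// gerBl expR_ge0.
move=> /(ler_wpM2l (_ : 0 <= r * p)); rewrite mulr_ge0 ?(ltW r0)// => /(_ erefl) H.
rewrite -(leeD2rE _ _ (_ : (r * phi rho iA `^ (- (r + 1)) * p)%:E \is a fin_num))//.
apply: (le_trans key); rewrite -EFinD lee_fin; lra.
Qed.

End one_interval.

Let levy_density_integrable (e : R) : 0 < e ->
  mu.-integrable setT (EFin \o (fun x => \1_(`]e, +oo[ : set R) x * rho0 rho x)).
Proof.
move=> e0; apply/integrableP; split.
  by apply: measurable_levy => //; exact: measurable_indic.
have Ae : (`]e, +oo[ : set R) `<=` [set x | e < x].
  by move=> x; rewrite /= in_itv/= andbT.
have := levy_indic_fin e0 Ae; apply: le_lt_trans.
rewrite le_eqVlt; apply/orP; left; apply/eqP; apply: eq_integral => x _.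
by rewrite gee0_abs// lee_fin mulr_ge0 ?rho0_ge0.
Qed.

(* Cut (e, +oo) into short intervals: by two_points_le the probability of two
   points in a common one is at most r(r+1) Pi(e, +oo) times the largest mass of
   an interval, which tends to 0 since Pi has a density. *)
Let equal_points_null (i j : nat) (e : R) : i != j -> 0 < e ->
  P [set w | J i w = J j w /\ e < J i w] = 0%E.
Proof.
move=> ij e0; set E := [set w | _].
pose f x : R := \1_(`]e, +oo[ : set R) x * rho0 rho x.
have f0 x : 0 <= f x by rewrite mulr_ge0 ?rho0_ge0.
have intf := levy_density_integrable e0.
have mf : measurable_fun setT (EFin \o f) by case/integrableP: intf.
pose M := fine (\int[mu]_x (f x)%:E)%E.
have ME : (\int[mu]_x (f x)%:E = M%:E)%E.
  by rewrite fineK//; exact: integrable_fin_num intf.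
have M0 : 0 <= M.
  by apply: fine_ge0; apply: integral_ge0 => x _; rewrite lee_fin.
have mE : measurable E.
  have -> : E = [set w | J i w = J j w] `&` (J i @^-1` `]e, +oo[).
    by apply/seteqP; split => w /=; rewrite in_itv/= andbT.
  apply: measurableI; last by rewrite -[X in measurable X]setTI; exact: mJ.
  have -> : [set w | J i w = J j w] = (fun w => J i w == J j w) @^-1` [set true].
    by apply/seteqP; split => w /= /eqP.
  rewrite -[X in measurable X]setTI.
  by apply: (measurable_fun_eqr (mJ i) (mJ j)).
pose c := r * (r + 1).
have c0 : 0 <= c by rewrite mulr_ge0 ?addr_ge0 ?(ltW r0).
have bound dlt : 0 < dlt -> (P E <= (c * dlt * M)%:E)%E.
  move=> dlt0.
  have [s [s0 /= hs]] := integral_normr_continuous intf dlt0.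
  (* Absolute continuity of the integral applies to sets of measure strictly below [s]. *)
  pose h := s / 2.
  have h0 : 0 < h by rewrite divr_gt0.
  pose A k : set R := `]e + k%:R * h, e + k.+1%:R * h]%classic.
  have mA k : measurable (A k) by exact: measurable_itv.
  have Ae k : A k `<=` [set x | e < x].
    move=> x; rewrite /A /= in_itv/= => /andP[+ _]; apply: le_lt_trans.
    by rewrite lerDl mulr_ge0// ltW.
  pose p k := fine (levy_int rho \1_(A k)).
  have pE k : levy_int rho \1_(A k) = (\int[mu]_(x in A k) (f x)%:E)%E.
    rewrite [RHS]integral_mkcond; apply: eq_integral => x _.
    rewrite patchE indicE; case: ifPn => [/set_mem xA|_]; last by rewrite mul0r.
    by rewrite /f indicE mem_set//= in_itv/= andbT; exact: (Ae _ _ xA).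
  have p0 k : 0 <= p k by rewrite fine_ge0// levy_int_ge0.
  have pfin k : levy_int rho \1_(A k) \is a fin_num.
    by rewrite ge0_fin_numE ?levy_int_ge0//; exact: levy_indic_fin (Ae k).
  have pd k : p k <= dlt.
    apply/ltW; rewrite /p pE.
    rewrite (_ : (\int[mu]_(x in A k) (f x)%:E)%E =
      (\int[mu]_(x in A k) `|f x|%:E)%E); last first.
      by apply: eq_integral => x _; rewrite ger0_norm.
    apply: (hs (A k) (mA k)).
    rewrite lebesgue_measure_itv/= lte_fin ltrD2l ltr_pM2r// ltr_nat ltnSn.
    rewrite -EFinB lte_fin opprD addrACA subrr add0r -mulrBl -natrB// subSnn mul1r.
    by rewrite /h ltr_pdivrMr// ltr_pMr// ltr1n.
  have tA : trivIset setT A.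
    have lt_disj k l x : (k < l)%N -> A k x -> A l x -> False.
      rewrite /A /= !in_itv/= => kl /andP[_ xk] /andP[xl _].
      have := lt_le_trans xl xk; rewrite ltrD2l ltr_pM2r// ltr_nat ltnS.
      by rewrite leqNgt kl.
    apply/trivIsetP => k l _ _ kl; apply/seteqP; split => // x [xk xl].
    by move: kl; rewrite neq_ltn => /orP[] kl; [exact: (lt_disj _ _ _ kl xk xl)|
      exact: (lt_disj _ _ _ kl xl xk)].
  have sp : (\sum_(k <oo) (p k)%:E <= M%:E)%E.
    rewrite -ME (eq_eseriesr (g := fun k => (\int[mu]_(x in A k) (f x)%:E)%E)); last first.
      by move=> k _; rewrite -pE fineK.
    rewrite -ge0_integral_bigcup//; last 2 first.
    - exact: measurable_funTS.
    - by move=> x _; rewrite lee_fin.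
    apply: ge0_subset_integral => //; first by apply: bigcup_measurable => k _; exact: mA.
    by move=> x _; rewrite lee_fin.
  (* The index of the interval is the predecessor of the least [n] with [J i w <= e + n h]; that [n]
     is not 0 because [e < J i w]. *)
  have cov : E `<=` \bigcup_k [set w | A k (J i w) /\ A k (J j w)].
    move=> w [Jij Je].
    have ex : exists n, J i w <= e + n%:R * h.
      exists (Num.bound ((J i w - e) / h)); rewrite -lerBlDl -ler_pdivrMr//.
      by rewrite ltW// archi_boundP// divr_ge0 ?(ltW h0)// subr_ge0 ltW.
    case: (ex_minnP ex) => -[|n]; first by rewrite mul0r addr0 leNgt Je.
    move=> ub lb; exists n => //=; rewrite -Jij.
    suff : A n (J i w) by [].
    rewrite /A /= in_itv/= ub andbT ltNge; apply/negP => /lb.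
    by rewrite ltnn.
  have mD k : measurable [set w | A k (J i w) /\ A k (J j w)].
    have -> : [set w | A k (J i w) /\ A k (J j w)] = (J i @^-1` A k) `&` (J j @^-1` A k) by [].
    by apply: measurableI; rewrite -[X in measurable X]setTI; exact: mJ.
  apply: (@le_trans _ _ (\sum_(k <oo) P [set w | A k (J i w) /\ A k (J j w)])%E).
    exact: measure_sigma_subadditive.
  apply: (@le_trans _ _ (\sum_(k <oo) ((c * dlt)%:E * (p k)%:E))%E).
    apply: lee_nneseries => // k _.
    apply: (le_trans (two_points_le e0 (mA k) (@Ae k) ij)).
    by rewrite -EFinM lee_fin -/c -/(p k) ler_wpM2r// ler_wpM2l.
  rewrite nneseriesZl; last by move=> k _; rewrite lee_fin.
  by rewrite [leRHS]EFinM lee_wpmul2l// lee_fin mulr_ge0// ltW.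
apply/eqP; rewrite eq_le measure_ge0 andbT leNgt; apply/negP => PE0.
have Pf : P E \is a fin_num by exact: fin_num_measure.
have v0 : 0 < fine (P E) by rewrite -lte_fin fineK.
(* With [dlt = P(E) / q] the bound reads [P(E) <= P(E) c M / (c M + 1)], which is impossible for
   [P(E) > 0]. *)
pose q := c * M + 1; have q0 : 0 < q by rewrite ltr_wpDl// mulr_ge0.
have := bound (fine (P E) / q) (divr_gt0 v0 q0).
rewrite -{1}(fineK Pf) lee_fin leNgt => /negP; apply.
rewrite mulrA mulrAC ltr_pdivrMr// mulrAC mulrC ltr_pM2l// /q.
by rewrite ltrDl.
Qed.

Lemma bn_distinct : {ae P, forall w, forall i j, i != j -> J i w != J j w}.
Proof.
(* Every point is positive, so the thresholds [1 / (n + 1)] leave countably many null events. *)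
have H : {ae P, forall w, forall i j n, i != j ->
    ~ (J i w = J j w /\ n.+1%:R^-1 < J i w)}.
  apply: ae_foralln => i; apply: ae_foralln => j; apply: ae_foralln => n.
  have [->|ij] := eqVneq i j; first exact: aeW.
  have N0 := equal_points_null ij (_ : 0 < n.+1%:R^-1).
  exists [set w | J i w = J j w /\ n.+1%:R^-1 < J i w]; split; last first.
  - by move=> w /= H; apply: contrapT => nH; apply: H.
  - by apply: N0; rewrite invr_gt0.
  - have -> : [set w | J i w = J j w /\ n.+1%:R^-1 < J i w] =
        [set w | J i w = J j w] `&` (J i @^-1` `]n.+1%:R^-1, +oo[).
      by apply/seteqP; split => w /=; rewrite in_itv/= andbT.
    apply: measurableI; last by rewrite -[X in measurable X]setTI; exact: mJ.
    have -> : [set w | J i w = J j w] = (fun w => J i w == J j w) @^-1` [set true].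
      by apply/seteqP; split => w /= /eqP.
    rewrite -[X in measurable X]setTI.
    by apply: (measurable_fun_eqr (mJ i) (mJ j)).
apply: filterS H => w H i j ij; apply/eqP => Jij.
have Ji0 : 0 < J i w by case: hJ => _ + _; apply.
pose n := Num.bound (J i w)^-1.
apply: (H i j n ij); split => //.
rewrite -[ltRHS]invrK ltf_pV2 ?posrE ?invr_gt0//.
rewrite (@lt_trans _ _ n%:R) ?ltr_nat//; apply: archi_boundP.
by rewrite invr_ge0 ltW.
Qed.

End distinct_points.

(** * Size-biased picks *)

Section nneseries_mul.
Local Open Scope ereal_scope.
Lemma ge0_nneseriesZl (R : realType) (z : \bar R) (f : (\bar R)^nat) : 0 <= z ->
  (forall i, 0 <= f i) -> \sum_(i <oo) (z * f i) = z * \sum_(i <oo) f i.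
Proof.
move=> z0 f0; apply/cvg_lim => //.
rewrite (_ : (fun n => \sum_(0 <= k < n) z * f k) =
  (fun n => z * \sum_(0 <= k < n) f k)); last first.
  by apply/funext => n; rewrite ge0_sume_distrr.
apply: nondecreasing_ge0_cvgeZl => //.
- by move=> n; apply: sume_ge0.
- by apply: (@ereal_nondecreasing_series _ _ xpredT 0%N).
- by apply: is_cvg_nneseries.
Qed.
End nneseries_mul.

Section rest.
Context (T : Type) (R : realType).
Implicit Types (J Jt : nat -> T -> R) (f h : R -> R).

(** Picks are known by value only, as in [size_biased_picks]; the value determines the index once
    the points are distinct. *)
Definition unpicked J Jt n i w : bool := [forall k : 'I_n, Jt k w != J i w].

Lemma unpicked0 J Jt i w : unpicked J Jt 0 i w = true.
Proof. by apply/forallP => -[]. Qed.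

Lemma unpickedS J Jt n i w :
  unpicked J Jt n.+1 i w = unpicked J Jt n i w && (Jt n w != J i w).
Proof.
apply/forallP/andP => [H|[/forallP H1 H2] k].
  split; last exact: (H ord_max).
  by apply/forallP => k; exact: (H (widen_ord (leqnSn n) k)).
have [kn|kn] := ltnP k n; first exact: (H1 (Ordinal kn)).
by have -> : (k : nat) = n by apply/eqP; rewrite eqn_leq kn andbT -ltnS.
Qed.

Definition rest J Jt n f w : \bar R :=
  (\sum_(i <oo) (if unpicked J Jt n i w then f (J i w) else 0)%:E)%E.

Lemma rest_ge0 J Jt n f w : (forall x, 0 <= f x) -> (0 <= rest J Jt n f w)%E.
Proof. by move=> f0; apply: nneseries_ge0 => i _ _; rewrite lee_fin; case: ifP. Qed.

Lemma rest0 J Jt f w : rest J Jt 0 f w = psum J f w.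
Proof. by apply: eq_eseriesr => i _; rewrite unpicked0. Qed.

Lemma rest_le_psum J Jt n f w : (forall x, 0 <= f x) ->
  (rest J Jt n f w <= psum J f w)%E.
Proof.
move=> f0; apply: lee_nneseries => [i _ _|i _]; rewrite lee_fin; case: ifP => //.
Qed.

Lemma restD J Jt n f h w : (forall x, 0 <= f x) -> (forall x, 0 <= h x) ->
  rest J Jt n (fun x => f x + h x) w = (rest J Jt n f w + rest J Jt n h w)%E.
Proof.
move=> f0 h0; rewrite -nneseriesD; last 2 first.
- by move=> i _ _; rewrite lee_fin; case: ifP.
- by move=> i _ _; rewrite lee_fin; case: ifP.
by apply: eq_eseriesr => i _; rewrite -EFinD; case: ifP => // _; rewrite addr0.
Qed.

Lemma restZ J Jt n c f w : (forall x, 0 <= f x) ->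
  rest J Jt n (fun x => c * f x) w = (c%:E * rest J Jt n f w)%E.
Proof.
move=> f0; rewrite -nneseriesZl; last by move=> i _; rewrite lee_fin; case: ifP.
by apply: eq_eseriesr => i _; rewrite -EFinM; case: ifP => // _; rewrite mulr0.
Qed.

(** The event on which the pathwise identities hold; it is almost sure by [ae_good]. *)
Definition good_upto J Jt n w := [/\ forall i j, i != j -> J i w != J j w,
  forall i, 0 < J i w,
  forall f, linbd f -> psum J f w \is a fin_num &
  forall m, (m < n)%N -> exists2 j, Jt m w = J j w & unpicked J Jt m j w].

Lemma good_upto_leq J Jt m n w : (m <= n)%N -> good_upto J Jt n w -> good_upto J Jt m w.
Proof.
by move=> mn [H1 H2 H3 H4]; split => // k km; apply: H4; exact: leq_trans mn.
Qed.

Lemma rest_fin J Jt n f w : good_upto J Jt 0 w -> linbd f ->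
  rest J Jt n f w \is a fin_num.
Proof.
move=> [_ _ fw _] lf; rewrite ge0_fin_numE ?rest_ge0//; last exact: linbd_ge0.
apply: (le_lt_trans (rest_le_psum _ _ _ _ (linbd_ge0 lf))).
by rewrite -ge0_fin_numE ?fw// psum_ge0//; exact: linbd_ge0.
Qed.

(** The term of the picked index leaves the series. As the points are distinct, no other index
    changes its status. *)
Lemma restS J Jt n f w : good_upto J Jt n.+1 w -> (forall x, 0 <= f x) ->
  rest J Jt n f w = ((f (Jt n w))%:E + rest J Jt n.+1 f w)%E.
Proof.
move=> [inj _ _ /(_ n (ltnSn n))[j Jj uj]] f0.
rewrite /rest (@nneseriesD1 _ _ j xpredT)//; last first.
  by move=> i _; rewrite lee_fin; case: ifP.
rewrite uj -Jj; congr (_ + _)%E; rewrite eseries_mkcond; apply: eq_eseriesr => i _ /=.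
rewrite unpickedS Jj; have [->|ij] := eqVneq i j; first by rewrite eqxx andbF.
by rewrite (inj j i) 1?eq_sym// andbT.
Qed.

(** Pigeonhole: [n] picks cannot take the values of [n + 1] distinct points. This keeps the
    remaining sums positive. *)
Lemma exists_unpicked J Jt n w : (forall i j, i != j -> J i w != J j w) ->
  exists i, unpicked J Jt n i w.
Proof.
move=> inj; apply: contrapT => H.
have {}H (i : 'I_n.+1) : exists k : 'I_n, Jt k w == J i w.
  apply/existsP; apply: contrapT => /negP; rewrite negb_exists => nH.
  by apply: H; exists i.
have [k kE] := choice H.
have : injective k.
  move=> i i' kk; apply/eqP; apply: contrapT => /negP ii'.
  have /negP := inj i i' ii'; apply.
  by rewrite -(eqP (kE i)) -(eqP (kE i')) kk.
by move=> /leq_card; rewrite !card_ord ltnn.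
Qed.

Definition rsum J Jt n w : R := tsum J w - \sum_(i < n) Jt i w.

Lemma rsumS J Jt n w : rsum J Jt n.+1 w = rsum J Jt n w - Jt n w.
Proof. by rewrite /rsum big_ord_recr/= opprD addrA. Qed.

Lemma rsumE J Jt n w : good_upto J Jt n w ->
  rest J Jt n Num.norm w = (rsum J Jt n w)%:E.
Proof.
elim: n => [|n ih] gw.
  rewrite rest0 /rsum big_ord0 subr0 /tsum fineK//.
  by case: gw => _ _ -> //; exact: linbd_norm.
have := ih (good_upto_leq (leqnSn n) gw).
rewrite (restS gw)// => E; rewrite rsumS EFinB -E.
have -> : `|Jt n w| = Jt n w.
  case: gw => _ J0 _ /(_ n (ltnSn n))[j -> _]; by rewrite gtr0_norm.
by rewrite addeAC subee ?add0e.
Qed.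

Lemma rsum_gt0 J Jt n w : good_upto J Jt n w -> 0 < rsum J Jt n w.
Proof.
move=> gw; rewrite -lte_fin -rsumE//; case: gw => inj J0 fin _.
have [i ui] := exists_unpicked Jt n inj.
rewrite /rest (@nneseriesD1 _ _ i xpredT)//; last first.
  by move=> k _; rewrite lee_fin; case: ifP.
rewrite ui (@lt_le_trans _ _ `|J i w|%:E) ?lte_fin ?normr_gt0 ?gt_eqF//.
by rewrite leeDl// nneseries_ge0// => k _ _; rewrite lee_fin; case: ifP.
Qed.

End rest.

Section measurable_rest.
Context d (S : measurableType d) (R : realType).
Variables (J Jt : nat -> S -> R) (n : nat).
Hypotheses (mJ : forall i, measurable_fun setT (J i))
  (mJt : forall k, (k < n)%N -> measurable_fun setT (Jt k)).

Lemma measurable_unpicked i : measurable_fun setT (unpicked J Jt n i).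
Proof.
have : forall m, (m <= n)%N -> measurable_fun setT (unpicked J Jt m i).
  elim=> [_|m ih mn].
    rewrite (_ : unpicked J Jt 0 i = cst true)//.
    by apply/funext => w; rewrite unpicked0.
  rewrite (_ : unpicked J Jt m.+1 i =
    (fun w => unpicked J Jt m i w && ~~ (Jt m w == J i w))); last first.
    by apply/funext => w; rewrite unpickedS.
  apply: measurable_and; first exact/ih/ltnW.
  by apply: measurable_neg; apply: measurable_fun_eqr => //; exact: mJt.
exact.
Qed.

Lemma measurable_rest (f : R -> R) : measurable_fun setT f -> (forall x, 0 <= f x) ->
  measurable_fun setT (rest J Jt n f).
Proof.
move=> mf f0; apply: ge0_emeasurable_sum => i.
- by move=> w _ _; rewrite lee_fin; case: ifP.
- move=> _; apply/measurable_EFinP; apply: measurable_fun_ifT => //.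
    exact: measurable_unpicked.
  exact: measurableT_comp.
Qed.

Lemma measurable_rsum m : (m <= n)%N -> measurable_fun setT (rsum J Jt m).
Proof.
move=> mn; apply: measurable_funB.
  have mS : measurable_fun setT (psum J Num.norm).
    by apply: measurable_psum => //; exact: normr_measurable.
  exact: (measurableT_comp (@fine_measurable R setT measurableT) mS).
by apply: measurable_sum => i; apply: mJt; exact: leq_trans mn.
Qed.

End measurable_rest.

Section inverse.
Context (R : realType).

Lemma measurable_inv : measurable_fun [set: R] (@GRing.inv R).
Proof.
(* Inversion is the power [-1] on each half-line; at 0 both conventions give 0. *)
rewrite (_ : @GRing.inv R =
  fun x => if 0 <= x then x `^ (-1) else - ((- x) `^ (-1))); last first.
  apply/funext => x; case: ifPn => x0; first by rewrite powR_inv1.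
  rewrite powR_inv1; last by rewrite oppr_ge0 ltW// ltNge.
  by rewrite invrN opprK.
apply: measurable_fun_ifT; first exact: measurable_fun_ler.
  exact: measurable_powR.
apply: measurable_funN.
rewrite (_ : (fun x : R => (- x) `^ (-1)) = (@powR R ^~ (-1)) \o -%R)//.
apply: measurableT_comp; first exact: measurable_powR.
exact: oppr_measurable.
Qed.

Lemma measurable_fun_inv d (T : measurableType d) (f : T -> R) :
  measurable_fun setT f -> measurable_fun setT (fun x => (f x)^-1).
Proof. exact: (measurableT_comp measurable_inv). Qed.

Lemma measurable_fun_div d (T : measurableType d) (f g : T -> R) :
  measurable_fun setT f -> measurable_fun setT g ->
  measurable_fun setT (fun x => f x / g x).
Proof.
by move=> mf mg; apply: measurable_funM => //; exact: measurable_fun_inv.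
Qed.

End inverse.

Section generated.
Context d (T : measurableType d) (R : realType).

Lemma preimages_measurable (I : set nat) (X : nat -> T -> R) :
  (forall i, I i -> measurable_fun setT (X i)) ->
  preimages I X `<=` d.-measurable.
Proof.
move=> mX A [i Ii [B mB <-]].
exact: (mX i Ii measurableT B mB).
Qed.

End generated.

Section picks.
Context d (T : measurableType d) (R : realType) (P : probability T R).
Variables (rho : R -> R) (r : R) (J Jt : nat -> {RV P >-> R}).
Hypothesis hrho : infinite_levy_density rho.
Hypothesis r0 : 0 < r.

Let J_ i : T -> R := J i.
Let Jt_ i : T -> R := Jt i.

Hypothesis hJ : bn_points P rho r J_.
Hypothesis hJt : size_biased_picks J Jt.

Let mJ i : measurable_fun setT (J_ i). Proof. exact: measurable_funPT. Qed.
Let mJt i : measurable_fun setT (Jt_ i). Proof. exact: measurable_funPT. Qed.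
Let J_gt0 i w : 0 < J_ i w. Proof. by case: hJ => _ + _; apply. Qed.

Lemma sum_points_tsum w : sum_points J w = tsum J_ w.
Proof.
congr fine; apply: eq_eseriesr => i _.
by rewrite gtr0_norm//; exact: J_gt0.
Qed.

(* T with the sigma-algebra of all points and of the first n picks *)
Definition past n : measurableType _ :=
  g_sigma_algebraType (preimages setT J_ `|` preimages `I_n Jt_).

Lemma measurable_past n (A : set T) :
  measurable (A : set (past n)) -> d.-measurable A.
Proof.
move=> mA; have : <<s preimages setT J_ `|` preimages `I_n Jt_ >> A by [].
apply: smallest_sub; first exact: sigma_algebra_measurable.
by move=> B [|]; apply: preimages_measurable.
Qed.

Lemma measurable_past_id n : measurable_fun setT (id : T -> past n).
Proof. by move=> _ A mA; rewrite setTI; exact: measurable_past mA. Qed.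

Lemma measurable_J_past n i : measurable_fun setT (J_ i : past n -> R).
Proof.
move=> _ A mA; apply: sub_sigma_algebra; left; exists i => //.
by exists A.
Qed.

Lemma measurable_Jt_past n k : (k < n)%N -> measurable_fun setT (Jt_ k : past n -> R).
Proof.
move=> kn _ A mA; apply: sub_sigma_algebra; right; exists k => //.
by exists A.
Qed.

Lemma measurable_of_past n d' (U : measurableType d') (Z : T -> U) :
  measurable_fun setT (Z : past n -> U) -> measurable_fun setT Z.
Proof.
move=> mZ _ A mA; rewrite setTI; apply: (@measurable_past n).
by have := mZ measurableT A mA; rewrite setTI.
Qed.

Let phi n j w : R := if unpicked J_ Jt_ n j w then J_ j w / rsum J_ Jt_ n w else 0.

Let mphi n j : measurable_fun setT (phi n j).
Proof.
apply: measurable_fun_ifT => //; first exact: measurable_unpicked.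
by apply: measurable_fun_div => //; exact: (@measurable_rsum _ _ _ _ _ n).
Qed.

Let phiP n j (A : set (past n)) : measurable A ->
  P ([set w | Jt n w = J j w] `&` A) = (\int[P]_(w in A) (phi n j w)%:E)%E.
Proof.
move=> mA; have [_ /(_ A mA) ->] := hJt n j.
apply: eq_integral => w _; rewrite /phi -/(unpicked J_ Jt_ n j w).
by rewrite /rsum sum_points_tsum.
Qed.

Let mE n j : measurable [set w | Jt_ n w = J_ j w].
Proof.
have -> : [set w | Jt_ n w = J_ j w] = (fun w => Jt_ n w == J_ j w) @^-1` [set true].
  by apply/seteqP; split => w /= /eqP.
rewrite -[X in measurable X]setTI.
by apply: (measurable_fun_eqr (mJt n) (mJ j)).
Qed.

Let phi_ge0 n j w : good_upto J_ Jt_ n w -> 0 <= phi n j w.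
Proof.
move=> gw; rewrite /phi; case: ifP => // _.
by rewrite divr_ge0// ?(ltW (rsum_gt0 gw))// ltW.
Qed.

(** The defining property of the conditional probability, extended from past events to
    past-measurable [Z]. The absolute value makes the weight nonnegative everywhere and changes it
    only outside the good event. *)
Let cond_int n j (Z : T -> \bar R) :
  {ae P, forall w, good_upto J_ Jt_ n w} ->
  (forall w, 0 <= Z w)%E -> measurable_fun setT (Z : past n -> \bar R) ->
  (\int[P]_w ((\1_[set w | Jt_ n w = J_ j w] w)%:E * Z w) =
   \int[P]_w (`|phi n j w|%R%:E * Z w))%E.
Proof.
move=> gw Z0 mZ.
apply: (@eq_integral_law _ _ _ _ _ (past n) _ P P
  (fun w => (\1_[set w | Jt_ n w = J_ j w] w)%:E) (fun w => `|phi n j w|%R%:E)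
  (id : T -> past n) (id : T -> past n)) => //.
- exact/measurable_EFinP/measurable_indic.
- by apply/measurable_EFinP; apply: measurableT_comp => //; exact: normr_measurable.
- exact: measurable_past_id.
- exact: measurable_past_id.
- move=> A mA; have mA' := measurable_past mA.
  transitivity (P ([set w | Jt_ n w = J_ j w] `&` A)).
    rewrite -[X in P X]setIT -integral_indic//; last exact: measurableI.
    by apply: eq_integral => w _; rewrite indicI EFinM.
  rewrite phiP// [LHS]integral_mkcond.
  apply: (@ae_eq_integral _ T R P setT) => //.
  + apply/(measurable_restrictT _ mA').1; apply: measurable_funTS.
    exact/measurable_EFinP.
  + apply: emeasurable_funM; last exact/measurable_EFinP/measurable_indic.
    by apply/measurable_EFinP; apply: measurableT_comp => //; exact: normr_measurable.
  + apply: filterS gw => w gw _; rewrite patchE indicE.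
    by case: (w \in A); rewrite ?mule1 ?mule0// ger0_norm// phi_ge0.
Qed.

Let sum_phi n (h : R -> R) w : good_upto J_ Jt_ n w -> (forall x, 0 <= h x) ->
  (\sum_(j <oo) (`|phi n j w|%R%:E * (h (J_ j w))%:E) =
   (`|(rsum J_ Jt_ n w)^-1|%R)%:E * rest J_ Jt_ n (fun x => `|x|%R * h x)%R w)%E.
Proof.
move=> gw h0; rewrite -nneseriesZl; last first.
  by move=> j _; rewrite lee_fin; case: ifP => // _; rewrite mulr_ge0.
apply: eq_eseriesr => j _; rewrite -!EFinM; congr EFin; rewrite /phi.
case: ifP => _; last by rewrite normr0 mul0r mulr0.
by rewrite normrM mulrA [X in X * _]mulrC.
Qed.

(** The events that pick [n] is a given unpicked point [J j] are disjoint up to a null set, and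
    their conditional probabilities sum to the remaining sum over itself. Hence almost surely one of
    them occurs. *)
Lemma ae_good n : {ae P, forall w, good_upto J_ Jt_ n w}.
Proof.
elim: n => [|n ih].
  apply: filterS2 (bn_distinct hrho r0 hJ) (psum_fin hrho r0 hJ) => w dw fw.
  by split => // m; rewrite ltn0.
pose U j := [set w | unpicked J_ Jt_ n j w].
have mUp j : measurable (U j : set (past n)).
  have := @measurable_unpicked _ (past n) R J_ Jt_ n (@measurable_J_past n)
    (@measurable_Jt_past n) j measurableT [set true] Logic.I.
  by rewrite setTI.
have mU j : measurable (U j) := measurable_past (mUp j).
pose E j := [set w | Jt_ n w = J_ j w].
pose F := \bigcup_j (E j `&` U j).
have mEU j : measurable (E j `&` U j) by apply: measurableI => //; exact: mE.
have mF : measurable F by exact: bigcupT_measurable.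
have PF : P F = 1%E.
  apply/eqP; rewrite eq_le probability_le1//=.
  rewrite -[X in (_ <= P X)%E]setIT -integral_indic//.
  apply: (@le_trans _ _ (\int[P]_w \sum_(j <oo) (\1_(E j) w)%:E * (\1_(U j) w)%:E)%E).
    have m1 j : measurable_fun setT (fun w => (\1_(E j) w)%:E * (\1_(U j) w)%:E : \bar R)%E.
      apply: emeasurable_funM; apply/measurable_EFinP/measurable_indic => //.
      exact: mE.
    have m2 j : measurable_fun setT (fun w => `|phi n j w|%R%:E * (\1_(U j) w)%:E : \bar R)%E.
      apply: emeasurable_funM; apply/measurable_EFinP.
        by apply: measurableT_comp => //; exact: normr_measurable.
      exact: measurable_indic.
    rewrite integral_nneseries//.
    rewrite (eq_eseriesr (g := fun j => \int[P]_w (`|phi n j w|%R%:E * (\1_(U j) w)%:E))%E); last first.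
      move=> j _; apply: cond_int => //.
      exact/measurable_EFinP/measurable_indic.
    rewrite -integral_nneseries//.
    have <- : (\int[P]_w (cst 1 w) = 1 :> \bar R)%E.
      by rewrite integral_cst// mul1e; exact: probability_setT.
    apply: ge0_ae_le_integralT => //.
    - by move=> w; apply: nneseries_ge0 => j _ _; rewrite mule_ge0 ?lee_fin.
    - apply: filterS ih => w gw.
      have := @sum_phi n (fun=> 1) w gw (fun=> ler01).
      rewrite (_ : (fun x => `|x| * 1) = Num.norm); last first.
        by apply/funext => x; rewrite mulr1.
      rewrite rsumE// ger0_norm ?invr_ge0 ?(ltW (rsum_gt0 gw))//.
      rewrite -EFinM mulVf ?gt_eqF ?rsum_gt0// => <-.
      rewrite le_eqVlt; apply/orP; left; apply/eqP.
      apply: eq_eseriesr => j _; rewrite indicE.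
      have -> : (w \in U j) = unpicked J_ Jt_ n j w by apply/idP/idP; rewrite inE.
      by rewrite /phi; case: (unpicked _ _ _ _ _); rewrite ?normr0 ?mul0e.
  apply: ge0_ae_le_integralT => //.
  - by move=> w; apply: nneseries_ge0 => j _ _; rewrite mule_ge0 ?lee_fin.
  - apply: filterS ih => w [inj _ _ _].
    have iE j : ((\1_(E j) w)%:E * (\1_(U j) w)%:E = (\1_(E j `&` U j) w)%:E :> \bar R)%E.
      by rewrite indicI EFinM.
    have [wF|wF] := pselect (F w); last first.
      rewrite eseries0 ?lee_fin// => j _ _; rewrite iE indicE memNset//.
      by move=> ?; apply: wF; exists j.
    have [j _ [Ej Uj]] := wF.
    rewrite (@nneseriesD1 _ _ j xpredT)//.
    rewrite eseries0.
      by rewrite adde0 iE lee_fin !indicE (mem_set wF)//; case: (_ \in _).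
    move=> k _ /= kj; rewrite indicE memNset ?mul0e// /E /= Ej => Jk.
    by have := inj k j kj; rewrite Jk eqxx.
have FN : P (~` F) = 0%E by rewrite probability_setC// PF subee.
have aF : {ae P, forall w, F w} by exists (~` F); split => //; exact: measurableC.
apply: filterS2 ih aF => w gw [j _ [Ej Uj]].
case: gw => H1 H2 H3 H4; split => // m; rewrite ltnS leq_eqVlt => /predU1P[->|]; last exact: H4.
by exists j.
Qed.

(* Summing over the value J_j of the pick turns the pick into an integral
   against the remaining points. *)
Lemma integral_pick n (Z : T -> \bar R) (A : set R) : measurable A ->
  (forall w, 0 <= Z w)%E -> measurable_fun setT (Z : past n -> \bar R) ->
  (\int[P]_w (Z w * (\1_A (Jt_ n w))%:E) =
   \int[P]_w (Z w * (`|(rsum J_ Jt_ n w)^-1|%R%:E *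
     rest J_ Jt_ n (fun x => `|x|%R * \1_A x)%R w)))%E.
Proof.
move=> mA Z0 mZ; pose E j := [set w | Jt_ n w = J_ j w].
have mZ' := measurable_of_past mZ.
pose Zj j w := (Z w * (\1_A (J_ j w))%:E)%E.
have Zj0 j w : (0 <= Zj j w)%E by rewrite mule_ge0 ?lee_fin.
have mZj j : measurable_fun setT (Zj j : past n -> \bar R).
  apply: emeasurable_funM => //; apply/measurable_EFinP.
  by apply: measurableT_comp; [exact: measurable_indic|exact: measurable_J_past].
have mZj' j := measurable_of_past (mZj j).
transitivity (\int[P]_w \sum_(j <oo) (\1_(E j) w)%:E * Zj j w)%E.
  apply: ge0_ae_eq_integralT.
  - by move=> w; rewrite mule_ge0 ?lee_fin.
  - by move=> w; apply: nneseries_ge0 => j _ _; rewrite mule_ge0 ?lee_fin.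
  - apply: filterS (ae_good n.+1) => w [inj _ _ /(_ n (ltnSn n))[j Ej _]].
    rewrite (@nneseriesD1 _ _ j xpredT)//; last first.
      by move=> k _; rewrite mule_ge0 ?lee_fin.
    rewrite eseries0.
      by rewrite adde0 (indicE _ (E j)) mem_set// mul1e /Zj Ej.
    move=> k _ /= kj; rewrite (indicE _ (E k)) memNset ?mul0e// /E /= Ej => Jk.
    by have := inj k j kj; rewrite Jk eqxx.
rewrite integral_nneseries//; last 2 first.
- move=> j; apply: emeasurable_funM => //.
  by apply/measurable_EFinP/measurable_indic; exact: mE.
- by move=> j w _; rewrite mule_ge0 ?lee_fin.
rewrite (eq_eseriesr (g := fun j => \int[P]_w (`|phi n j w|%R%:E * Zj j w))%E); last first.
  by move=> j _; apply: cond_int => //; exact: ae_good.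
rewrite -integral_nneseries//; last 2 first.
- move=> j; apply: emeasurable_funM => //; apply/measurable_EFinP.
  by apply: measurableT_comp => //; exact: normr_measurable.
- by move=> j w _; rewrite mule_ge0 ?lee_fin.
apply: ge0_ae_eq_integralT.
- by move=> w; apply: nneseries_ge0 => j _ _; rewrite mule_ge0 ?lee_fin.
- by move=> w; rewrite mule_ge0// mule_ge0// rest_ge0.
- apply: filterS (ae_good n) => w gw.
  rewrite -(sum_phi gw)// -ge0_nneseriesZl//.
  by apply: eq_eseriesr => j _; rewrite /Zj muleCA.
Qed.

End picks.

(** * Integration along paths *)

Section translation.
Local Open Scope ereal_scope.
Context (R : realType).
Notation mu := (@lebesgue_measure R).

(** Lebesgue measure and its translate agree on half-open intervals. *)
Lemma ge0_integral_shift (t : R) (f : R -> \bar R) : (forall x, 0 <= f x) ->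
  measurable_fun setT f -> \int[mu]_x f x = \int[mu]_x f (t + x)%R.
Proof.
move=> f0 mf.
have ms : measurable_fun setT (fun x : measurableTypeR R => (t + x)%R : measurableTypeR R).
  exact: measurable_funD.
have w0 (x : measurableTypeR R) : 0 <= cst 1%E x :> \bar R by [].
have mw : measurable_fun setT (cst 1%E : measurableTypeR R -> \bar R) by [].
transitivity (\int[wlaw mu w0 mw ms]_x f x); last first.
  by rewrite integral_wlaw//; apply: eq_integral => x _; rewrite mul1e.
apply: eq_measure_integral => A mA _.
apply: lebesgue_measure_unique => // _ [[a b]] _ <-.
rewrite /= /wlaw integral_cst; last first.
  by rewrite -[X in measurable X]setTI; exact: ms.
rewrite mul1e.
rewrite (_ : _ @^-1` _ = `](a - t)%R, (b - t)%R]%classic); last first.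
  by apply/seteqP; split => x /=; rewrite !in_itv/= ltrBlDl lerBrDl.
rewrite lebesgue_measure_itv [RHS]lebesgue_measure_itv/= !lte_fin ltrD2r; case: ifPn => // _.
by rewrite -!EFinB; congr EFin; ring.
Qed.

End translation.

Section rcons_tuple.
Context (R : realType).
Implicit Types n : nat.
Notation mu := (@lebesgue_measure R).

Definition tuple_rcons n (u : n.-tuple R) (t : R) : n.+1.-tuple R :=
  [tuple of rcons u t].

Lemma tuple_cons_rcons n (x : R) (u : n.-tuple R) t :
  tuple_cons (x, tuple_rcons u t) = tuple_rcons (tuple_cons (x, u)) t.
Proof. exact: val_inj. Qed.

Lemma measurable_tuple_rcons d (T : measurableType d) n (u : T -> n.-tuple R) (t : T -> R) :
  measurable_fun setT u -> measurable_fun setT t ->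
  measurable_fun setT (fun w => tuple_rcons (u w) (t w)).
Proof.
move=> mu_ mt; apply/measurable_fun_tnthP => i.
have [ni|ni] := ltnP i n.
  rewrite (_ : _ \o _ = fun w => tnth (u w) (Ordinal ni)); last first.
    apply/funext => w; rewrite /= !(tnth_nth 0)/= nth_rcons size_tuple ni.
    by [].
  by apply: (measurableT_comp (measurable_tnth _)).
rewrite (_ : _ \o _ = t)//; apply/funext => w /=.
rewrite (tnth_nth 0)/= nth_rcons size_tuple ltnNge ni/=.
by rewrite (_ : _ == n)// eqn_leq ni andbT -ltnS.
Qed.

Local Open Scope ereal_scope.

Lemma integral_lebesgue_cons n (F : n.+1.-tuple R -> \bar R) :
  (forall v, 0 <= F v) -> measurable_fun setT F ->
  \int[@lebesgue_tuple R n.+1]_v F v =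
  \int[mu]_x \int[@lebesgue_tuple R n]_u F (tuple_cons (x, u)).
Proof.
move=> F0 mF.
have w0 (x : R * n.-tuple R) : 0 <= cst 1%E x :> \bar R by [].
have mw : measurable_fun setT (cst 1%E : R * n.-tuple R -> \bar R) by [].
pose m := (mu \x @lebesgue_tuple R n).
transitivity (\int[wlaw m w0 mw (@measurable_tuple_cons R n)]_x F x).
  apply: eq_measure_integral => A mA _.
  rewrite /= /wlaw integral_cst ?mul1e//.
  by rewrite -[X in measurable X]setTI; exact: measurable_tuple_cons.
rewrite integral_wlaw//.
under eq_integral do rewrite mul1e.
rewrite fubini_tonelli1//.
apply: (measurableT_comp mF); exact: measurable_tuple_cons.
Qed.

Lemma measurable_tuple_cons1 n (G : n.+1.-tuple R -> \bar R) x :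
  measurable_fun setT G -> measurable_fun setT (fun u => G (tuple_cons (x, u))).
Proof.
move=> mG; apply: (measurableT_comp mG).
exact: (measurableT_comp (@measurable_tuple_cons R n) (pair1_measurable x)).
Qed.

Lemma measurable_integral_rcons n (G : n.+1.-tuple R -> \bar R) :
  (forall v, 0 <= G v) -> measurable_fun setT G ->
  measurable_fun setT (fun u => \int[mu]_t G (tuple_rcons u t)).
Proof.
move=> G0 mG.
apply: (@measurable_fun_fubini_tonelli_F _ _ _ _ _ mu
  (fun z : n.-tuple R * R => G (tuple_rcons z.1 z.2))) => //.
by apply: (measurableT_comp mG); exact: measurable_tuple_rcons.
Qed.

(** [lebesgue_tuple] grows at the head, whereas the chain grows at the tail. *)
Lemma integral_lebesgue_rcons n (F : n.+1.-tuple R -> \bar R) :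
  (forall v, 0 <= F v) -> measurable_fun setT F ->
  \int[@lebesgue_tuple R n.+1]_v F v =
  \int[@lebesgue_tuple R n]_u \int[mu]_t F (tuple_rcons u t).
Proof.
elim: n F => [|n ih] F F0 mF.
  rewrite integral_lebesgue_cons// [RHS]integral_dirac//; last first.
    exact: measurable_integral_rcons.
  rewrite diracE mem_set// mul1e; apply: eq_integral => x _.
  rewrite [LHS]integral_dirac//; last exact: measurable_tuple_cons1.
  by rewrite diracE mem_set// mul1e; congr F; exact: val_inj.
rewrite integral_lebesgue_cons// [RHS]integral_lebesgue_cons; last 2 first.
- by move=> v; apply: integral_ge0.
- exact: measurable_integral_rcons.
apply: eq_integral => x _; rewrite ih//; last exact: measurable_tuple_cons1.
apply: eq_integral => u _; apply: eq_integral => t _.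
by rewrite tuple_cons_rcons.
Qed.

End rcons_tuple.

Section kernel.
Context (R : realType) (rho : R -> R).
Hypothesis hrho : infinite_levy_density rho.
Notation mu := (@lebesgue_measure R).
Implicit Types n : nat.

(** The factor of the joint density for one step from [s] down to [t]; the constants [r + i] are
    collected in [rising]. *)
Definition step_kernel (s t : R) : R :=
  if (0 < t) && (t < s) then (s - t) * rho0 rho (s - t) / s else 0.

Lemma step_kernel_ge0 s t : 0 <= step_kernel s t.
Proof.
rewrite /step_kernel; case: ifP => // /andP[t0 ts].
by rewrite divr_ge0 ?(ltW (lt_trans t0 ts))// mulr_ge0 ?rho0_ge0// subr_ge0 ltW.
Qed.

Lemma measurable_step_kernel d (T : measurableType d) (s t : T -> R) :
  measurable_fun setT s -> measurable_fun setT t ->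
  measurable_fun setT (fun w => step_kernel (s w) (t w)).
Proof.
move=> ms mt; have mst : measurable_fun setT (fun w => s w - t w).
  exact: measurable_funB.
apply: measurable_fun_ifT => //.
  by apply: measurable_and; exact: measurable_fun_ltr.
apply: measurable_fun_div => //; apply: measurable_funM => //.
exact: (measurableT_comp (measurable_rho0 hrho) mst).
Qed.

(** For [n = 0] the product is empty, and the indicator alone restricts to positive values. *)
Definition path_kernel n (v : n.+1.-tuple R) : R :=
  (0 < v`_n)%R%:R * \prod_(i < n) step_kernel v`_i v`_i.+1.

Lemma path_kernel_ge0 n (v : n.+1.-tuple R) : 0 <= path_kernel v.
Proof. by rewrite mulr_ge0// prodr_ge0// => i _; exact: step_kernel_ge0. Qed.

Lemma measurable_nth_tuple n (i : nat) : (i < n)%N ->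
  measurable_fun setT (fun v : n.-tuple R => v`_i).
Proof.
move=> i_n; rewrite (_ : (fun v : n.-tuple R => v`_i) = (@tnth _ R ^~ (Ordinal i_n))).
  exact: measurable_tnth.
by apply/funext => v; rewrite (tnth_nth 0).
Qed.

Lemma measurable_path_kernel n : measurable_fun setT (@path_kernel n).
Proof.
apply: measurable_funM.
  rewrite (_ : (fun v : n.+1.-tuple R => _) = (fun v : n.+1.-tuple R =>
    if 0 < v`_n then 1 else 0)); last first.
    by apply/funext => v; case: (0 < _).
  apply: measurable_fun_ifT => //; apply: measurable_fun_ltr => //.
  exact: measurable_nth_tuple.
apply: measurable_prod => i _; apply: measurable_step_kernel.
  by apply: measurable_nth_tuple; exact: ltn_trans (ltnSn n).
by apply: measurable_nth_tuple; rewrite ltnS.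
Qed.

Lemma nth_tuple_rcons n (u : n.-tuple R) t i :
  (tuple_rcons u t)`_i = if (i < n)%N then u`_i else if i == n then t else 0.
Proof. by rewrite /= nth_rcons size_tuple. Qed.

Lemma path_kernel_rcons n (v : n.+1.-tuple R) t :
  path_kernel (tuple_rcons v t) = path_kernel v * step_kernel v`_n t.
Proof.
rewrite /path_kernel big_ord_recr/= !nth_tuple_rcons ltnn eqxx ltnSn mulrA.
have -> : \prod_(i < n) step_kernel (tuple_rcons v t)`_i (tuple_rcons v t)`_i.+1 =
    \prod_(i < n) step_kernel v`_i v`_i.+1.
  apply: eq_bigr => i _; rewrite !nth_tuple_rcons.
  by rewrite (ltn_trans (ltn_ord i) (ltnSn n)) ltnS ltn_ord.
rewrite [in RHS]mulrAC -!mulrA [X in _ * X]mulrC !mulrA; congr (_ * _).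
rewrite /step_kernel; case: ifP => [/andP[t0 ts]|_]; last by rewrite !mulr0.
by rewrite t0 (lt_trans t0 ts).
Qed.

Local Open Scope ereal_scope.

(** The last coordinate stays free: it will be the total sum of a [BN(r + n)] process, whose law is
    not given by a kernel. *)
Definition path_int n (psi : n.+1.-tuple R -> \bar R) (t : R) : \bar R :=
  \int[@lebesgue_tuple R n]_u
    ((path_kernel (tuple_rcons u t))%:E * psi (tuple_rcons u t)).

Lemma path_int_ge0 n (psi : n.+1.-tuple R -> \bar R) t :
  (forall v, 0 <= psi v) -> 0 <= path_int psi t.
Proof.
move=> p0; apply: integral_ge0 => u _.
by rewrite mule_ge0// lee_fin path_kernel_ge0.
Qed.

Lemma measurable_path_int n (psi : n.+1.-tuple R -> \bar R) :
  (forall v, 0 <= psi v) -> measurable_fun setT psi ->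
  measurable_fun setT (path_int psi).
Proof.
move=> p0 mp.
apply: (@measurable_fun_fubini_tonelli_F _ _ _ _ _ (@lebesgue_tuple R n)
  (fun z : R * n.-tuple R => (path_kernel (tuple_rcons z.2 z.1))%:E *
    psi (tuple_rcons z.2 z.1))).
  have mr : measurable_fun setT (fun z : R * n.-tuple R => tuple_rcons z.2 z.1).
    exact: measurable_tuple_rcons.
  apply: emeasurable_funM; last exact: (measurableT_comp mp mr).
  apply/measurable_EFinP; exact: (measurableT_comp (@measurable_path_kernel n) mr).
by move=> z; rewrite mule_ge0// lee_fin path_kernel_ge0.
Qed.

Lemma path_int0 (psi : 1.-tuple R -> \bar R) t : measurable_fun setT psi ->
  path_int psi t = (0 < t)%R%:R%:E * psi (tuple_rcons [tuple] t).
Proof.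
move=> mp.
have mr : measurable_fun setT (fun u : 0.-tuple R => tuple_rcons u t).
  exact: measurable_tuple_rcons.
rewrite /path_int/= integral_dirac//; last first.
  apply: emeasurable_funM; last exact: (measurableT_comp mp mr).
  apply/measurable_EFinP; exact: (measurableT_comp (@measurable_path_kernel 0) mr).
by rewrite diracE mem_set// mul1e /path_kernel big_ord0 mulr1.
Qed.

(** Isolates the last step, from [s] to [t]; in the Mecke formula [s = t + x] with [x] the removed
    point. *)
Lemma path_intS n (psi : n.+2.-tuple R -> \bar R) t :
  (forall v, 0 <= psi v) -> measurable_fun setT psi ->
  path_int psi t = \int[mu]_s ((step_kernel s t)%:E *
    path_int (fun v => psi (tuple_rcons v t)) s).
Proof.
move=> p0 mp.
have mpt : measurable_fun setT (fun v => psi (tuple_rcons v t)).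
  by apply: (measurableT_comp mp); exact: measurable_tuple_rcons.
rewrite /path_int integral_lebesgue_rcons; last 2 first.
- by move=> v; rewrite mule_ge0// lee_fin path_kernel_ge0.
- have mr : measurable_fun setT (fun u : n.+1.-tuple R => tuple_rcons u t).
    exact: measurable_tuple_rcons.
  apply: emeasurable_funM => //.
  apply/measurable_EFinP; exact: (measurableT_comp (@measurable_path_kernel _) mr).
pose G (z : n.-tuple R * R) : \bar R := (step_kernel z.2 t)%:E *
  ((path_kernel (tuple_rcons z.1 z.2))%:E * psi (tuple_rcons (tuple_rcons z.1 z.2) t)).
have mG : measurable_fun setT G.
  have mr : measurable_fun setT (fun z : n.-tuple R * R => tuple_rcons z.1 z.2).
    exact: measurable_tuple_rcons.
  apply: emeasurable_funM.
    by apply/measurable_EFinP; exact: measurable_step_kernel.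
  apply: emeasurable_funM; last exact: (measurableT_comp mpt mr).
  apply/measurable_EFinP; exact: (measurableT_comp (@measurable_path_kernel _) mr).
have G0 z : 0 <= G z.
  by rewrite !mule_ge0 ?lee_fin ?step_kernel_ge0 ?path_kernel_ge0.
transitivity (\int[@lebesgue_tuple R n]_u \int[mu]_s G (u, s)).
  apply: eq_integral => u _; apply: eq_integral => s _.
  rewrite path_kernel_rcons nth_tuple_rcons ltnn eqxx /G/= EFinM.
  by rewrite [X in X * _]muleC -muleA.
rewrite (fubini_tonelli (m1 := @lebesgue_tuple R n) (m2 := mu) G)//.
apply: eq_integral => s _.
have mr : measurable_fun setT (fun u : n.-tuple R => tuple_rcons u s).
  exact: measurable_tuple_rcons.
rewrite -ge0_integralZl//.
- apply: emeasurable_funM; last exact: (measurableT_comp mpt mr).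
  apply/measurable_EFinP; exact: (measurableT_comp (@measurable_path_kernel _) mr).
- by move=> u _; rewrite mule_ge0// lee_fin path_kernel_ge0.
- by rewrite lee_fin step_kernel_ge0.
Qed.

End kernel.

Lemma eq_integralT d (T : measurableType d) (R : realType) (m : {measure set T -> \bar R})
  (f g : T -> \bar R) : f =1 g -> (\int[m]_x f x = \int[m]_x g x)%E.
Proof. by move=> /funext ->. Qed.

Section path_int_pick.
Local Open Scope ereal_scope.
Context (R : realType) (rho : R -> R).
Hypothesis hrho : infinite_levy_density rho.
Variables (n : nat) (f : R -> R) (psi : n.+2.-tuple R -> \bar R).
Hypotheses (lf : linbd f) (psi0 : forall v, 0 <= psi v) (mpsi : measurable_fun setT psi).
Notation mu := (@lebesgue_measure R).

(* psi times the inverse of the weights that appear in chain_law_pick *)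
Definition unweight (z : n.+1.-tuple R * R) : \bar R :=
  psi (tuple_rcons z.1 (z.1`_n - z.2)%R) *
  (expR (f z.2) * expR z.1`_n * `|(z.1`_n)^-1|)%R%:E.

Lemma unweight_ge0 z : 0 <= unweight z.
Proof. by rewrite mule_ge0// lee_fin !mulr_ge0 ?expR_ge0. Qed.

Lemma measurable_unweight : measurable_fun setT unweight.
Proof.
have mn : measurable_fun setT (fun z : n.+1.-tuple R * R => z.1`_n).
  apply: (measurableT_comp (f := fun v : n.+1.-tuple R => v`_n)) => //.
  exact: measurable_nth_tuple.
apply: emeasurable_funM.
  apply: (measurableT_comp mpsi); apply: measurable_tuple_rcons => //.
  exact: measurable_funB.
apply/measurable_EFinP; apply: measurable_funM; first apply: measurable_funM.
- apply: measurableT_comp; first exact: measurable_expR.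
  by apply: measurableT_comp => //; exact: linbd_measurable.
- by apply: measurableT_comp; first exact: measurable_expR.
- apply: measurableT_comp; first exact: normr_measurable.
  exact: measurable_fun_inv.
Qed.

(** Under [s = t + x] the kernel [Theta(s - t) / s] becomes [x rho(x) / (t + x)]. The exponentials
    in [tilt] and [unweight] cancel up to [expR t], and both sides vanish for [x <= 0]. *)
Lemma path_int_unweight t : (0 < t)%R ->
  \int[mu]_x ((tilt (fun x => f x + 1 * `|x|)%R Num.norm x * rho0 rho x)%:E *
    path_int rho (fun v => unweight (v, x)) (t + `|x|)%R) =
  (expR t)%:E * path_int rho psi t.
Proof.
move=> t0; pose psit (v : n.+1.-tuple R) := psi (tuple_rcons v t).
have psit0 v : 0 <= psit v by exact: psi0.
have mpsit : measurable_fun setT psit.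
  by apply: (measurableT_comp mpsi); exact: measurable_tuple_rcons.
have mP := measurable_path_int hrho psit0 mpsit.
pose G s := (step_kernel rho s t)%:E * path_int rho psit s.
have G0 s : 0 <= G s by rewrite mule_ge0 ?path_int_ge0// lee_fin step_kernel_ge0.
have mG : measurable_fun setT G.
  by apply: emeasurable_funM => //; apply/measurable_EFinP; exact: measurable_step_kernel.
have -> : path_int rho psi t = \int[mu]_x G (t + x)%R.
  transitivity (\int[mu]_s G s); first exact: (path_intS hrho t psi0 mpsi).
  exact: (ge0_integral_shift t G0 mG).
have mGt : measurable_fun setT (fun x => G (t + x)%R).
  by apply: (measurableT_comp mG); exact: measurable_funD.
transitivity (\int[mu]_x ((expR t)%:E * G (t + x)%R)); last first.
  by apply: ge0_integralZl.
apply: eq_integralT => x; rewrite /G.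
have [x0|x0] := leP x 0%R.
  rewrite {1}/rho0 ltNge x0/= mulr0 mul0e /step_kernel.
  by rewrite t0/= ltNge gerDl x0/= mul0e mule0.
rewrite gtr0_norm//.
have s0 : (0 < t + x)%R by rewrite addr_gt0.
pose C := (expR (f x) * expR (t + x) * `|(t + x)^-1|)%R.
have -> : path_int rho (fun v => unweight (v, x)) (t + x)%R =
    C%:E * path_int rho psit (t + x)%R.
  rewrite /path_int -ge0_integralZl//.
  - apply: eq_integralT => u; rewrite /unweight /= nth_rcons size_tuple ltnn eqxx.
    by rewrite addrK muleCA [RHS]muleCA muleC -muleA (muleC C%:E) -/C.
  - have mr : measurable_fun setT (fun u : n.-tuple R => tuple_rcons u (t + x)%R).
      exact: measurable_tuple_rcons.
    apply: emeasurable_funM; last exact: (measurableT_comp mpsit mr).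
    apply/measurable_EFinP.
    exact: (measurableT_comp (@measurable_path_kernel _ _ hrho _) mr).
  - by move=> u _; rewrite mule_ge0// lee_fin path_kernel_ge0.
  - by rewrite lee_fin !mulr_ge0 ?expR_ge0.
rewrite !muleA -!EFinM; congr (_%:E * _).
rewrite /C /step_kernel t0 ltrDl x0/= (_ : t + x - t = x)%R; last ring.
rewrite ger0_norm ?invr_ge0 ?(ltW s0)// /tilt mul1r opprD !expRD !expRN gtr0_norm//.
by field; rewrite !gt_eqF ?expR_gt0.
Qed.

End path_int_pick.

(** * The law of the remaining sums *)

Section chain.
Local Open Scope ereal_scope.
Context d (T : measurableType d) (R : realType) (P : probability T R).
Variables (rho : R -> R) (r : R) (J Jt : nat -> {RV P >-> R}).
Hypothesis hrho : infinite_levy_density rho.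
Hypothesis r0 : (0 < r)%R.
Notation mu := (@lebesgue_measure R).

Let J_ i : T -> R := J i.
Let Jt_ i : T -> R := Jt i.

Hypothesis hJ : bn_points P rho r J_.
Hypothesis hJt : size_biased_picks J Jt.

Variables (d' : R -> measure_display) (T' : forall s : R, measurableType (d' s))
  (P' : forall s : R, probability (T' s) R) (J' : forall s : R, nat -> T' s -> R).
Hypothesis hJ' : forall s, (0 < s)%R -> bn_points (P' s) rho s (@J' s).

Let mJt i : measurable_fun setT (Jt_ i). Proof. exact: measurable_funPT. Qed.

Let s_gt0 n : (0 < r + n%:R)%R. Proof. by rewrite ltr_pwDl. Qed.

Definition rsum_tuple n w : n.+1.-tuple R := [tuple rsum J_ Jt_ i w | i < n.+1].

Lemma nth_rsum_tuple n i w : (i <= n)%N -> (rsum_tuple n w)`_i = rsum J_ Jt_ i w.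
Proof.
move=> i_n; have i_n1 : (i < n.+1)%N by [].
by rewrite -[i]/(nat_of_ord (Ordinal i_n1)) -tnth_nth tnth_mktuple.
Qed.

Lemma rsum_tupleS n w :
  rsum_tuple n.+1 w = tuple_rcons (rsum_tuple n w) (rsum J_ Jt_ n.+1 w).
Proof.
apply: eq_from_tnth => i; rewrite !(tnth_nth 0%R) nth_rsum_tuple -1?ltnS//.
rewrite nth_tuple_rcons; have [i_n|] := ltnP i n.+1; first by rewrite nth_rsum_tuple.
move=> n_i; have /eqP iE : (i : nat) == n.+1 by rewrite eqn_leq n_i -ltnS ltn_ord.
by rewrite iE eqxx.
Qed.

Lemma measurable_rsum_tuple d1 (S : measurableType d1) (J1 Jt1 : nat -> S -> R) n :
  (forall i, measurable_fun setT (J1 i)) ->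
  (forall k, (k < n)%N -> measurable_fun setT (Jt1 k)) ->
  measurable_fun setT (fun w => [tuple rsum J1 Jt1 i w | i < n.+1]).
Proof.
move=> mJ1 mJt1; apply/measurable_fun_tnthP => i.
rewrite (_ : _ \o _ = rsum J1 Jt1 i).
  by apply: (@measurable_rsum _ S R J1 Jt1 n) => //; rewrite -ltnS.
by apply/funext => w; rewrite /= tnth_mktuple.
Qed.

Let mX n : measurable_fun setT (rsum_tuple n).
Proof. exact: measurable_rsum_tuple. Qed.

Let mrest n f : linbd f -> measurable_fun setT (rest J_ Jt_ n f).
Proof. by move=> [mf f0 _]; exact: measurable_rest. Qed.

Let mexp n f : linbd f -> measurable_fun setT (fun w => expeR (- rest J_ Jt_ n f w)).
Proof.
move=> lf; apply: measurableT_comp; first exact: measurable_expeR.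
by apply: measurableT_comp => //; exact: mrest.
Qed.

(* Keeping the Laplace functional of the remaining points next to (T_0, ..., T_n)
   is what makes the induction on n go through. *)
Definition chain_law n := forall f, linbd f -> forall psi : n.+1.-tuple R -> \bar R,
  (forall v, 0 <= psi v) -> measurable_fun setT psi ->
  \int[P]_w (expeR (- rest J_ Jt_ n f w) * psi (rsum_tuple n w)) =
  (rising r n)%:E * \int[P' (r + n%:R)]_w (expeR (- psum (@J' _) f w) *
    path_int rho psi (tsum (@J' _) w)).

Lemma rising_ge0 n : (0 <= rising r n)%R.
Proof. by rewrite prodr_ge0// => i _; rewrite addr_ge0// ltW. Qed.

(** The given process and the reference process at [r + 0] have the same Laplace functional. In the
    direction [|x|], [laplace_unique] extends this to functions of the total sum, under weights of
    mass at most 1. *)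
Lemma chain_law0 : chain_law 0.
Proof.
move=> f lf psi psi0 mpsi.
have s0 := s_gt0 0; have hJ1 := hJ' s0.
rewrite /rising big_ord0 mul1e.
pose psi1 t := ((0 < t)%R%:R%:E : \bar R) * psi (tuple_rcons [tuple] t).
have mi : measurable_fun setT (fun t : R => (0 < t)%R%:R%:E : \bar R).
  rewrite (_ : (fun t : R => _) = (fun t : R => (if (0 < t)%R then 1%R else 0%R)%:E)); last first.
    by apply/funext => t; case: (0 < t)%R.
  apply/measurable_EFinP; apply: measurable_fun_ifT => //.
  exact: measurable_fun_ltr.
have mpsi1 : measurable_fun setT psi1.
  apply: emeasurable_funM => //; apply: (measurableT_comp mpsi).
  exact: measurable_tuple_rcons.
have psi10 t : 0 <= psi1 t by rewrite mule_ge0// lee_fin.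
transitivity (\int[P]_w (expeR (- psum J_ f w) * psi1 (tsum J_ w))).
  apply: ge0_ae_eq_integralT => [w|w|].
  - by rewrite mule_ge0 ?expeR_ge0.
  - by rewrite mule_ge0 ?expeR_ge0.
  - apply: filterS (ae_good hrho r0 hJ hJt 0) => w gw; rewrite rest0 /psi1.
    have := rsum_gt0 gw; rewrite /rsum big_ord0 subr0 => ->; rewrite mul1e.
    congr (_ * psi _); apply: eq_from_tnth => i; rewrite !(tnth_nth 0%R).
    rewrite nth_rsum_tuple -1?ltnS//; case: i => -[|//] i0 /=.
    by rewrite /rsum big_ord0 subr0.
transitivity (\int[P' (r + 0%:R)]_w (expeR (- psum (@J' _) f w) * psi1 (tsum (@J' _) w))); last first.
  by apply: eq_integral => w _; rewrite path_int0.
have me : measurable_fun setT (fun w => expeR (- psum J_ f w)).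
  exact: (measurable_expeR_psum hJ).
have me' : measurable_fun setT (fun w => expeR (- psum (@J' (r + 0%:R)) f w)).
  exact: (measurable_expeR_psum hJ1).
apply: laplace_unique => //.
- by move=> w; exact: expeR_ge0.
- by move=> w; exact: expeR_ge0.
- exact: (measurable_tsum hJ).
- exact: (measurable_tsum hJ1).
- by move=> w; exact: tsum_ge0.
- by move=> w; exact: tsum_ge0.
- by case: hJ => _ _ ->//; rewrite ltry.
- move=> l l0.
  have lfl : linbd (fun x => f x + l * `|x|)%R.
    by apply: linbdD => //; apply: linbdZ => //; exact: linbd_norm.
  transitivity (\int[P]_w expeR (- psum J_ (fun x => f x + l * `|x|)%R w)).
    apply: ge0_ae_eq_integralT => [w|w|].
    - by rewrite mule_ge0 ?expeR_ge0// lee_fin expR_ge0.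
    - exact: expeR_ge0.
    - by apply: filterS (expeR_psum_tsum hrho r0 hJ) => w /(_ f l lf l0) ->.
  transitivity (\int[P' (r + 0%:R)]_w expeR (- psum (@J' _) (fun x => f x + l * `|x|)%R w)).
    case: hJ => _ _ ->//; case: hJ1 => _ _ ->//.
    by rewrite addr0.
  apply: ge0_ae_eq_integralT => [w|w|].
  - exact: expeR_ge0.
  - by rewrite mule_ge0 ?expeR_ge0// lee_fin expR_ge0.
  - by apply: filterS (expeR_psum_tsum hrho s0 hJ1) => w /(_ f l lf l0) ->.
Qed.

Section step.
Variable n : nat.
Hypothesis chain_n : chain_law n.

Let s := (r + n%:R)%R.
Let s1 := (r + n.+1%:R)%R.

Let s0 : (0 < s)%R. Proof. exact: s_gt0. Qed.
Let s10 : (0 < s1)%R. Proof. exact: s_gt0. Qed.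
Let hs : bn_points (P' s) rho s (@J' s). Proof. exact: hJ'. Qed.
Let hs1 : bn_points (P' s1) rho s1 (@J' s1). Proof. exact: hJ'. Qed.
Let hs1' : bn_points (P' s1) rho (s + 1)%R (@J' s1).
Proof. by rewrite (_ : (s + 1)%R = s1)// /s /s1 -addrA natr1. Qed.

Let risingS : rising r n.+1 = (rising r n * s)%R.
Proof. by rewrite /rising big_ord_recr. Qed.

(** Putting [f + l h] for [f] in [chain_law] gives the Laplace transform of [rest h] under weights
    of finite mass. By [laplace_unique] with the function [|y|], the factor [rest h] comes down even
    if both sides are infinite. *)
Lemma chain_law_point f h (D : set (n.+1.-tuple R)) : linbd f -> linbd h -> measurable D ->
  \int[P]_w (expeR (- rest J_ Jt_ n f w) * (\1_D (rsum_tuple n w))%:E * rest J_ Jt_ n h w) =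
  (rising r n)%:E * \int[P' s]_w (expeR (- psum (@J' s) f w) * psum (@J' s) h w *
    path_int rho (fun v => (\1_D v)%:E) (tsum (@J' s) w)).
Proof.
move=> lf lh mD.
have h0 := linbd_ge0 lh.
pose psiD (v : n.+1.-tuple R) : \bar R := (\1_D v)%:E.
have psiD0 v : 0 <= psiD v by rewrite lee_fin.
have mpsiD : measurable_fun setT psiD by exact/measurable_EFinP/measurable_indic.
pose w1 w := expeR (- rest J_ Jt_ n f w) * psiD (rsum_tuple n w).
pose w2 w := (rising r n)%:E * (expeR (- psum (@J' s) f w) * path_int rho psiD (tsum (@J' s) w)).
have w10 w : 0 <= w1 w by rewrite mule_ge0 ?expeR_ge0.
have pi0 t : 0 <= path_int rho psiD t by exact: path_int_ge0.
have w20 w : 0 <= w2 w by rewrite mule_ge0 ?lee_fin ?rising_ge0// mule_ge0 ?expeR_ge0.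
have mw1 : measurable_fun setT w1.
  apply: emeasurable_funM; first exact: mexp.
  by apply: (measurableT_comp mpsiD); exact: mX.
have mpi : measurable_fun setT (fun w => path_int rho psiD (tsum (@J' s) w)).
  exact: (measurableT_comp (measurable_path_int hrho psiD0 mpsiD) (measurable_tsum hs)).
have mw2' g : linbd g -> measurable_fun setT (fun w => expeR (- psum (@J' s) g w) *
    path_int rho psiD (tsum (@J' s) w)).
  by move=> lg; apply: emeasurable_funM => //; exact: (measurable_expeR_psum hs).
have mw2 : measurable_fun setT w2 by apply: measurable_funeM; exact: mw2'.
have r0n : 0 <= (rising r n)%:E :> \bar R by rewrite lee_fin rising_ge0.
have c0 g w : 0 <= expeR (- psum (@J' s) g w) * path_int rho psiD (tsum (@J' s) w).
  by rewrite mule_ge0 ?expeR_ge0.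
have key : \int[P]_w (w1 w * `|fine (rest J_ Jt_ n h w)|%R%:E) =
    \int[P' s]_w (w2 w * `|fine (psum (@J' s) h w)|%R%:E).
  apply: (@laplace_unique _ _ _ _ _ P (P' s) w1 w2
    (fun w => fine (rest J_ Jt_ n h w)) (fun w => fine (psum (@J' s) h w))
    w10 w20 mw1 mw2 _ _ _ _ _ _ (fun y => `|y|%R%:E)).
  - by apply: measurableT_comp => //; exact: mrest.
  - by apply: measurableT_comp => //; exact: (measurable_psum_lin hs).
  - by move=> w; rewrite fine_ge0// rest_ge0.
  - by move=> w; rewrite fine_ge0// psum_ge0.
  - apply: (@le_lt_trans _ _ (\int[P]_w cst 1 w)).
      apply: ge0_ae_le_integralT => //; apply/aeW => w.
      rewrite /w1 -[leRHS]mule1 lee_pmul ?expeR_ge0//; last first.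
        by rewrite /psiD lee_fin indicE; case: (_ \in _).
      by rewrite -[leRHS]expeR0 lee_expeR oppe_le0 rest_ge0//; exact: linbd_ge0.
    rewrite integral_cst// mul1e; apply: (@le_lt_trans _ _ 1); last exact: ltry.
    exact: probability_le1.
  - move=> l l0.
    have llh : linbd (fun x => l * h x)%R by exact: linbdZ.
    have lfl : linbd (fun x => f x + l * h x)%R by exact: linbdD.
    transitivity (\int[P]_w (expeR (- rest J_ Jt_ n (fun x => f x + l * h x)%R w) * psiD (rsum_tuple n w))).
      apply: ge0_ae_eq_integralT => [w|w|].
      - by rewrite mule_ge0// lee_fin expR_ge0.
      - by rewrite mule_ge0 ?expeR_ge0.
      - apply: filterS (ae_good hrho r0 hJ hJt 0) => w gw; rewrite /w1.
        rewrite restD; [|exact: linbd_ge0|exact: linbd_ge0].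
        rewrite restZ// -(fineK (rest_fin n gw lf)) -(fineK (rest_fin n gw lh)) /=.
        by rewrite opprD expRD EFinM muleAC.
    rewrite (chain_n lfl psiD0 mpsiD) -/s.
    under [RHS]eq_integral do rewrite /w2 -muleA.
    rewrite [RHS]ge0_integralZl//; last 2 first.
    - apply: emeasurable_funM; first exact: mw2'.
      apply/measurable_EFinP; apply: measurableT_comp => //; apply: measurable_funN.
      apply: measurable_funM => //; apply: measurableT_comp => //.
      exact: (measurable_psum_lin hs).
    - by move=> w _; rewrite mule_ge0// lee_fin expR_ge0.
    congr (_ * _); apply: ge0_ae_eq_integralT => [w|w|].
    - exact: c0.
    - by rewrite mule_ge0// lee_fin expR_ge0.
    - apply: filterS (psum_fin hrho s0 hs) => w fw.
      rewrite psumD; [|exact: linbd_ge0|exact: linbd_ge0].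
      rewrite psumZ// -(fineK (fw _ lf)) -(fineK (fw _ lh)) /=.
      by rewrite opprD expRD EFinM muleAC.
  - by move=> y; rewrite lee_fin.
  - by apply/measurable_EFinP; exact: normr_measurable.
transitivity (\int[P]_w (w1 w * `|fine (rest J_ Jt_ n h w)|%R%:E)).
  apply: ge0_ae_eq_integralT => [w|w|].
  - by apply: mule_ge0; [exact: w10|exact: rest_ge0].
  - by rewrite mule_ge0// lee_fin.
  - apply: filterS (ae_good hrho r0 hJ hJt 0) => w gw.
    rewrite ger0_norm ?fine_ge0 ?rest_ge0// fineK//; exact: rest_fin.
rewrite key.
under eq_integral do rewrite /w2 -muleA.
rewrite ge0_integralZl//; last 2 first.
- apply: emeasurable_funM; first exact: mw2'.
  apply/measurable_EFinP; apply: measurableT_comp; first exact: normr_measurable.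
  by apply: measurableT_comp => //; exact: (measurable_psum_lin hs).
- by move=> w _; rewrite mule_ge0// lee_fin.
congr (_ * _); apply: ge0_ae_eq_integralT => [w|w|].
- by rewrite mule_ge0// lee_fin.
- by rewrite mule_ge0// mule_ge0 ?expeR_ge0// psum_ge0.
- apply: filterS (psum_fin hrho s0 hs) => w fw.
  by rewrite ger0_norm ?fine_ge0 ?psum_ge0// fineK ?fw// muleAC.
Qed.

(* The factor rsum n compensates the 1 / rsum n of a size-biased pick, and
   |x| <= f x keeps the total mass finite. *)
Lemma chain_law_pick f (Phi : n.+1.-tuple R * R -> \bar R) : linbd f ->
  (forall x, (`|x| <= f x)%R) -> (forall z, 0 <= Phi z) -> measurable_fun setT Phi ->
  \int[P]_w (expeR (- rest J_ Jt_ n f w) * `|rsum J_ Jt_ n w|%R%:E *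
    Phi (rsum_tuple n w, Jt_ n w)) =
  (rising r n.+1)%:E * \int[P' s1]_w (expeR (- psum (@J' s1) f w) *
    \int[mu]_x ((tilt f Num.norm x * rho0 rho x)%:E *
      path_int rho (fun v => Phi (v, x)) (tsum (@J' s1) w + `|x|)%R)).
Proof.
move=> lf fx.
have mf := linbd_measurable lf.
(* To express the right-hand side as one weighted law, the [n + 1] real coordinates hold the pick
   (head) and [T_0, ..., T_{n-1}] (tail). Then [T_n], recovered in [U], is the sum of the reference
   process plus the pick. *)
pose m2 := (P' s1 \x @lebesgue_tuple R n.+1)%E.
pose hd (v : n.+1.-tuple R) := thead v.
pose tl (v : n.+1.-tuple R) : n.-tuple R := [tuple of behead v].
have hdE x u : hd (tuple_cons (x, u)) = x by [].
have tlE x u : tl (tuple_cons (x, u)) = u by exact: val_inj.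
pose w1 w := expeR (- rest J_ Jt_ n f w) * `|rsum J_ Jt_ n w|%R%:E.
pose Y1 w := (rsum_tuple n w, Jt_ n w).
pose U (z : T' s1 * n.+1.-tuple R) : n.+1.-tuple R :=
  tuple_rcons (tl z.2) (tsum (@J' s1) z.1 + `|(hd z.2)|)%R.
pose a (x : R) := (tilt f Num.norm x * rho0 rho x)%R.
pose w2 (z : T' s1 * n.+1.-tuple R) := (rising r n.+1)%:E *
  (expeR (- psum (@J' s1) f z.1) * ((a (hd z.2))%:E * (path_kernel rho (U z))%:E)).
pose Y2 (z : T' s1 * n.+1.-tuple R) := (U z, (hd z.2)).
have a0 x : (0 <= a x)%R by rewrite mulr_ge0 ?rho0_ge0// mulr_ge0 ?expR_ge0.
have ma : measurable_fun setT a.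
  apply: measurable_funM; last exact: measurable_rho0.
  by apply: measurable_tilt => //; exact: normr_measurable.
have rn0 : 0 <= (rising r n.+1)%:E :> \bar R by rewrite lee_fin rising_ge0.
have w10 w : 0 <= w1 w by rewrite mule_ge0 ?expeR_ge0.
have w20 z : 0 <= w2 z.
  rewrite mule_ge0// mule_ge0 ?expeR_ge0// mule_ge0// lee_fin//.
  exact: path_kernel_ge0.
have mabs : measurable_fun setT (fun w => `|rsum J_ Jt_ n w|%R%:E : \bar R).
  apply/measurable_EFinP; apply: measurableT_comp; first exact: normr_measurable.
  exact: (@measurable_rsum _ _ _ _ _ n).
have mw1 : measurable_fun setT w1 by apply: emeasurable_funM => //; exact: mexp.
have m21 : measurable_fun setT (fun z : T' s1 * n.+1.-tuple R => (hd z.2)).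
  apply: (measurableT_comp (f := hd)) => //; exact: measurable_tnth.
have m22 : measurable_fun setT (fun z : T' s1 * n.+1.-tuple R => (tl z.2)).
  by apply: (measurableT_comp (f := tl)) => //; exact: measurable_behead.
have mU : measurable_fun setT U.
  apply: measurable_tuple_rcons => //; apply: measurable_funD.
    exact: (measurableT_comp (measurable_tsum hs1) measurable_fst).
  by apply: measurableT_comp; first exact: normr_measurable.
have mw2 : measurable_fun setT w2.
  apply: measurable_funeM; apply: emeasurable_funM.
    exact: (measurableT_comp (measurable_expeR_psum hs1 lf) measurable_fst).
  apply: emeasurable_funM; apply/measurable_EFinP.
    exact: (measurableT_comp ma m21).
  exact: (measurableT_comp (@measurable_path_kernel _ _ hrho _) mU).
have mY1 : measurable_fun setT Y1 by apply/measurable_fun_pairP; split; [exact: mX|exact: mJt].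
have mY2 : measurable_fun setT Y2 by apply/measurable_fun_pairP.
have Fub (Psi : n.+1.-tuple R * R -> \bar R) : (forall z, 0 <= Psi z) ->
    measurable_fun setT Psi ->
  \int[m2]_z (w2 z * Psi (Y2 z)) =
  (rising r n.+1)%:E * \int[P' s1]_w (expeR (- psum (@J' s1) f w) *
    \int[mu]_x ((a x)%:E *
      path_int rho (fun v => Psi (v, x)) (tsum (@J' s1) w + `|x|)%R)).
  move=> Psi0 mPsi.
  pose G (z : T' s1 * n.+1.-tuple R) := expeR (- psum (@J' s1) f z.1) *
    ((a (hd z.2))%:E * ((path_kernel rho (U z))%:E * Psi (Y2 z))).
  have mPY2 : measurable_fun setT (fun z => Psi (Y2 z)) by exact: (measurableT_comp mPsi mY2).
  have mKP : measurable_fun setT (fun z => (path_kernel rho (U z))%:E * Psi (Y2 z)).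
    apply: emeasurable_funM => //; apply/measurable_EFinP.
    exact: (measurableT_comp (@measurable_path_kernel _ _ hrho _) mU).
  have maKP : measurable_fun setT (fun z : T' s1 * n.+1.-tuple R =>
      (a (hd z.2))%:E * ((path_kernel rho (U z))%:E * Psi (Y2 z))).
    apply: emeasurable_funM => //; apply/measurable_EFinP.
    exact: (measurableT_comp ma m21).
  have mG : measurable_fun setT G.
    apply: emeasurable_funM => //.
    exact: (measurableT_comp (measurable_expeR_psum hs1 lf) measurable_fst).
  have KP0 z : 0 <= (path_kernel rho (U z))%:E * Psi (Y2 z).
    by rewrite mule_ge0// lee_fin path_kernel_ge0.
  have aKP0 (z : T' s1 * n.+1.-tuple R) :
      0 <= (a (hd z.2))%:E * ((path_kernel rho (U z))%:E * Psi (Y2 z)).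
    by rewrite mule_ge0// lee_fin.
  have G0 z : 0 <= G z by rewrite mule_ge0 ?expeR_ge0.
  have A4 (c e b k p : \bar R) : c * (e * (b * k)) * p = c * (e * (b * (k * p))).
    by rewrite -!muleA.
  rewrite (_ : (fun z => w2 z * Psi (Y2 z)) = (fun z => (rising r n.+1)%:E * G z)); last first.
    by apply/funext => z; exact: A4.
  rewrite ge0_integralZl//; congr (_ * _).
  rewrite (@fubini_tonelli1 _ _ _ _ _ (P' s1) (@lebesgue_tuple R n.+1) G)//.
  apply: eq_integralT => w; rewrite /fubini_F.
  pose Gw (v : n.+1.-tuple R) := (a (hd v))%:E *
    ((path_kernel rho (U (w, v)))%:E * Psi (Y2 (w, v))).
  have mGw : measurable_fun setT Gw by exact: (measurableT_comp maKP (pair1_measurable w)).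
  have Gw0 v : 0 <= Gw v by exact: (aKP0 (w, v)).
  rewrite (_ : (fun y => G (w, y)) = (fun v => expeR (- psum (@J' s1) f w) * Gw v))//.
  rewrite ge0_integralZl//; last exact: expeR_ge0.
  congr (_ * _); rewrite integral_lebesgue_cons//.
  apply: eq_integralT => x; rewrite /path_int -ge0_integralZl//.
  - by apply: eq_integralT => u; rewrite /Gw /Y2 /U /= tlE hdE.
  - have mwx : measurable_fun setT (fun u : n.-tuple R => (w, tuple_cons (x, u))).
      apply: (measurableT_comp (pair1_measurable w)).
      exact: (measurableT_comp (@measurable_tuple_cons R n) (pair1_measurable x)).
    have := measurableT_comp mKP mwx.
    rewrite (_ : _ \o _ = (fun u => (path_kernel rho (tuple_rcons u (tsum (@J' s1) w + `|x|)%R))%:E *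
      Psi (tuple_rcons u (tsum (@J' s1) w + `|x|)%R, x)))//.
    by apply/funext => u; rewrite /= /Y2 /U /= !tlE hdE.
  - by move=> u _; rewrite mule_ge0// lee_fin path_kernel_ge0.
  - by rewrite lee_fin.
move=> Phi0 mPhi; rewrite -Fub//.
pose Gr : set (set (n.+1.-tuple R * R)) :=
  [set A `*` B | A in measurable & B in measurable].
apply: (@eq_integral_law_pi _ _ _ _ _ _ _ P m2 w1 w2 Y1 Y2 w10 w20 mw1 mw2 mY1 mY2 Gr) => //.
- exact: measurable_prod_measurableType.
- move=> _ _ [A mA [B mB <-]] [A' mA' [B' mB' <-]].
  exists (A `&` A'); first exact: measurableI.
  by exists (B `&` B'); [exact: measurableI|rewrite setXI].
- by exists setT => //; exists setT => //; rewrite setXTT.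
- move=> _ [D mD [A mA <-]].
  have iX v x : \1_(D `*` A) (v, x) = (\1_D v * \1_A x)%R :> R.
    by rewrite !indicE in_setX -natrM mulnb.
  rewrite (Fub (fun z => (\1_(D `*` A) z)%:E)); last 2 first.
  + by move=> z; rewrite lee_fin.
  + by apply/measurable_EFinP/measurable_indic; exact: measurableX.
  (* On a rectangle three formulas combine: [integral_pick] produces this [h], [chain_law_point]
     passes to [BN(s)], and [mecke_tsum] removes the point and passes to [BN(s + 1)]. *)
  pose h x : R := (`|x| * \1_A x)%R.
  have lh : linbd h.
    apply: (@linbdM _ 1%R); [exact: linbd_norm|exact: measurable_indic|].
    by move=> x; rewrite indicE; case: (x \in A); rewrite ?ler01 ?lexx.
  pose psiD (v : n.+1.-tuple R) : \bar R := (\1_D v)%:E.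
  have psiD0 v : 0 <= psiD v by rewrite lee_fin.
  have mpsiD : measurable_fun setT psiD by exact/measurable_EFinP/measurable_indic.
  transitivity ((rising r n)%:E * \int[P' s]_w (expeR (- psum (@J' s) f w) * psum (@J' s) h w *
      path_int rho psiD (tsum (@J' s) w))); last first.
    rewrite (mecke_tsum hrho s0 hs hs1' lf lh); last 2 first.
    + by move=> t; exact: path_int_ge0.
    + exact: measurable_path_int.
    rewrite muleA -EFinM -risingS.
    apply: (congr1 (fun y => (rising r n.+1)%:E * y)).
    apply: eq_integralT => w.
    apply: (congr1 (fun y => expeR (- psum (@J' s1) f w) * y)).
    apply: eq_integralT => x.
    rewrite (_ : path_int rho (fun v => (\1_(D `*` A) (v, x))%:E) _ =
      (\1_A x)%:E * path_int rho psiD (tsum (@J' s1) w + `|x|)%R); last first.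
      rewrite /path_int -ge0_integralZl//.
      + by apply: eq_integralT => u; rewrite iX (EFinM (\1_D _)) muleA muleC.
      + have mr : measurable_fun setT (fun u : n.-tuple R =>
          tuple_rcons u (tsum (@J' s1) w + `|x|)%R) by exact: measurable_tuple_rcons.
        apply: emeasurable_funM; last exact: (measurableT_comp mpsiD mr).
        apply/measurable_EFinP.
        exact: (measurableT_comp (@measurable_path_kernel _ _ hrho _) mr).
      + by move=> u _; rewrite mule_ge0// lee_fin path_kernel_ge0.
    rewrite muleA -EFinM; congr (_%:E * _); rewrite /a /tilt /h; ring.
  rewrite -(chain_law_point lf lh mD).
  pose Z w := expeR (- rest J_ Jt_ n f w) * `|rsum J_ Jt_ n w|%R%:E * psiD (rsum_tuple n w).
  transitivity (\int[P]_w (Z w * (\1_A (Jt_ n w))%:E)).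
    by apply: eq_integralT => w; rewrite /Y1 iX EFinM muleA.
  have Z0 w : 0 <= Z w by apply: mule_ge0; [exact: w10|exact: psiD0].
  have mZ : measurable_fun setT (Z : past J Jt n -> \bar R).
    have mJp := @measurable_J_past _ _ _ _ J Jt n.
    have mJtp := @measurable_Jt_past _ _ _ _ J Jt n.
    apply: emeasurable_funM; first apply: emeasurable_funM.
    - apply: (measurableT_comp (@measurable_expeR R)); apply: measurableT_comp => //.
      by apply: (@measurable_rest _ (past J Jt n) R J_ Jt_ n) => //; exact: linbd_ge0.
    - apply/measurable_EFinP; apply: measurableT_comp; first exact: normr_measurable.
      exact: (@measurable_rsum _ (past J Jt n) R J_ Jt_ n).
    - apply: (measurableT_comp mpsiD).
      exact: (@measurable_rsum_tuple _ (past J Jt n) J_ Jt_ n).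
  rewrite (integral_pick hrho r0 hJ hJt mA Z0 mZ).
  apply: ge0_ae_eq_integralT => [w|w|].
  - by rewrite mule_ge0// mule_ge0// rest_ge0// => x; exact: (linbd_ge0 lh).
  - apply: mule_ge0; last by apply: rest_ge0; exact: (linbd_ge0 lh).
    by apply: mule_ge0; [exact: expeR_ge0|exact: psiD0].
  - apply: filterS (ae_good hrho r0 hJ hJt n) => w gw; rewrite /Z.
    have r1 : `|rsum J_ Jt_ n w|%R%:E * `|(rsum J_ Jt_ n w)^-1|%R%:E = 1 :> \bar R.
      by rewrite -EFinM -normrM mulfV ?normr1// gt_eqF// rsum_gt0.
    by rewrite muleA (muleAC (_ * _) (psiD _)) -(muleA (expeR _)) r1 mule1.
- apply: (@le_lt_trans _ _ (\int[P]_w cst 1 w)).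
    apply: ge0_ae_le_integralT => //.
    apply: filterS (ae_good hrho r0 hJ hJt n) => w gw.
    have r1 := rsum_gt0 gw; rewrite /w1 gtr0_norm//.
    have gw0 := good_upto_leq (leq0n n) gw.
    rewrite -(fineK (rest_fin n gw0 lf)) -EFinM lee_fin.
    have : (rsum J_ Jt_ n w <= fine (rest J_ Jt_ n f w))%R.
      rewrite -lee_fin -(rsumE gw) fineK; last exact: rest_fin.
      apply: lee_nneseries => [i _ _|i _]; rewrite lee_fin; case: ifP => //.
    move=> le1; rewrite expRN mulrC ler_pdivrMr ?expR_gt0// mul1r.
    apply: (le_trans le1); have := expR_ge1Dx (fine (rest J_ Jt_ n f w)); lra.
  rewrite integral_cst// mul1e; apply: (@le_lt_trans _ _ 1); last exact: ltry.
  exact: probability_le1.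
Qed.

(** With [g = f + |x|], the exponent [rest n g] splits into [f] at the pick, [rest n.+1 f] and the
    remaining sum. The factors of [unweight] cancel all but [expeR (- rest n.+1 f)]. *)
Lemma chain_lawS : chain_law n.+1.
Proof.
move=> f lf psi psi0 mpsi.
pose g x := (f x + 1 * `|x|)%R.
have lg : linbd g by apply: linbdD => //; apply: linbdZ => //; exact: linbd_norm.
have gx x : (`|x| <= g x)%R by rewrite /g mul1r lerDr; exact: linbd_ge0.
have := chain_law_pick lg gx (unweight_ge0 f psi0) (measurable_unweight lf mpsi).
move=> H; transitivity (\int[P]_w (expeR (- rest J_ Jt_ n g w) * `|rsum J_ Jt_ n w|%R%:E *
    unweight f psi (rsum_tuple n w, Jt_ n w))).
  apply: ge0_ae_eq_integralT => [w|w|].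
  - by rewrite mule_ge0 ?expeR_ge0.
  - by rewrite mule_ge0 ?unweight_ge0// mule_ge0 ?expeR_ge0.
  - apply: filterS (ae_good hrho r0 hJ hJt n.+1) => w gw.
    have gw' := good_upto_leq (leqnSn n) gw.
    have gw0 := good_upto_leq (leq0n n) gw'.
    have X0 := rsum_gt0 gw'.
    rewrite /unweight /= rsum_tupleS nth_rsum_tuple// rsumS.
    rewrite restD; [|exact: linbd_ge0|by move=> x; rewrite mul1r].
    rewrite restZ// (rsumE gw') mul1e (restS gw (linbd_ge0 lf)).
    rewrite -(fineK (rest_fin n.+1 gw0 lf)) -!EFinD /= (gtr0_norm X0) gtr0_norm ?invr_gt0//.
    rewrite muleCA (muleC (psi _)) -!EFinM; congr (_%:E * _).
    rewrite !opprD !expRD !expRN.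
    by field; rewrite !gt_eqF ?expR_gt0.
rewrite H -/s1; apply: (congr1 (fun y => (rising r n.+1)%:E * y)).
(* [path_int_unweight] holds at positive [t] only. *)
have pos : {ae P' s1, forall w, (0 < tsum (@J' s1) w)%R}.
  case: (hs1) => _ J0 _; apply: filterS (psum_fin hrho s10 hs1) => w fw.
  rewrite -lte_fin /tsum fineK ?fw//; last exact: linbd_norm.
  rewrite /psum (@nneseriesD1 _ _ 0%N xpredT)//.
  rewrite (@lt_le_trans _ _ `|@J' s1 0%N w|%:E) ?lte_fin ?normr_gt0 ?gt_eqF//.
  by rewrite leeDl// nneseries_ge0// => k _ _; rewrite lee_fin.
apply: ge0_ae_eq_integralT => [w|w|].
- rewrite mule_ge0 ?expeR_ge0//; apply: integral_ge0 => x _.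
  rewrite mule_ge0//; last by apply: path_int_ge0 => // v; exact: unweight_ge0.
  by rewrite lee_fin mulr_ge0 ?rho0_ge0// mulr_ge0 ?expR_ge0.
- by rewrite mule_ge0 ?expeR_ge0 ?path_int_ge0.
- apply: filterS2 pos (expeR_psum_tsum hrho s10 hs1) => w t0 /(_ f 1%R lf ler01) E.
  rewrite path_int_unweight// E mul1r -muleA (muleA (expR _)%:E) -EFinM -expRD.
  by rewrite addNr expR0 mul1e.
Qed.

End step.

Lemma chain_lawP n : chain_law n.
Proof. by elim: n => [|n ih]; [exact: chain_law0|exact: chain_lawS]. Qed.

End chain.

(** * Joint and transition densities *)

Section density.
Context (R : realType) (r : R) (rho : R -> R) (g : R -> R -> R).
Hypothesis hrho : infinite_levy_density rho.

Lemma joint_densityE n (v : n.+1.-tuple R) :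
  joint_density r rho g v = rising r n * g (r + n%:R) v`_n * path_kernel rho v.
Proof.
rewrite /joint_density; case: ifPn => [/andP[/forallP dec vn0]|].
  rewrite /path_kernel vn0 mul1r; congr (_ * _); apply: eq_bigr => i _.
  (* Only the last coordinate is assumed positive; the decrease carries this back to the others, as
     [step_kernel] requires. *)
  have pos k : (k <= n)%N -> 0 < v`_(n - k).
    elim: k => [|k ih] kn; first by rewrite subn0.
    apply: (lt_trans (ih (ltnW kn))).
    have kn' : (n - k.+1 < n)%N by rewrite -subn_gt0 subKn.
    by have := dec (Ordinal kn'); rewrite /= subnSK.
  have vi : 0 < v`_i.+1.
    by have := pos (n - i.+1)%N (leq_subr _ _); rewrite subKn.
  by rewrite /step_kernel vi (dec i)/= /Theta /rho0 subr_gt0 (dec i).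
rewrite negb_and => /orP[|/negbTE vn0]; last by rewrite /path_kernel vn0 mul0r mulr0.
rewrite negb_forall => /existsP[i /negbTE di].
rewrite /path_kernel (bigD1 i)//= {1}/step_kernel di andbF mul0r.
by rewrite !mulr0.
Qed.

Lemma trans_densityE n t y : trans_density r rho g n t y =
  (r + n%:R) * step_kernel rho t y * (g (r + n%:R + 1) y / g (r + n%:R) t).
Proof.
rewrite /trans_density /step_kernel; case: ifPn => [/andP[y0 yt]|_]; last first.
  by rewrite mulr0 mul0r.
by rewrite /Theta /rho0 subr_gt0 yt.
Qed.

End density.

Section density_integral.
Local Open Scope ereal_scope.
Context d (T : measurableType d) (R : realType) (P : probability T R)
  d' (S : measurableType d') (m : {measure set S -> \bar R}).

Lemma integral_has_density (X : T -> S) (f : S -> R) : has_density P m X f ->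
  forall psi : S -> \bar R, (forall x, 0 <= psi x) -> measurable_fun setT psi ->
  \int[P]_w psi (X w) = \int[m]_x ((f x)%:E * psi x).
Proof.
move=> [mX mf f0 hf] psi psi0 mpsi.
transitivity (\int[P]_w (cst 1 w * psi (X w))).
  by apply: eq_integralT => w; rewrite mul1e.
apply: (@eq_integral_law _ _ _ _ _ S _ P m (cst 1) (fun x => (f x)%:E) X id) => //.
- exact/measurable_EFinP.
- move=> A mA.
  transitivity (P (X @^-1` A)).
    rewrite -[X in P X]setIT -integral_indic//; last first.
      by rewrite -[X in measurable X]setTI; exact: mX.
    by apply: eq_integralT => w; rewrite mul1e.
  rewrite hf// integral_mkcond; apply: eq_integralT => x.
  by rewrite patchE indicE; case: (x \in A); rewrite ?mule1 ?mule0.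
Qed.

End density_integral.

Section remaining.
Context d (T : measurableType d) (R : realType) (P : probability T R).
Variables (rho : R -> R) (r : R) (J Jt : nat -> {RV P >-> R}).
Hypothesis hrho : infinite_levy_density rho.
Hypothesis r0 : 0 < r.
Hypothesis hJ : bn_points P rho r (fun i => J i : T -> R).
Hypothesis hJt : size_biased_picks J Jt.
Variables (d' : R -> measure_display) (T' : forall s : R, measurableType (d' s))
  (P' : forall s : R, probability (T' s) R)
  (J' : forall s : R, nat -> {RV (P' s) >-> R}) (g : R -> R -> R).
Hypothesis hJ' : forall s, 0 < s -> bn_points (P' s) rho s (fun i => @J' s i : T' s -> R).
Hypothesis hg : forall s : R, 0 < s ->
  has_density (P' s) (@lebesgue_measure R) (sum_points (@J' s)) (g s).
Notation mu := (@lebesgue_measure R).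

Let X := remaining_sum J Jt.

Lemma remaining_sum_rsum n w :
  X n w = rsum (fun i => J i : T -> R) (fun i => Jt i : T -> R) n w.
Proof.
elim: n => [|n ih] /=; last by rewrite rsumS -ih.
by rewrite /rsum big_ord0 subr0 /X/= (sum_points_tsum hJ).
Qed.

Definition remaining_tuple n w : n.+1.-tuple R := [tuple X i w | i < n.+1].

Lemma remaining_tuple_rsum n : remaining_tuple n = rsum_tuple J Jt n.
Proof.
apply/funext => w; apply: eq_from_tnth => i.
by rewrite !tnth_mktuple remaining_sum_rsum.
Qed.

Lemma nth_remaining_tuple n i w : (i <= n)%N -> (remaining_tuple n w)`_i = X i w.
Proof. by move=> i_n; rewrite remaining_tuple_rsum nth_rsum_tuple// remaining_sum_rsum. Qed.

Lemma remaining_tupleS n w :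
  remaining_tuple n.+1 w = tuple_rcons (remaining_tuple n w) (X n.+1 w).
Proof. by rewrite !remaining_tuple_rsum rsum_tupleS remaining_sum_rsum. Qed.

Lemma measurable_remaining_tuple n : measurable_fun setT (remaining_tuple n).
Proof.
rewrite remaining_tuple_rsum; apply: measurable_rsum_tuple.
  by move=> i; exact: measurable_funPT.
by move=> k _; exact: measurable_funPT.
Qed.

Lemma measurable_remaining_sum n : measurable_fun setT (X n).
Proof.
rewrite (_ : X n = (fun v : n.+1.-tuple R => v`_n) \o remaining_tuple n).
  apply: measurableT_comp; last exact: measurable_remaining_tuple.
  exact: measurable_nth_tuple.
by apply/funext => w; rewrite /= nth_remaining_tuple.
Qed.

Let s_gt0 n : 0 < r + n%:R. Proof. by rewrite ltr_pwDl. Qed.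

Let mg n : measurable_fun setT (g (r + n%:R)). Proof. by case: (hg (s_gt0 n)). Qed.
Let g0 n x : 0 <= g (r + n%:R) x. Proof. by case: (hg (s_gt0 n)). Qed.

Let joint n (v : n.+1.-tuple R) := joint_density r rho g v.

Lemma joint_density_ge0 n (v : n.+1.-tuple R) : 0 <= joint v.
Proof.
rewrite /joint joint_densityE; apply: mulr_ge0; last exact: path_kernel_ge0.
by apply: mulr_ge0; [exact: rising_ge0|exact: g0].
Qed.

Lemma measurable_joint_density n : measurable_fun setT (@joint n).
Proof.
rewrite (_ : @joint n = fun v : n.+1.-tuple R =>
  rising r n * g (r + n%:R) v`_n * path_kernel rho v); last first.
  by apply/funext => v; rewrite /joint joint_densityE.
apply: measurable_funM; last exact: measurable_path_kernel.
apply: measurable_funM => //; apply: (measurableT_comp (mg n)).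
exact: measurable_nth_tuple.
Qed.

(** This is [chain_law] at [f = 0]: the total sum of [BN(r + n)] has density [g (r + n)], which is
    integrated against [path_int], and Fubini makes the last coordinate the inner variable. *)
Lemma remaining_has_density n :
  has_density P (@lebesgue_tuple R n.+1) (remaining_tuple n) (@joint n).
Proof.
split; [exact: measurable_remaining_tuple|exact: measurable_joint_density|
  exact: joint_density_ge0|move=> A mA].
pose psi (v : n.+1.-tuple R) : \bar R := (\1_A v)%:E.
have psi0 v : (0 <= psi v)%E by rewrite lee_fin.
have mpsi : measurable_fun setT psi by exact/measurable_EFinP/measurable_indic.
have mpi := measurable_path_int hrho psi0 mpsi.
have pi0 t : (0 <= path_int rho psi t)%E by exact: path_int_ge0.
have rn0 : (0 <= (rising r n)%:E :> \bar R)%E by rewrite lee_fin rising_ge0.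
transitivity (\int[P]_w psi (remaining_tuple n w))%E.
  rewrite -[X in P X]setIT -integral_indic//.
  by rewrite -[X in measurable X]setTI; exact: measurable_remaining_tuple.
rewrite remaining_tuple_rsum.
transitivity ((rising r n)%:E * \int[P' (r + n%:R)]_w path_int rho psi (sum_points (@J' (r + n%:R)) w))%E.
  have := chain_lawP hrho r0 hJ hJt hJ' (linbd0 R) psi0 mpsi.
  rewrite (_ : (fun w => _ * _)%E = (fun w => psi (rsum_tuple J Jt n w))); last first.
    apply/funext => w; rewrite (_ : rest _ _ _ _ _ = 0%E) ?oppe0 ?expeR0 ?mul1e//.
    by rewrite /rest eseries0// => i _ _; case: ifP.
  move=> ->; congr (_ * _)%E; apply: eq_integralT => w.
  by rewrite /psum eseries0// oppe0 expeR0 mul1e -(sum_points_tsum (hJ' (s_gt0 n))).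
rewrite (integral_has_density (hg (s_gt0 n)) pi0 mpi).
rewrite -ge0_integralZl//; last 2 first.
- by apply: emeasurable_funM => //; apply/measurable_EFinP; exact: mg.
- by move=> x _; rewrite mule_ge0// lee_fin.
pose G (z : n.-tuple R * R) : \bar R :=
  ((joint (tuple_rcons z.1 z.2))%:E * psi (tuple_rcons z.1 z.2))%E.
have mr : measurable_fun setT (fun z : n.-tuple R * R => tuple_rcons z.1 z.2).
  exact: measurable_tuple_rcons.
have G0 z : (0 <= G z)%E by rewrite mule_ge0// lee_fin joint_density_ge0.
have mG : measurable_fun setT G.
  apply: emeasurable_funM; last exact: (measurableT_comp mpsi mr).
  by apply/measurable_EFinP; exact: (measurableT_comp (@measurable_joint_density n) mr).
transitivity (\int[mu]_t \int[@lebesgue_tuple R n]_u G (u, t))%E.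
  apply: eq_integralT => t.
  have mrt : measurable_fun setT (fun u : n.-tuple R => tuple_rcons u t).
    exact: measurable_tuple_rcons.
  rewrite muleA -EFinM /path_int -ge0_integralZl//.
  - apply: eq_integralT => u; rewrite muleA -EFinM /G /joint joint_densityE.
    by rewrite nth_tuple_rcons ltnn eqxx.
  - apply: emeasurable_funM; last exact: (measurableT_comp mpsi mrt).
    apply/measurable_EFinP.
    exact: (measurableT_comp (@measurable_path_kernel _ _ hrho _) mrt).
  - by move=> u _; rewrite mule_ge0// lee_fin path_kernel_ge0.
  - by rewrite lee_fin mulr_ge0// rising_ge0.
rewrite -(fubini_tonelli (m1 := @lebesgue_tuple R n) (m2 := mu) G)//.
rewrite [RHS]integral_mkcond.
transitivity (\int[@lebesgue_tuple R n.+1]_v ((joint v)%:E * psi v))%E.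
  rewrite [RHS]integral_lebesgue_rcons//.
  - by move=> v; rewrite mule_ge0// lee_fin joint_density_ge0.
  - by apply: emeasurable_funM => //; apply/measurable_EFinP; exact: measurable_joint_density.
apply: eq_integralT => v; rewrite patchE /psi indicE.
by case: (v \in A); rewrite ?mule1 ?mule0.
Qed.

(** The denominator of [trans_density] cancels the factor [g (r + n)] of the shorter path. *)
Let joint_rcons n (u : n.+1.-tuple R) y : g (r + n%:R) u`_n != 0 ->
  joint (tuple_rcons u y) = joint u * trans_density r rho g n u`_n y.
Proof.
move=> gu; rewrite /joint !joint_densityE trans_densityE path_kernel_rcons.
rewrite nth_tuple_rcons ltnn eqxx /rising big_ord_recr/= -/(rising r n) -natr1 addrA.
by field.
Qed.

Let measurable_trans n d1 (S : measurableType d1) (t y : S -> R) :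
  measurable_fun setT t -> measurable_fun setT y ->
  measurable_fun setT (fun z => trans_density r rho g n (t z) (y z)).
Proof.
move=> mt my; rewrite (_ : (fun z => _) = (fun z => (r + n%:R) *
    step_kernel rho (t z) (y z) * (g (r + n.+1%:R) (y z) / g (r + n%:R) (t z)))); last first.
  by apply/funext => z; rewrite trans_densityE -natr1 addrA.
apply: measurable_funM.
  by apply: measurable_funM => //; exact: measurable_step_kernel.
apply: measurable_fun_div; first exact: (measurableT_comp (mg n.+1) my).
exact: (measurableT_comp (mg n) mt).
Qed.

Let trans_ge0 n t y : 0 <= trans_density r rho g n t y.
Proof.
rewrite trans_densityE mulr_ge0//.
  by rewrite mulr_ge0 ?step_kernel_ge0// ltW.
by rewrite divr_ge0// -addrA natr1.
Qed.

Definition transition n (C : set R) (t : R) : \bar R :=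
  (\int[mu]_(y in C) (trans_density r rho g n t y)%:E)%E.

Lemma transition_indic n C t : transition n C t =
  (\int[mu]_y ((trans_density r rho g n t y)%:E * (\1_C y)%:E))%E.
Proof.
rewrite /transition integral_mkcond; apply: eq_integralT => y.
by rewrite patchE indicE; case: (y \in C); rewrite ?mule1 ?mule0.
Qed.

Lemma transition_ge0 n C t : (0 <= transition n C t)%E.
Proof. by apply: integral_ge0 => y _; rewrite lee_fin trans_ge0. Qed.

Lemma measurable_transition n C : measurable C ->
  measurable_fun setT (transition n C).
Proof.
move=> mC.
pose F (z : R * R) : \bar R := ((trans_density r rho g n z.1 z.2)%:E * (\1_C z.2)%:E)%E.
rewrite (_ : transition n C = (fun t => \int[mu]_y F (t, y))%E); last first.
  by apply/funext => t; exact: transition_indic.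
apply: (@measurable_fun_fubini_tonelli_F _ _ _ _ _ mu F).
  apply: emeasurable_funM.
    by apply/measurable_EFinP; exact: measurable_trans.
  apply/measurable_EFinP.
  exact: (measurableT_comp (measurable_indic mC) measurable_snd).
by move=> z; rewrite mule_ge0// lee_fin trans_ge0.
Qed.

(* The division by g_{r+n}(t) in trans_density is harmless: T_n almost surely
   avoids the zeros of g_{r+n}. *)
Let null_density n :
  P (remaining_tuple n @^-1` [set v | g (r + n%:R) v`_n = 0]) = 0%E.
Proof.
have m1 : measurable_fun setT (fun v : n.+1.-tuple R => g (r + n%:R) v`_n).
  exact: (measurableT_comp (mg n) (measurable_nth_tuple (ltnSn n))).
have mZ : measurable [set v : n.+1.-tuple R | g (r + n%:R) v`_n = 0].
  rewrite -[X in measurable X]setTI.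
  exact: (m1 measurableT [set 0] (measurable_set1 0)).
have [_ _ _ ->//] := remaining_has_density n.
rewrite integral0_eq// => v /= gv.
by rewrite /joint joint_densityE gv mulr0 mul0r.
Qed.

Lemma transition_prob n (D : set (n.+1.-tuple R)) (C : set R) :
  measurable D -> measurable C ->
  P ((X n.+1 @^-1` C) `&` (remaining_tuple n @^-1` D)) =
  (\int[P]_(w in remaining_tuple n @^-1` D) transition n C (X n w))%E.
Proof.
move=> mD mC.
pose Z := [set v : n.+1.-tuple R | g (r + n%:R) v`_n = 0].
have mgn : measurable_fun setT (fun v : n.+1.-tuple R => g (r + n%:R) v`_n).
  exact: (measurableT_comp (mg n) (measurable_nth_tuple (ltnSn n))).
have mZ : measurable Z.
  rewrite -[X in measurable X]setTI.
  exact: (mgn measurableT [set 0] (measurable_set1 0)).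
(* Removing [Z] costs nothing in probability and makes [joint_rcons] available; on the removed paths
   the joint density vanishes. *)
pose D' := D `\` Z.
have mD' : measurable D' by exact: measurableD.
pose front (v : n.+2.-tuple R) : n.+1.-tuple R := [tuple v`_i | i < n.+1].
have frontE u y : front (tuple_rcons u y) = u.
  apply: eq_from_tnth => i; rewrite tnth_mktuple nth_tuple_rcons ltn_ord.
  by rewrite (tnth_nth 0).
have mfront : measurable_fun setT front.
  apply/measurable_fun_tnthP => i.
  rewrite (_ : _ \o _ = (fun v : n.+2.-tuple R => v`_i)); last first.
    by apply/funext => v; rewrite /= tnth_mktuple.
  by apply: measurable_nth_tuple; exact: ltn_trans (ltn_ord i) _.
pose psi2 (v : n.+2.-tuple R) : \bar R := ((\1_D' (front v))%:E * (\1_C v`_n.+1)%:E)%E.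
have psi20 v : (0 <= psi2 v)%E by rewrite mule_ge0// lee_fin.
have mpsi2 : measurable_fun setT psi2.
  apply: emeasurable_funM; apply/measurable_EFinP.
    exact: (measurableT_comp (measurable_indic mD') mfront).
  exact: (measurableT_comp (measurable_indic mC) (measurable_nth_tuple _)).
pose psi1 (v : n.+1.-tuple R) : \bar R := ((\1_D v)%:E * transition n C v`_n)%E.
have psi10 v : (0 <= psi1 v)%E by rewrite mule_ge0 ?lee_fin// transition_ge0.
have mpsi1 : measurable_fun setT psi1.
  apply: emeasurable_funM; first exact/measurable_EFinP/measurable_indic.
  apply: (measurableT_comp (measurable_transition n mC)).
  exact: measurable_nth_tuple.
transitivity (\int[P]_w psi2 (remaining_tuple n.+1 w))%E.
  transitivity (\int[P]_w (\1_((X n.+1 @^-1` C) `&` (remaining_tuple n @^-1` D)) w)%:E)%E.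
    rewrite integral_indic ?setIT//; apply: measurableI.
      by rewrite -[X in measurable X]setTI; exact: measurable_remaining_sum.
    by rewrite -[X in measurable X]setTI; exact: measurable_remaining_tuple.
  apply: ge0_ae_eq_integralT => //.
  exists (remaining_tuple n @^-1` Z); split; [|exact: null_density|].
    by rewrite -[X in measurable X]setTI; exact: measurable_remaining_tuple.
  move=> w /= H; apply: contrapT => nZ; apply: H.
  rewrite /psi2 remaining_tupleS frontE nth_tuple_rcons ltnn eqxx -EFinM; congr EFin.
  rewrite !indicE -natrM mulnb; congr ((nat_of_bool _)%:R); apply/idP/andP.
    rewrite inE => -[/= CX DX]; split; last by rewrite inE.
    by rewrite inE; split.
  by rewrite !inE => -[[/= DX _] CX]; split.
rewrite (integral_has_density (remaining_has_density n.+1) psi20 mpsi2).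
rewrite [RHS]integral_mkcond.
transitivity (\int[P]_w psi1 (remaining_tuple n w))%E; last first.
  apply: eq_integralT => w; rewrite patchE /psi1 nth_remaining_tuple// indicE.
  have -> : (remaining_tuple n w \in D) = (w \in remaining_tuple n @^-1` D).
    by apply/idP/idP; rewrite !inE.
  by case: (w \in _); rewrite ?mul1e ?mul0e.
rewrite (integral_has_density (remaining_has_density n) psi10 mpsi1).
rewrite integral_lebesgue_rcons//; last 2 first.
- by move=> v; rewrite mule_ge0// lee_fin joint_density_ge0.
- by apply: emeasurable_funM => //; apply/measurable_EFinP; exact: measurable_joint_density.
apply: eq_integralT => u.
rewrite (_ : (fun y => _ * psi2 _)%E = (fun y => (\1_D' u)%:E *
    ((joint (tuple_rcons u y))%:E * (\1_C y)%:E))%E); last first.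
  apply/funext => y; rewrite /psi2 frontE nth_tuple_rcons ltnn eqxx muleCA.
  by [].
rewrite /psi1 !indicE.
have [gu|gu] := eqVneq (g (r + n%:R) u`_n) 0.
  rewrite (_ : u \in D' = false); last first.
    by apply/negP; rewrite inE => -[_ /=]; apply.
  have -> : joint u = 0 by rewrite /joint joint_densityE gu mulr0 mul0r.
  by rewrite mul0e integral0_eq// => y _; rewrite mul0e.
have -> : (u \in D') = (u \in D).
  apply/idP/idP; rewrite !inE; first by case.
  by move=> Du; split => //; exact/eqP.
case: (u \in D); last first.
  by rewrite mul0e mule0 integral0_eq// => y _; rewrite mul0e.
rewrite mul1e transition_indic -ge0_integralZl//; last 3 first.
- apply: emeasurable_funM.
    by apply/measurable_EFinP; exact: measurable_trans.
  exact/measurable_EFinP/measurable_indic.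
- by move=> y _; rewrite mule_ge0// lee_fin trans_ge0.
- by rewrite lee_fin joint_density_ge0.
apply: eq_integralT => y; rewrite mul1e muleA joint_rcons//.
Qed.

(** Brings every event of the past of the chain into the form treated by [transition_prob]. *)
Lemma preimages_sub_tuple n :
  <<s preimages `I_n.+1 X >> `<=` preimage_set_system setT (remaining_tuple n) measurable.
Proof.
apply: smallest_sub.
  by apply: sigma_algebra_preimage; exact: sigma_algebra_measurable.
move=> A [i /= i_n [B mB <-]].
exists ((fun v : n.+1.-tuple R => v`_i) @^-1` B).
  by rewrite -[X in measurable X]setTI; exact: measurable_nth_tuple.
apply/seteqP; split => w /= [_]; rewrite nth_remaining_tuple//.
Qed.

(** The Markov property: the version depends on the present value only, so it is measurable for the
    smaller sigma-algebra and is tested against the larger one. *)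
Lemma cond_prob_past n C : measurable C ->
  is_cond_prob P <<s preimages `I_n.+1 X >> (X n.+1 @^-1` C)
    (fun w => transition n C (X n w)) /\
  is_cond_prob P <<s preimages [set n] X >> (X n.+1 @^-1` C)
    (fun w => transition n C (X n w)).
Proof.
move=> mC.
have sub : <<s preimages [set n] X >> `<=` <<s preimages `I_n.+1 X >>.
  apply: sub_sigma_algebra2 => A [i /= -> HA]; exists n => //=.
have m1 A : measurable A -> <<s preimages [set n] X >> ((fun w => transition n C (X n w)) @^-1` A).
  move=> mA; apply: sub_sigma_algebra; exists n => //.
  exists (transition n C @^-1` A); last by rewrite setTI.
  by rewrite -[X in measurable X]setTI; exact: measurable_transition.
have H F : <<s preimages `I_n.+1 X >> F ->
    P ((X n.+1 @^-1` C) `&` F) = (\int[P]_(w in F) transition n C (X n w))%E.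
  by move=> /preimages_sub_tuple[D mD <-]; rewrite setTI; exact: transition_prob.
split; split => //.
- by move=> A mA; apply: sub; exact: m1.
- by move=> F /sub; exact: H.
Qed.

End remaining.

Theorem theorem3p1 (R : realType) (rho : R -> R) (r : R)
  (hrho : infinite_levy_density rho) (hr : 0 < r)
  (d : measure_display) (T : measurableType d) (P : probability T R)
  (B : R.-ker T ~> R) (J Jt : nat -> {RV P >-> R})
  (hB : BN_process r rho B J) (hJt : size_biased_picks J Jt)
  (d' : R -> measure_display) (T' : forall s : R, measurableType (d' s))
  (P' : forall s : R, probability (T' s) R)
  (B' : forall s : R, R.-ker (T' s) ~> R)
  (J' : forall s : R, nat -> {RV (P' s) >-> R})
  (g : R -> R -> R)
  (hB' : forall s : R, 0 < s -> BN_process s rho (B' s) (J' s))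
  (hg : forall s : R, 0 < s ->
    has_density (P' s) (@lebesgue_measure R) (sum_points (J' s)) (g s)) :
  (forall n : nat,
     has_density P (@lebesgue_tuple R n.+1)
       (fun w => [tuple remaining_sum J Jt i w | i < n.+1])
       (joint_density r rho g (n := n))) /\
  (markov_chain P (remaining_sum J Jt) /\
   transition_density P (remaining_sum J Jt) (trans_density r rho g)).
Proof.
have hJ := BN_process_points hrho hB.
have hJ' s (s0 : 0 < s) := BN_process_points hrho (hB' s s0).
split; [|split].
- by move=> n; exact: (remaining_has_density hrho hr hJ hJt hJ' hg).
- split=> [n|n C mC]; first exact: (measurable_remaining_sum Jt hJ).
  exists (fun w => transition rho r g n C (remaining_sum J Jt n w)).
  exact: (cond_prob_past hrho hr hJ hJt hJ' hg).
- by move=> n C mC; case: (cond_prob_past hrho hr hJ hJt hJ' hg n mC).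
Qed.
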